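(* Let $p\in(2,3)$, $\mathbf X=(X,\mathbb X)\in\mathcal D^p([0,T];\mathbb R^d)$, $(y,y')\in\mathcal V^p_X([0,T];\mathbb R^k)$, $e\in\mathbb N$, and consider the controlled rough differential equation $$Y_t=y_t+\int_0^tf(\alpha_s,Y_s)\,\mathrm d\mathbf X_s,\qquad t\in[0,T].\qquad(\ast)$$ (i) If $f\in C^3_b(\mathbb R^{k+e};\mathcal L(\mathbb R^d;\mathbb R^k))$ and $(\alpha,\alpha')\in\mathcal V^p_X([0,T];\mathbb R^e)$, then there exists a unique solution $(Y,Y')\in\mathcal V^p_X([0,T];\mathbb R^k)$ to $(\ast)$. Moreover, there exists a componentwise non-decreasing function $K_p\colon[0,\infty)^5\to[0,\infty)$ (depending only on $p$ and the dimensions) such that $$\|Y,Y'\|_{X,p}\le K_p(\|f\|_{C^2_b},\|y,y'\|_{X,p},\|\alpha\|_p,\|\alpha,\alpha'\|_{X,p},\|\mathbf X\|_p).$$ (ii) Let $f\in C^3_b(\mathbb R^{k+e};\mathcal L(\mathbb R^d;\mathbb R^k))$, $(\alpha,\alpha')\in\mathcal V^p_X([0,T];\mathbb R^e)$ and let $(Y,Y')\in\mathcal V^p_X([0,T];\mathbb R^k)$ be the unique solution to $(\ast)$. Let moreover $(\tilde y,\tilde y')\in\mathcal V^p_X([0,T];\mathbb R^k)$, $(\tilde\alpha,\tilde\alpha')\in\mathcal V^p_X([0,T];\mathbb R^e)$, $\tilde f\in C^3_b(\mathbb R^{k+e};\mathcal L(\mathbb R^d;\mathbb R^k))$, with corresponding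 solution $(\widetilde Y,\widetilde Y')\in\mathcal V^p_X([0,T];\mathbb R^k)$ of $\widetilde Y_t=\tilde y_t+\int_0^t\tilde f(\tilde\alpha_s,\widetilde Y_s)\,\mathrm d\mathbf X_s$, and suppose that $\|Y,Y'\|_{X,p},\|\widetilde Y,\widetilde Y'\|_{X,p}\le K$ for some $K>0$. Then $$|Y_0-\widetilde Y_0|+\|Y,Y';\widetilde Y,\widetilde Y'\|_{X,p}\lesssim|y_0-\tilde y_0|+\|y,y';\tilde y,\tilde y'\|_{X,p}+\|f-\tilde f\|_{C^2_b}+|\alpha_0-\tilde\alpha_0|+\|\alpha,\alpha';\tilde\alpha,\tilde\alpha'\|_{X,p},$$ where the implicit multiplicative constant depends on $p$, $\|f\|_{C^3_b}\vee\|\tilde f\|_{C^3_b}$, $\|\alpha,\alpha'\|_{X,p}$, $\|\tilde\alpha,\tilde\alpha'\|_{X,p}$, $K$ and $\|\mathbf X\|_p$.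
   Context: Fix $T>0$ and $\Delta_T=\{(s,t)\in[0,T]^2:s\le t\}$. $\mathcal L(E_1;E_2)$ is the space of linear maps. $C^k_b$ is the space of $k$-times Fréchet differentiable functions that are continuous and bounded together with all derivatives up to order $k$, with $\|f\|_{C^k_b}=\|f\|_\infty+\|\mathrm Df\|_\infty+\dots+\|\mathrm D^kf\|_\infty$. $X_{s,t}=X_t-X_s$. Variation norms. For a càdlàg path $X\colon[0,T]\to E$, $\|X\|_p=(\sup_{\mathcal P}\sum_{[u,v]\in\mathcal P}|X_v-X_u|^p)^{1/p}$ over partitions $\mathcal P$ of $[0,T]$; $D^p([0,T];E)$ is the set of càdlàg paths with $\|X\|_p<\infty$. For $\mathbb X\colon\Delta_T\to E$, $\|\mathbb X\|_{\frac p2}=(\sup_{\mathcal P}\sum_{[u,v]\in\mathcal P}|\mathbb X_{u,v}|^{p/2})^{2/p}$; $D_2^{p/2}(\Delta_T;E)$ is the set of $\mathbb X$ with $\|\mathbb X\|_{\frac p2}<\infty$ such that $s\mapsto\mathbb X_{s,t}$ and $t\mapsto\mathbb X_{s,t}$ are càdlàg. Rough paths. $\mathbf X=(X,\mathbb X)\in\mathcal D^p([0,T];\mathbb R^d)$ (càdlàg $p$-rough path) if $X\in D^p([0,T];\mathbb R^d)$, $\mathbb X\in D_2^{p/2}(\Delta_T;\mathbb R^{d\times d})$ and $\mathbb X_{s,t}=\mathbb X_{s,u}+\mathbb X_{u,t}+X_{s,u}\otimes X_{u,t}$ for $s\le u\le t$. $\|\mathbf X\|_p=\|X\|_p+\|\mathbb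 X\|_{\frac p2}$. Controlled paths. $(Y,Y')\in\mathcal V^p_X([0,T];E)$ if $Y\in D^p([0,T];E)$, $Y'\in D^p([0,T];\mathcal L(\mathbb R^d;E))$ and $R^Y\in D_2^{p/2}(\Delta_T;E)$, $R^Y_{s,t}=Y_{s,t}-Y'_sX_{s,t}$. $\|Y,Y'\|_{X,p}=|Y'_0|+\|Y'\|_p+\|R^Y\|_{\frac p2}$, and $\|Y,Y';\widetilde Y,\widetilde Y'\|_{X,p}=|Y'_0-\widetilde Y'_0|+\|Y'-\widetilde Y'\|_p+\|R^Y-R^{\widetilde Y}\|_{\frac p2}$ for $(Y,Y'),(\widetilde Y,\widetilde Y')\in\mathcal V^p_X$. Rough integral. For $(V,V')\in\mathcal V^p_X([0,T];\mathcal L(\mathbb R^d;\mathbb R^k))$, $\int_s^tV_r\,\mathrm d\mathbf X_r=\lim_{|\mathcal P|\to0}\sum_{[u,v]\in\mathcal P}(V_uX_{u,v}+V'_u\mathbb X_{u,v})$ over partitions of $[s,t]$ with mesh tending to $0$, using $\mathcal L(\mathbb R^d;\mathcal L(\mathbb R^d;\mathbb R^k))\cong\mathcal L(\mathbb R^d\otimes\mathbb R^d;\mathbb R^k)$. In $(\ast)$ the integrand is the controlled path $(f((\alpha,Y)),\mathrm Df((\alpha,Y))(\alpha',Y'))$, and a solution is a controlled path $(Y,Y')\in\mathcal V^p_X([0,T];\mathbb R^k)$ with $Y'=y'+f((\alpha,Y))$ satisfying $(\ast)$. $A\lesssim B$ means $A\le CB$ for a constant $C$ whose dependence on the listed variables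 is locally bounded (it may also depend on dimensions). *)

(* Defs.v *)
From HB Require Import structures.
From mathcomp Require Import all_boot all_order all_algebra.
From mathcomp Require Import all_classical all_reals all_analysis.

Set Implicit Arguments.
Unset Strict Implicit.
Unset Printing Implicit Defensive.

Import Order.TTheory GRing.Theory Num.Theory.
Import numFieldNormedType.Exports.
Local Open Scope classical_set_scope.
Local Open Scope ring_scope.

(* R^n is the space of row vectors 'rV[R]_n.  A finite-dimensional target space
   E is a matrix space 'M[R]_(a, b) (E = R^k is a = 1, b = k), with the norm of
   the library (maximum of the absolute values of the entries).  The space
   L(R^n; E) is represented by the matrices of the linear maps
   h |-> mxvec (A h), so that it is again a normed matrix space and can in turn
   be the target of linear maps: L(R^d; L(R^d; E)) is linmx R d d (a * b). *)
Notation linmx R n a b := ('M[R]_(n, (a * b)%N)) (only parsing).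

Section LinearMaps.
Context {R : realType}.

Definition lapp {n a b : nat} (A : linmx R n a b) (h : 'rV[R]_n) : 'M[R]_(a, b) :=
  vec_mx (h *m A).

Definition mklin {n a b : nat} (g : 'rV[R]_n -> 'M[R]_(a, b)) : linmx R n a b :=
  lin1_mx (fun h => mxvec (g h)).

Lemma mklinK (n a b : nat) (g : {linear 'rV[R]_n -> 'M[R]_(a, b)}) h :
  lapp (mklin g) h = g h.
Proof.
rewrite /lapp /mklin.
by rewrite (mul_rV_lin1 (mxvec \o g : {linear _ -> _})) /= mxvecK.
Qed.

Definition tensor {d : nat} (u v : 'rV[R]_d) : 'M[R]_d := u^T *m v.

(* L(R^d; L(R^d; E)) acting on R^d (x) R^d *)
Definition lapp2 {d a b : nat} (A : linmx R d d (a * b)) (M : 'M[R]_d) :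
    'M[R]_(a, b) :=
  \sum_(i < d) \sum_(j < d)
    M i j *: lapp (lapp A (delta_mx 0 i)) (delta_mx 0 j).

Lemma lapp2_tensor (d a b : nat) (A : linmx R d d (a * b)) (u v : 'rV[R]_d) :
  lapp2 A (tensor u v) = lapp (lapp A u) v.
Proof.
have lapp_sum n' a' b' (B : linmx R n' a' b') (w : 'rV[R]_n') :
    lapp B w = \sum_i w 0 i *: lapp B (delta_mx 0 i).
  rewrite {1}[w]row_sum_delta /lapp mulmx_suml linear_sum/=.
  by apply: eq_bigr => i _; rewrite -scalemxAl linearZ.
rewrite /lapp2 [lapp A u]lapp_sum /lapp mulmx_sumr linear_sum/=.
apply: eq_bigr => i _; rewrite -scalemxAr linearZ/= -/(lapp _ v) lapp_sum.
rewrite scaler_sumr; apply: eq_bigr => j _.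
by rewrite scalerA /tensor mxE big_ord1 mxE.
Qed.

End LinearMaps.

Section SmoothFunctions.
Context {R : realType} {n : nat}.

(* The Frechet derivative Df : R^n -> L(R^n; E). *)
Definition frechet {a b : nat} (f : 'rV[R]_n -> 'M[R]_(a, b))
    (x : 'rV[R]_n) : linmx R n a b := mklin ('d f x).

Lemma frechetE (a b : nat) (f : 'rV[R]_n -> 'M[R]_(a, b)) x h :
  lapp (frechet f x) h = 'd f x h.
Proof. exact: mklinK. Qed.

Definition supnorm {a b : nat} (f : 'rV[R]_n -> 'M[R]_(a, b)) : \bar R :=
  ereal_sup [set (`|f x|)%:E | x in [set: 'rV[R]_n]].

Fixpoint Cb (m : nat) {a b : nat} (f : 'rV[R]_n -> 'M[R]_(a, b)) : Prop :=
  [/\ continuous f, (supnorm f < +oo)%E &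
      match m with
      | 0 => True
      | m'.+1 => (forall x, differentiable f x) /\ Cb m' (frechet f)
      end].

Fixpoint Cbnorm (m : nat) {a b : nat} (f : 'rV[R]_n -> 'M[R]_(a, b)) : \bar R :=
  match m with
  | 0 => supnorm f
  | m'.+1 => (supnorm f + Cbnorm m' (frechet f))%E
  end.

End SmoothFunctions.

(* Paths are total functions on R; only their values on [0, T], and those of
   two-parameter functions on {0 <= s <= t <= T}, are used. *)
Section Paths.
Context {R : realType}.

Definition part_sum {V : zmodType} (s t : R) (g : R -> R -> V) (pi : seq R) : V :=
  let u := nth t (s :: pi) in \sum_(0 <= i < size pi) g (u i) (u i.+1).

Definition mesh_lt (s t : R) (pi : seq R) (delta : R) : Prop :=
  let u := nth t (s :: pi) in
  forall i, (i < size pi)%N -> u i.+1 - u i < delta.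

Definition cadlag {V : topologicalType} (s t : R) (f : R -> V) : Prop :=
  (forall u, s <= u < t -> f r @[r --> u^'+] --> f u) /\
  (forall u, s < u <= t -> exists l : V, f r @[r --> u^'-] --> l).

Definition incr {V : zmodType} (X : R -> V) (s t : R) : V := X t - X s.

Variable T : R.

Section Variation.
Context {V : normedModType R}.

Definition var2 (q : R) (G : R -> R -> V) : \bar R :=
  poweR (ereal_sup [set (part_sum 0 T (fun u v => `|G u v| `^ q) pi)%:E
                     | pi in itv_partition 0 T]) q^-1.

Definition var1 (p : R) (X : R -> V) : \bar R := var2 p (incr X).

Definition D1 (p : R) (X : R -> V) : Prop :=
  cadlag 0 T X /\ (var1 p X < +oo)%E.

Definition D2 (q : R) (G : R -> R -> V) : Prop :=
  [/\ (var2 q G < +oo)%E,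
      (forall t, 0 <= t <= T -> cadlag 0 t (fun s => G s t)) &
      (forall s, 0 <= s <= T -> cadlag s T (fun t => G s t))].

End Variation.

Variables (p : R) (d : nat).

Definition rough_path (X : R -> 'rV[R]_d) (XX : R -> R -> 'M[R]_d) : Prop :=
  [/\ D1 p X, D2 (p / 2) XX &
      forall s u t, 0 <= s -> s <= u -> u <= t -> t <= T ->
        XX s t = XX s u + XX u t + tensor (incr X s u) (incr X u t)].

Definition rough_norm (X : R -> 'rV[R]_d) (XX : R -> R -> 'M[R]_d) : \bar R :=
  (var1 p X + var2 (p / 2)%R XX)%E.

Section Controlled.
Variable X : R -> 'rV[R]_d.
Context {a b : nat}.

Definition remainder (Y : R -> 'M[R]_(a, b)) (Y' : R -> linmx R d a b)
    (s t : R) : 'M[R]_(a, b) :=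
  incr Y s t - lapp (Y' s) (incr X s t).

Definition controlled (Y : R -> 'M[R]_(a, b)) (Y' : R -> linmx R d a b) : Prop :=
  [/\ D1 p Y, D1 p Y' & D2 (p / 2) (remainder Y Y')].

Definition ctrl_norm (Y : R -> 'M[R]_(a, b)) (Y' : R -> linmx R d a b) : \bar R :=
  (`|Y' 0|%:E + var1 p Y' + var2 (p / 2)%R (remainder Y Y'))%E.

Definition ctrl_dist (Y : R -> 'M[R]_(a, b)) (Y' : R -> linmx R d a b)
    (Z : R -> 'M[R]_(a, b)) (Z' : R -> linmx R d a b) : \bar R :=
  (`|Y' 0 - Z' 0|%:E + var1 p (fun t => (Y' t - Z' t)%R)
   + var2 (p / 2)%R (fun s t => (remainder Y Y' s t - remainder Z Z' s t)%R))%E.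

End Controlled.

Section Equation.
Variables (X : R -> 'rV[R]_d) (XX : R -> R -> 'M[R]_d).

Definition is_rough_integral {k : nat} (V : R -> linmx R d 1 k)
    (V' : R -> linmx R d d (1 * k)) (s t : R) (I : 'rV[R]_k) : Prop :=
  forall eps, 0 < eps -> exists2 delta, 0 < delta &
    forall pi, itv_partition s t pi -> mesh_lt s t pi delta ->
      `| part_sum s t
           (fun u v => lapp (V u) (incr X u v) + lapp2 (V' u) (XX u v)) pi
         - I | < eps.

Context {e k : nat}.
Variable f : 'rV[R]_(e + k) -> linmx R d 1 k.

(* f is defined on pairs (alpha, Y), hence on R^(e + k) in this order; fpath and
   fpath' form the controlled path (f((alpha, Y)), Df((alpha, Y)) (alpha', Y')). *)
Definition fpath (alpha : R -> 'rV[R]_e) (Y : R -> 'rV[R]_k) (s : R) :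
    linmx R d 1 k := f (row_mx (alpha s) (Y s)).

Definition fpath' (alpha : R -> 'rV[R]_e) (alpha' : R -> linmx R d 1 e)
    (Y : R -> 'rV[R]_k) (Y' : R -> linmx R d 1 k) (s : R) :
    linmx R d d (1 * k) :=
  mklin (fun h => lapp (frechet f (row_mx (alpha s) (Y s)))
                       (row_mx (lapp (alpha' s) h) (lapp (Y' s) h))).

Definition rde_solution (y : R -> 'rV[R]_k) (y' : R -> linmx R d 1 k)
    (alpha : R -> 'rV[R]_e) (alpha' : R -> linmx R d 1 e)
    (Y : R -> 'rV[R]_k) (Y' : R -> linmx R d 1 k) : Prop :=
  [/\ controlled X Y Y',
      (forall t, 0 <= t <= T -> Y' t = y' t + fpath alpha Y t) &
      (forall t, 0 <= t <= T ->
         is_rough_integral (fpath alpha Y) (fpath' alpha alpha' Y Y')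
           0 t (Y t - y t))].

End Equation.

End Paths.

Definition locally_bounded_on {R : realType} {U : topologicalType} (D : set U)
    (C : U -> R) : Prop :=
  forall z, D z -> exists M : R, \forall w \near z, D w -> `|C w| <= M.

(* Main.v *)
(* All variation norms are turned into Hoelder bounds with respect to one common control
   W. The q-variation over [s, T] is right-continuous in s, hence so is W, and [0, T]
   splits into N pieces, with N depending only on W(T) and eps, such that W oscillates by
   at most eps on each piece deprived of its right endpoint. On such a piece the sewing
   estimate for the rough integral shows that the solution map improves bounds by a factor
   1/2, both for a controlled path and for a difference of two of them. The jump at the
   right endpoint is recovered because the rough integral over [u, t] only involves the
   integrand before time t. Patching the pieces together gives the a priori bound and the
   stability estimate, with constants depending only on the size of the data. The Picard
   iterates converge by the same difference estimate, and uniqueness is stability for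
   equal data. *)

Require Import Defs.
From HB Require Import structures.
From mathcomp Require Import all_boot all_order all_algebra.
From mathcomp Require Import all_classical all_reals all_analysis.
From mathcomp Require Import ring lra.

Set Implicit Arguments.
Unset Strict Implicit.
Unset Printing Implicit Defensive.

Import Order.TTheory GRing.Theory Num.Theory.
Import numFieldNormedType.Exports.
Local Open Scope classical_set_scope.
Local Open Scope ring_scope.

(** * Partitions and the sewing lemma *)

Section PartitionSums.
Context {R : realType}.

(** The obstacle is that [W] may jump: it need not be small on short closed intervals. The existence
    of the integral, a limit as the mesh tends to 0, meets the same difficulty. A short interval may
    carry a large jump, but whenever it is split at a point, right-continuity makes the control of
    one of the two halves small, and each term in the defect of the germ has a factor from each
    half. Every control is normalised by the size of the path that it measures, so its mass is at
    most 1 for one function and 2 for a pair. Hence the solutions, whose norms are finite but not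
    yet estimated, and the differences of the data can take part in the common control without
    changing the number of pieces, and the stability bound comes out linear in the size [E] of the
    differences. A single [c] at least 1 dominates dimensions, norms, mass and sewing constant, so
    that intermediate constants are numerical multiples of powers of [c]. The dependence on [p] is
    carried by the sewing constant, which blows up as [p] tends to 3. *)

Fixpoint psum {V : zmodType} (g : R -> R -> V) (s : R) (pi : seq R) : V :=
  if pi is x :: pi' then g s x + psum g x pi' else 0.

Lemma part_sumE (V : zmodType) (g : R -> R -> V) s t pi :
  part_sum s t g pi = psum g s pi.
Proof.
rewrite /part_sum; elim: pi s => [|x pi IH] s /=; first by rewrite big_nil.
rewrite big_nat_recl //=; congr (_ + _); rewrite -IH.
by apply: eq_bigr.
Qed.

Lemma psum_cat (V : zmodType) (g : R -> R -> V) s p1 p2 :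
  psum g s (p1 ++ p2) = psum g s p1 + psum g (last s p1) p2.
Proof. by elim: p1 s => [|x p1 IH] s /=; rewrite ?add0r// IH addrA. Qed.

Lemma psumB (V : zmodType) (g1 g2 : R -> R -> V) s pi :
  psum (fun u v => g1 u v - g2 u v) s pi = psum g1 s pi - psum g2 s pi.
Proof.
elim: pi s => [|x pi IH] s /=; first by rewrite subr0.
by rewrite IH opprD addrACA.
Qed.

Lemma mesh_ltP (s t : R) pi delta :
  mesh_lt s t pi delta <-> path (fun u v => v - u < delta) s pi.
Proof. by rewrite /mesh_lt; split=> [H|/(pathP t) H]; [apply/(pathP t)|]. Qed.

Lemma psum_telescope (W : R -> R) s t pi : itv_partition s t pi ->
  psum (fun u v => W v - W u) s pi = W t - W s.
Proof.
elim: pi s => [|x pi IH] s /=; first by move/itv_partition_nil ->; rewrite subrr.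
by move/itv_partition_cons/IH ->; rewrite addrC addrA subrK.
Qed.

Lemma itv_partition_itv (s t : R) x pi :
  itv_partition s t (x :: pi) -> s < x /\ x <= t.
Proof.
move=> H; split; first by case: H => /= /andP[].
exact: itv_partition_le (itv_partition_cons H).
Qed.

Lemma itv_partition_split (s t x : R) p1 p2 :
  itv_partition s t (p1 ++ x :: p2) ->
  [/\ itv_partition s (last s p1) p1, last s p1 < x & itv_partition x t p2].
Proof.
rewrite /itv_partition cat_path last_cat /= => -[/and3P[H1 H2 H3] H4].
by split => //.
Qed.

Lemma ler_psum (g1 g2 : R -> R -> R) s t pi : itv_partition s t pi ->
  (forall u v, s <= u -> u <= v -> v <= t -> g1 u v <= g2 u v) ->
  psum g1 s pi <= psum g2 s pi.
Proof.
elim: pi s => [|x pi IH] s //= H Hg.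
have [sx xt] := itv_partition_itv H.
apply: lerD; first by apply: Hg => //; exact: ltW.
apply: IH; first exact: itv_partition_cons H.
by move=> u v xu uv vt; apply: Hg => //; apply: le_trans xu; exact: ltW.
Qed.

Lemma psumZ (a : R) (g : R -> R -> R) s pi :
  psum (fun u v => a * g u v) s pi = a * psum g s pi.
Proof. by elim: pi s => [|x pi IH] s /=; rewrite ?mulr0// IH mulrDr. Qed.

Lemma itv_partition_mesh (s t delta : R) : 0 < delta -> s <= t ->
  exists2 pi, itv_partition s t pi & mesh_lt s t pi delta.
Proof.
move=> d0 st.
(* The induction is on the number of steps of length [delta / 2] that cover [s, t]; half of [delta]
   keeps the mesh strictly below it. *)
suff H : forall n s, s <= t -> t - s <= n%:R * (delta / 2) ->
    exists2 pi, itv_partition s t pi & path (fun u v => v - u < delta) s pi.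
  have [|pi H1 H2] := H (Num.bound ((t - s) / (delta / 2))) s st.
    rewrite -ler_pdivrMr; last by lra.
    by apply/ltW/archi_boundP/divr_ge0; lra.
  by exists pi => //; apply/mesh_ltP.
elim=> [|n IH] {st}s st Hn.
  have -> : s = t by apply/eqP; rewrite eq_le st/=; move: Hn; rewrite mul0r; lra.
  by exists [::].
have [Hs|Hs] := leP (t - s) (delta / 2).
  have [->|ne] := eqVneq s t; first by exists [::].
  have lst : s < t by rewrite lt_neqAle ne.
  exists [:: t]; first exact: itv_partition1.
  by rewrite /= andbT; lra.
have [|pi H1 H2] := IH (s + delta / 2) ltac:(lra).
  by move: Hn; rewrite -natr1 mulrDl mul1r; lra.
exists (s + delta / 2 :: pi).
  case: H1 => H1 H3; split => //=; rewrite H1 andbT; lra.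
by rewrite /= H2 andbT; lra.
Qed.

(** The integral is a limit as the mesh tends to 0, so two fine partitions need not refine each
    other; they are compared through this one. *)
Lemma common_refinement (s t : R) p1 p2 :
  itv_partition s t p1 -> itv_partition s t p2 ->
  exists q, [/\ itv_partition s t q, {subset p1 <= q} & {subset p2 <= q}].
Proof.
move=> H1 H2; pose q := sort <=%O (undup (p1 ++ p2)).
have mq x : (x \in q) = (x \in p1) || (x \in p2).
  by rewrite mem_sort mem_undup mem_cat.
have bnd p x : itv_partition s t p -> x \in p -> s < x <= t.
  elim: p {H1 H2 q mq} s => // y p IH s0 H.
  have [sy yt] := itv_partition_itv H.
  rewrite inE => /orP[/eqP ->|/(IH _ (itv_partition_cons H))/andP[yx ->]].
    by rewrite sy yt.
  by rewrite (lt_trans sy yx).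
have bq x : x \in q -> s < x <= t.
  by rewrite mq => /orP[]; apply: bnd.
have sq : path <%O s q.
  rewrite path_min_sorted; last by apply/allP => x /bq/andP[].
  by rewrite sort_lt_sorted undup_uniq.
clearbody q; exists q; split; [|by move=> x xp; rewrite mq xp ?orbT..].
split => //; case E: q => [|x q']; last rewrite -E.
  case: p1 H1 mq {bnd} => [/itv_partition_nil -> _ /=|x p1 _]; first by rewrite eqxx.
  by move=> /(_ x); rewrite E in_nil in_cons eqxx.
have lq : last s q \in q by rewrite E /= mem_last.
have tq : t \in q.
  case: p1 H1 mq {bnd} => [/itv_partition_nil st _|y p1 [_ /eqP <-] ->].
    have := bq x; rewrite E mem_head st => /(_ isT)/andP[tx xt].
    by have := lt_le_trans tx xt; rewrite ltxx.
  by rewrite /= mem_last.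
rewrite eq_le; case/andP: (bq _ lq) => _ ->/=.
rewrite leNgt; apply/negP => lt_t.
have : sorted <%O (s :: q) by [].
move: tq => /splitPr Eq; case: Eq sq lq lt_t => r1 r2.
rewrite cat_path last_cat /= => /and3P[_ _ Hp] _ Hl _.
have := mem_last t r2; rewrite inE => /orP[/eqP El|/(allP (lt_path_min Hp)) /=].
  by rewrite El ltxx in Hl.
by move=> /lt_trans/(_ Hl); rewrite ltxx.
Qed.

End PartitionSums.

Ltac mxring := apply/matrixP => ? ?; rewrite !mxE; ring.

Section Sewing.
Context {R : realType}.

Definition sew_const (k : R) : R := 2 / (1 - 2 * 2^-1 `^ k).

Lemma half_powR_lt (k : R) : 1 < k -> 2 * 2^-1 `^ k < 1.
Proof.
move=> k1.
have -> : (k = 1 + (k - 1))%R by lra.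
rewrite powRD; last by apply/implyP => _; apply/eqP; lra.
rewrite powRr1; last by lra.
rewrite mulrA divff ?mul1r; last by apply/eqP; lra.
rewrite -[ltRHS](powRr0 (2^-1)).
rewrite /powR; case: eqP => [|_]; first by lra.
rewrite ltr_expR mul0r pmulr_rlt0; last by lra.
by rewrite ln_lt0//; lra.
Qed.

Lemma sew_const_ge0 (k : R) : 1 < k -> 0 <= sew_const k.
Proof.
by move=> /half_powR_lt H; apply: divr_ge0 => //; lra.
Qed.

Lemma sew_constE (k : R) : 1 < k ->
  sew_const k = sew_const k * (2 * 2^-1 `^ k) + 2.
Proof.
by move=> /half_powR_lt H; rewrite /sew_const; field; apply/eqP; lra.
Qed.

Lemma split_first (P : pred R) s pi : pi != [::] -> P (last s pi) ->
  exists p1 x p2, [/\ pi = p1 ++ x :: p2, P x & ~~ has P p1].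
Proof.
elim: pi s => // y pi IH s _ /= Hl.
have [Py|nPy] := boolP (P y); first by exists [::], y, pi.
case: pi IH Hl => [_ /=|z pi IH Hl]; first by rewrite (negbTE nPy).
have [p1 [x [p2 [-> Px np]]]] := IH y isT Hl.
by exists (y :: p1), x, p2; split => //=; rewrite (negbTE nPy).
Qed.

(** Splitting points are restricted to [b < t0], because an integrand bounded on a half-open piece
    gives no information at its right endpoint. For [b = t0] also [c = t0], and the defect vanishes
    since [Xi] is 0 on the diagonal. *)
Lemma sewing (n1 n2 : nat) (W : R -> R) (Xi : R -> R -> 'M[R]_(n1, n2)) (k D s0 t0 : R) :
  1 < k -> 0 <= D ->
  (forall s t, s0 <= s -> s <= t -> t <= t0 -> W s <= W t) ->
  (forall a, s0 <= a -> a <= t0 -> Xi a a = 0) ->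
  (forall a b c, s0 <= a -> a <= b -> b <= c -> c <= t0 -> b < t0 ->
     `|Xi a c - Xi a b - Xi b c| <= D * (W c - W a) `^ k) ->
  forall pi s t, s0 <= s -> t <= t0 -> itv_partition s t pi ->
  `|psum Xi s pi - Xi s t| <= sew_const k * D * (W t - W s) `^ k.
Proof.
move=> k1 D0 mW Xi0 dXi.
have C0 := sew_const_ge0 k1.
have dXi' a b c : s0 <= a -> a <= b -> b <= c -> c <= t0 ->
    `|Xi a c - Xi a b - Xi b c| <= D * (W c - W a) `^ k.
  move=> sa ab bc ct; have [bt|tb] := ltP b t0; first exact: dXi.
  have <- : b = c by apply/eqP; rewrite eq_le bc /=; exact: le_trans tb.
  have Xb : Xi b b = 0 by apply: Xi0; lra.
  by rewrite subrr Xb subrr normr0 mulr_ge0 ?powR_ge0.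
move=> pi; have [n] := ubnP (size pi).
elim: n pi => // n IH pi sn s t ss tt Hpi.
have st := itv_partition_le Hpi.
have [pi0|pi0] := eqVneq pi [::].
  move: Hpi; rewrite pi0 => /itv_partition_nil <- /=.
  have Xs : Xi s s = 0 by apply: Xi0; lra.
  rewrite Xs subrr normr0; apply: mulr_ge0; last exact: powR_ge0.
  exact: mulr_ge0.
(* Cut where [W] crosses its middle value: [x] is the first point of the partition with [W x] at
   least [m] and [y] the point before it. Both [s, y] and [x, t] carry at most half of the control,
   and the interval [y, x], which may contain a large jump, is isolated at the price of two
   defects. *)
pose m := (W s + W t) / 2.
have Wst := mW s t ss st tt.
have Ht : m <= W (last s pi) by case: Hpi => _ /eqP ->; rewrite /m; lra.
have [p1 [x [p2 [Epi Px np]]]] :=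
  split_first (P := fun x => m <= W x) pi0 Ht.
rewrite Epi in Hpi sn *.
have [H1 yx H2] := itv_partition_split Hpi.
set y := last s p1 in H1 yx.
have sy := itv_partition_le H1.
have xt := itv_partition_le H2.
have Wy : W y <= m.
  move: np; rewrite /y; case: (p1) => [|z p] np /=; first by rewrite /m; lra.
  by have /(hasPn np) := mem_last z p; rewrite -ltNge => /ltW.
move: sn; rewrite size_cat /= addnS ltnS => sn.
have s1 : (size p1 < n)%N by apply: leq_ltn_trans sn; rewrite leq_addr.
have s2 : (size p2 < n)%N by apply: leq_ltn_trans sn; rewrite leq_addl.
have I1 := IH p1 s1 s y ss (le_trans (ltW yx) (le_trans xt tt)) H1.
have I2 := IH p2 s2 x t (le_trans (le_trans ss sy) (ltW yx)) tt H2.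
rewrite psum_cat /= -/y.
have -> : psum Xi s p1 + (Xi y x + psum Xi x p2) - Xi s t =
   (psum Xi s p1 - Xi s y) + (psum Xi x p2 - Xi x t) -
   ((Xi s t - Xi s y - Xi y t) + (Xi y t - Xi y x - Xi x t)).
  by mxring.
have halfW u v : s <= u -> u <= v -> v <= t -> W v - W u <= (W t - W s) / 2 ->
    (W v - W u) `^ k <= (W t - W s) `^ k * 2^-1 `^ k.
  move=> su uv vt Wuv.
  have Wuv0 := mW u v (le_trans ss su) uv (le_trans vt tt).
  rewrite -powRM; [|lra|lra].
  by apply: ge0_ler_powR; rewrite ?nnegrE ?subr_ge0//; lra.
have Wx : m <= W x by [].
have yt : y <= t by lra.
have Wyt := mW y t (le_trans ss sy) yt tt.
have h1 : (W y - W s) `^ k <= (W t - W s) `^ k * 2^-1 `^ k.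
  by apply: halfW => //; move: Wy; rewrite /m; lra.
have h2 : (W t - W x) `^ k <= (W t - W s) `^ k * 2^-1 `^ k.
  by apply: halfW => //; [lra | move: Wx; rewrite /m; lra].
have d1 := dXi' s y t ss sy yt tt.
have d2 := dXi' y x t (le_trans ss sy) (ltW yx) xt tt.
have h3 : (W t - W y) `^ k <= (W t - W s) `^ k.
  have h := mW s y ss sy (le_trans yt tt).
  apply: ge0_ler_powR; rewrite ?nnegrE ?subr_ge0 ?lerD2l ?lerN2//; lra.
set w := (W t - W s) `^ k in d1 h1 h2 h3 *.
apply: (le_trans (ler_normB _ _)).
apply: (le_trans (lerD (ler_normD _ _) (ler_normD _ _))).
apply: (le_trans (lerD (lerD I1 I2) (lerD d1 d2))).
have CD0 : 0 <= sew_const k * D by apply: mulr_ge0.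
apply: (@le_trans _ _ (sew_const k * D * (w * 2^-1 `^ k) + sew_const k * D * (w * 2^-1 `^ k) + (D * w + D * w))).
  by apply: lerD; apply: lerD => //; apply: ler_wpM2l.
have -> : sew_const k * D * w = (sew_const k * (2 * 2^-1 `^ k) + 2) * D * w.
  by rewrite -sew_constE.
by rewrite le_eqVlt; apply/orP; left; apply/eqP; ring.
Qed.

End Sewing.

Section SewingLimit.
Context {R : realType}.

Lemma mx_cauchy_limit (n1 n2 : nat) (x : nat -> 'M[R]_(n1, n2)) :
  (forall eps, 0 < eps -> exists N, forall i j, (N <= i)%N -> (N <= j)%N ->
     `|x i - x j| < eps) ->
  exists l, forall eps, 0 < eps -> exists N, forall i, (N <= i)%N -> `|x i - l| < eps.
Proof.
move=> H.
have cx : cauchy (x @ \oo).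
  apply: cauchy_exP => eps eps0; have [N HN] := H _ eps0.
  exists (x N); exists N => // i /= Ni.
  by rewrite -ball_normE /=; apply: HN.
have /cauchy_cvg/cvg_ex[l xl] := cx.
exists l => eps eps0.
have [N _ HN] := (@cvgrPdist_lt _ _ _ _ _ _ _).1 xl eps eps0.
by exists N => i Ni; rewrite distrC; apply: HN.
Qed.

(** The relation [e] on consecutive points stands for a bound on the mesh. Local errors proportional
    to increments of [W] telescope, so the number of intervals does not matter. *)
Lemma psum_refine (n1 n2 : nat) (Xi : R -> R -> 'M[R]_(n1, n2)) (W : R -> R)
    (e : rel R) (c s0 t0 : R) :
  (forall u v q, s0 <= u -> v <= t0 -> e u v -> itv_partition u v q ->
     `|psum Xi u q - Xi u v| <= c * (W v - W u)) ->
  forall p q s t, s0 <= s -> t <= t0 ->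
  itv_partition s t p -> itv_partition s t q -> {subset p <= q} -> path e s p ->
  `|psum Xi s q - psum Xi s p| <= c * (W t - W s).
Proof.
move=> He; elim=> [|x p IH] q s t ss tt Hp Hq pq ep.
  have Est := itv_partition_nil Hp; rewrite -Est in Hq *.
  by rewrite (itv_partitionxx Hq) !subrr normr0 mulr0.
have [sx xt] := itv_partition_itv Hp.
have xq : x \in q by apply: pq; rewrite mem_head.
have [q1 [q2 Eq]] : exists q1 q2, q = q1 ++ x :: q2.
  by case/splitPr: xq => q1 q2; exists q1, q2.
rewrite Eq in Hq pq *.
have [H1 lx H2] := itv_partition_split Hq.
have Hp' := itv_partition_cons Hp.
move: ep => /= /andP[esx ep].
have pq2 : {subset p <= q2}.
  move=> z zp; have : z \in q1 ++ x :: q2 by apply: pq; rewrite inE zp orbT.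
  have xz : x < z by case: Hp' => /lt_path_min/allP/(_ _ zp).
  rewrite mem_cat inE => /or3P[zq1|/eqP zx|//]; last by rewrite zx ltxx in xz.
  case: Hq => + _; rewrite -cat1s catA cat_path => /andP[+ _].
  rewrite cats1 rcons_path => /andP[+ _]; case/splitPr: zq1 H1 lx => r1 r2 H1 lx _.
  have [_ _ /itv_partition_le] := itv_partition_split H1.
  by rewrite leNgt (lt_trans lx xz).
have I1 := IH q2 x t (le_trans ss (ltW sx)) tt Hp' H2 pq2 ep.
have Hq1 : itv_partition s x (rcons q1 x).
  by case: H1 => H1 _; split; rewrite ?rcons_path ?H1 ?last_rcons.
have I2 := He s x _ ss (le_trans xt tt) esx Hq1.
rewrite -cat1s catA psum_cat cats1 last_rcons.
rewrite /=.
have -> : psum Xi s (rcons q1 x) + psum Xi x q2 - (Xi s x + psum Xi x p) =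
  (psum Xi s (rcons q1 x) - Xi s x) + (psum Xi x q2 - psum Xi x p) by mxring.
have -> : c * (W t - W s) = c * (W x - W s) + c * (W t - W x) by ring.
exact: le_trans (ler_normD _ _) (lerD I2 I1).
Qed.

(** Local errors that are an arbitrarily small multiple of the control make the sums over fine
    partitions Cauchy; the limit is taken along chosen partitions of mesh below [n.+1%:R^-1]. *)
Lemma sewing_limit (n1 n2 : nat) (Xi : R -> R -> 'M[R]_(n1, n2)) (W : R -> R) (s t : R) :
  s <= t -> W s <= W t ->
  (forall eta, 0 < eta -> exists2 delta, 0 < delta &
     forall u v q, s <= u -> v <= t -> v - u < delta -> itv_partition u v q ->
     `|psum Xi u q - Xi u v| <= eta * (W v - W u)) ->
  exists I, forall eps, 0 < eps -> exists2 delta, 0 < delta &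
    forall pi, itv_partition s t pi -> mesh_lt s t pi delta ->
      `|part_sum s t Xi pi - I| < eps.
Proof.
move=> st Wst H.
have C eps : 0 < eps -> exists2 delta, 0 < delta & forall p q,
    itv_partition s t p -> itv_partition s t q ->
    mesh_lt s t p delta -> mesh_lt s t q delta ->
    `|psum Xi s p - psum Xi s q| < eps.
  move=> eps0; pose eta := eps / (4 * (W t - W s + 1)).
  have eta0 : 0 < eta by rewrite divr_gt0//; lra.
  have Heta : eta * (W t - W s) <= eps / 4.
    rewrite /eta invfM mulrA -mulrA ler_piMr; [by []|lra|].
    by rewrite mulrC ler_pdivrMr; lra.
  have [delta d0 Hd] := H eta eta0.
  exists delta => // p q Hp Hq /mesh_ltP mp /mesh_ltP mq.
  have [r [Hr pr qr]] := common_refinement Hp Hq.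
  have Hr1 := psum_refine (e := fun u v => v - u < delta) Hd (lexx s) (lexx t) Hp Hr pr mp.
  have Hr2 := psum_refine (e := fun u v => v - u < delta) Hd (lexx s) (lexx t) Hq Hr qr mq.
  have -> : psum Xi s p - psum Xi s q =
    (psum Xi s r - psum Xi s q) - (psum Xi s r - psum Xi s p) by mxring.
  by apply: le_lt_trans (ler_normB _ _) _; lra.
have P n : {q : seq R | itv_partition s t q & mesh_lt s t q (n.+1%:R^-1)}.
  apply: cid2; apply: itv_partition_mesh => //.
have mesh_le p d1 d2 : d1 <= d2 -> mesh_lt s t p d1 -> mesh_lt s t p d2.
  by move=> d12 Hp u i ip; apply: lt_le_trans d12; exact: Hp.
pose x n := psum Xi s (s2val (P n)).
have xs n delta : 0 < delta -> (Num.bound delta^-1 <= n)%N -> mesh_lt s t (s2val (P n)) delta.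
  move=> d0 nd; apply: mesh_le (s2valP' (P n)).
  rewrite -[leRHS]invrK lef_pV2 ?posrE ?invr_gt0 ?ltr0Sn//.
  apply/ltW/(lt_trans (archi_boundP _)); first by rewrite invr_ge0 ltW.
  by rewrite ltr_nat ltnS.
have [eps eps0|I HI] := @mx_cauchy_limit _ _ x.
  have [delta d0 Hd] := C _ eps0.
  exists (Num.bound delta^-1) => i j Ni Nj.
  by apply: Hd; [exact: (s2valP (P i))|exact: (s2valP (P j))|exact: xs|exact: xs].
exists I => eps eps0.
have [delta d0 Hd] := C (eps / 2) ltac:(lra).
exists delta => // pi Hpi mpi; rewrite part_sumE.
have [N HN] := HI (eps / 2) ltac:(lra).
pose n := maxn N (Num.bound delta^-1).
have h1 := HN n (leq_maxl _ _).
have h2 := Hd pi (s2val (P n)) Hpi (s2valP (P n)) mpi (xs _ _ d0 (leq_maxr _ _)).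
have -> : psum Xi s pi - I = (psum Xi s pi - x n) + (x n - I) by mxring.
by apply: le_lt_trans (ler_normD _ _) _; rewrite /x in h1 *; lra.
Qed.

End SewingLimit.

(** * Right-continuous controls of an interval *)

Section Control.
Context {R : realType}.

(* A control of the interval [0, T] is encoded by the single function
   W t = omega(0, t), the control itself being omega(s, t) = W t - W s. *)
Definition is_control (T : R) (W : R -> R) : Prop :=
  [/\ W 0 = 0,
      (forall s t, 0 <= s -> s <= t -> t <= T -> W s <= W t) &
      (forall s eta, 0 <= s -> s < T -> 0 < eta ->
         exists2 r, s < r & r <= T /\ W r - W s <= eta)].

Variables (T : R) (W : R -> R).
Hypotheses (T0 : 0 < T) (cW : is_control T W).

(** The time [tau i] is the first one at which [W] reaches [i%:R * eta], or [T]. A jump of [W]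
    across several levels makes some pieces degenerate, which is why [tau] is only
    non-decreasing. *)
Lemma control_pieces (eta : R) (N : nat) : 0 < eta -> W T < N%:R * eta ->
  exists tau : nat -> R, [/\ tau 0%N = 0, tau N = T,
    (forall i, tau i <= tau i.+1),
    (forall i, 0 <= tau i <= T) &
    (forall i r, tau i <= r -> r < tau i.+1 -> W r - W (tau i) <= eta)].
Proof.
case: cW => W0 mW rW eta0 WT.
pose S i := [set t | 0 <= t <= T /\ (i%:R * eta <= W t \/ t = T)].
have ST i : S i T by split; [rewrite ltW//= | right].
have lbS i : lbound (S i) 0 by move=> t [/andP[]].
have hiS i : has_inf (S i) by split; [exists T; exact: ST | exists 0].
pose tau i := inf (S i).
have tauP i : 0 <= tau i <= T.
  by rewrite lb_le_inf ?ge_inf//; [exists 0|exists T].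
have Ltau i t : S i t -> tau i <= t by move=> Sit; apply: ge_inf => //; exists 0.
(* Right-continuity of [W]: the level is attained at the infimum itself. *)
have Wtau i : tau i < T -> i%:R * eta <= W (tau i).
  move=> tT; case/andP: (tauP i) => t0 _.
  apply/ler_addgt0Pr => d d0.
  have [r tr [rT Wr]] := rW _ _ t0 tT d0.
  have [u [[/andP[u0 uT] Su] ur]] : exists u, S i u /\ u < r.
    by have [u Su ur] := inf_adherent (eps := r - tau i) ltac:(lra) (hiS i); exists u; split => //; rewrite /tau in tr *; lra.
  case: Su => [Su|uT']; last by lra.
  have := mW u r u0 (ltW ur) rT; lra.
exists tau; split => //.
- apply/eqP; rewrite eq_le; apply/andP; split; last by case/andP: (tauP 0%N).
  by apply: Ltau; split; [rewrite lexx ltW|left; rewrite mul0r W0].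
- apply/eqP; rewrite eq_le; case/andP: (tauP N) => _ ->/=.
  apply: lb_le_inf; first by exists T.
  move=> t [/andP[t0 tT] [|->//]] Nt.
  have := mW t T t0 tT (lexx T); lra.
- move=> i; apply: lb_le_inf; first by exists T.
  move=> t [tT H]; apply: Ltau; split => //.
  case: H => [H|]; [left|by right].
  by apply: le_trans H; rewrite ler_pM2r// ler_nat.
- move=> i r ir ri.
  have [r0 rT] : 0 <= r /\ r < T by have := tauP i; have := tauP i.+1; lra.
  have : ~ S i.+1 r by move/Ltau; lra.
  move=> nS; have Wr : W r < i.+1%:R * eta.
    by rewrite ltNge; apply/negP => H; apply: nS; split; [apply/andP; split; lra|left].
  have := Wtau i ltac:(lra); rewrite -natr1 in Wr; lra.
Qed.

(** A substitute for uniform continuity, which fails at jumps. If [b] lies in the same piece as [a],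
    the left half is small. Otherwise a cutting time lies in (a, b], and right-continuity there,
    with one [delta] for the finitely many cutting times, makes the right half small. *)
Lemma control_modulus (eta : R) : 0 < eta -> exists2 delta, 0 < delta &
  forall a b c, 0 <= a -> a <= b -> b <= c -> c <= T -> c - a < delta ->
    W b - W a <= eta \/ W c - W b <= eta.
Proof.
move=> eta0; case: (cW) => W0 mW rW.
have WT0 : 0 <= W T by rewrite -W0; apply: mW => //; exact: ltW.
pose N := Num.bound (W T / eta).
have [|tau [t0 tN tm tT tau_eta]] := @control_pieces eta N eta0.
  by rewrite -ltr_pdivrMr//; apply: archi_boundP; rewrite divr_ge0// ltW.
have [delta d0 Hd] : exists2 delta, 0 < delta & forall i, (i < N.+1)%N -> tau i < T ->
    forall c, tau i <= c -> c < tau i + delta -> c <= T -> W c - W (tau i) <= eta.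
  elim: N.+1 => [|n [delta d0 Hd]]; first by exists 1.
  have [tn|tn] := ltP (tau n) T; last first.
    exists delta => // i; rewrite ltnS leq_eqVlt => /orP[/eqP ->|]; last exact: Hd.
    by move=> h; move: (lt_le_trans h tn); rewrite ltxx.
  have [n0 nT] := andP (tT n).
  have [r nr [rT Wr]] := rW _ _ n0 tn eta0.
  exists (Num.min delta (r - tau n)); first by rewrite lt_min d0/=; lra.
  move=> i; rewrite ltnS leq_eqVlt => /orP[/eqP ->|iN] iT c ic.
    rewrite -ltrBlDl lt_min => /andP[_ cr] cT.
    by have := mW c r ltac:(lra) ltac:(lra) rT; lra.
  rewrite -ltrBlDl lt_min => /andP[cd _] cT.
  by apply: Hd => //; lra.
exists delta => // a b c a0 ab bc cT cad.
have [aT|Ta] := ltP a T; last first.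
  have Eba : b = a by lra.
  by left; rewrite Eba subrr ltW.
have [j [jN ja aj]] : exists j, [/\ (j < N)%N, tau j <= a & a < tau j.+1].
  have aN : a < tau N by rewrite tN.
  elim: N aN {tN Hd} => [|n IH]; first by rewrite t0; lra.
  have [an|na] := ltP a (tau n); last by exists n.
  by move=> _; have [j [jn ? ?]] := IH an; exists j; split => //; apply: ltn_trans jn _.
have [bj|jb] := ltP b (tau j.+1).
  left; have := tau_eta j b ltac:(lra) bj.
  have := mW (tau j) a ltac:(have := tT j; lra) ja (ltW aT); lra.
right; have [jT|Tj] := ltP (tau j.+1) T; last first.
  have -> : c = b by have := tT j.+1; lra.
  by rewrite subrr ltW.
have := Hd j.+1 jN jT c ltac:(lra) ltac:(lra) cT.
have := mW (tau j.+1) b ltac:(have := tT j.+1; lra) jb ltac:(lra); lra.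
Qed.

End Control.

(** * Linear maps *)

Section MatrixNorm.
Context {R : realType}.

Lemma mx_norm_leP (m n : nat) (A : 'M[R]_(m, n)) (B : R) : 0 <= B ->
  (`|A| <= B <-> forall i j, `|A i j| <= B).
Proof.
move=> B0; rewrite /Num.norm /= mx_normrE; split=> [H i j|H].
  by apply: le_trans H; apply: (le_bigmax _ _ (i, j)).
by apply/bigmax_leP; split => // -[i j] _; apply: H.
Qed.

Lemma mx_norm_entry (m n : nat) (A : 'M[R]_(m, n)) i j : `|A i j| <= `|A|.
Proof. exact: (mx_norm_leP A (normr_ge0 A)).1 (lexx _) i j. Qed.

Lemma mulmx_norm (m n q : nat) (A : 'M[R]_(m, n)) (B : 'M[R]_(n, q)) :
  `|A *m B| <= n%:R * (`|A| * `|B|).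
Proof.
apply/mx_norm_leP; first by rewrite !mulr_ge0.
move=> i j; rewrite mxE; apply: (le_trans (ler_norm_sum _ _ _)).
apply: (@le_trans _ _ (\sum_(l < n) `|A| * `|B|)).
  by apply: ler_sum => l _; rewrite normrM ler_pM// mx_norm_entry.
by rewrite sumr_const card_ord mulr_natl.
Qed.

Lemma vec_mx_norm (m n : nat) (u : 'rV[R]_(m * n)) : `|vec_mx u| <= `|u|.
Proof. by apply/mx_norm_leP => // i j; rewrite mxE mx_norm_entry. Qed.

Lemma row_mx_norm (m n1 n2 : nat) (A : 'M[R]_(m, n1)) (B : 'M[R]_(m, n2)) :
  `|row_mx A B| <= `|A| + `|B|.
Proof.
apply/mx_norm_leP; first by rewrite addr_ge0.
move=> i j; rewrite mxE; case: (fintype.split j) => l.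
  by apply: (le_trans (mx_norm_entry _ _ _)); rewrite lerDl.
by apply: (le_trans (mx_norm_entry _ _ _)); rewrite lerDr.
Qed.

Section Lapp.
Variables (n a b : nat).
Implicit Types (A B : linmx R n a b) (h k : 'rV[R]_n).

Lemma lapp_norm A h : `|lapp A h| <= n%:R * (`|A| * `|h|).
Proof. by rewrite (le_trans (vec_mx_norm _))// (le_trans (mulmx_norm _ _))// [`|A| * _]mulrC. Qed.

Lemma lappBl A B h : lapp (A - B) h = lapp A h - lapp B h.
Proof. by rewrite /lapp mulmxBr linearB. Qed.

Lemma lappDl A B h : lapp (A + B) h = lapp A h + lapp B h.
Proof. by rewrite /lapp mulmxDr linearD. Qed.

Lemma lappBr A h k : lapp A (h - k) = lapp A h - lapp A k.
Proof. by rewrite /lapp mulmxBl linearB. Qed.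

Lemma lappDr A h k : lapp A (h + k) = lapp A h + lapp A k.
Proof. by rewrite /lapp mulmxDl linearD. Qed.

Lemma lapp_sub2 A B h k : lapp A h - lapp B k = lapp B (h - k) + lapp (A - B) h.
Proof. by rewrite lappBr lappBl [RHS]addrC addrA subrK. Qed.

Lemma lapp0l h : lapp (0 : linmx R n a b) h = 0.
Proof. by rewrite /lapp mulmx0 linear0. Qed.

Lemma lapp0r A : lapp A 0 = 0.
Proof. by rewrite /lapp mul0mx linear0. Qed.

End Lapp.

Section Lapp2.
Variables (d a b : nat).
Implicit Types (A B : linmx R d d (a * b)) (M N : 'M[R]_d).

Lemma lapp2Bl A B M : lapp2 (A - B) M = lapp2 A M - lapp2 B M.
Proof.
rewrite /lapp2 -sumrB; apply: eq_bigr => i _; rewrite -sumrB.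
by apply: eq_bigr => j _; rewrite !lappBl scalerBr.
Qed.

Lemma lapp2Dr A M N : lapp2 A (M + N) = lapp2 A M + lapp2 A N.
Proof.
rewrite /lapp2 -big_split; apply: eq_bigr => i _; rewrite -big_split.
by apply: eq_bigr => j _; rewrite mxE scalerDl.
Qed.

Lemma lapp20r A : lapp2 A 0 = 0.
Proof. by rewrite /lapp2 big1// => i _; rewrite big1// => j _; rewrite mxE scale0r. Qed.

(** Two applications of [lapp_norm] give [d ^ 2], and the double sum has [d ^ 2] terms. *)
Lemma lapp2_norm A M : `|lapp2 A M| <= d%:R ^+ 4 * (`|A| * `|M|).
Proof.
have delta_norm l : `|(delta_mx 0 l : 'rV[R]_d)| <= 1.
  apply/mx_norm_leP => // i j; rewrite mxE.
  by case: (_ && _); rewrite ?normr1 ?normr0.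
rewrite /lapp2; apply: (le_trans (ler_norm_sum _ _ _)).
apply: (@le_trans _ _ (\sum_(i < d) \sum_(j < d) d%:R ^+ 2 * (`|A| * `|M|))).
  apply: ler_sum => i _; apply: (le_trans (ler_norm_sum _ _ _)).
  apply: ler_sum => j _; rewrite normrZ.
  have h1 : `|lapp A (delta_mx 0 i)| <= d%:R * `|A|.
    apply: (le_trans (lapp_norm _ _)); rewrite ler_wpM2l//.
    by rewrite ler_piMr.
  have h2 : `|lapp (lapp A (delta_mx 0 i)) (delta_mx 0 j)| <= d%:R * (d%:R * `|A|).
    apply: (le_trans (lapp_norm _ _)); rewrite ler_wpM2l//.
    by apply: le_trans h1; rewrite ler_piMr.
  apply: (le_trans (ler_pM (normr_ge0 _) (normr_ge0 _) (mx_norm_entry _ _ _) h2)).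
  by rewrite le_eqVlt; apply/orP; left; apply/eqP; ring.
rewrite !sumr_const card_ord; set z := _ * (`|A| * _).
rewrite -[z *+ d *+ d]mulr_natr -[z *+ d]mulr_natr /z.
by rewrite le_eqVlt; apply/orP; left; apply/eqP; ring.
Qed.

End Lapp2.
End MatrixNorm.

Section MeanValue.
Context {R : realType}.

(** The norm is the maximum of the entries, so the scalar mean value theorem for each entry loses no
    constant, although the intermediate point depends on the entry. *)
Lemma mean_value_ineq (m n : nat) (phi dphi : R -> 'M[R]_(m, n)) (B : R) :
  (forall x : R, is_derive x 1 phi (dphi x)) ->
  (forall x, 0 <= x -> x <= 1 -> `|dphi x| <= B) ->
  `|phi 1 - phi 0| <= B.
Proof.
move=> dp pB; have B0 : 0 <= B by apply: le_trans (pB 0 _ _).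
apply/mx_norm_leP => // i j; rewrite !mxE.
have dij (x : R) : is_derive x 1 (fun x => phi x i j) (dphi x i j).
  have [H1 H2] := dp x; split; first exact: (derivable_mxP _ _ _).1.
  by move: H2; rewrite derive_mx// => <-; rewrite mxE.
have [|c /andP[c0 c1] ->] := @MVT_segment R _ _ 0 1 ler01 (fun x _ => dij x).
  apply: continuous_subspaceT => x.
  by apply: differentiable_continuous; apply/derivable1_diffP; case: (dij x).
rewrite subr0 mulr1; apply: le_trans (mx_norm_entry _ _ _) _.
exact: pB.
Qed.

Lemma is_derive_line (n m1 m2 : nat) (f : 'rV[R]_n -> 'M[R]_(m1, m2)) (a h : 'rV[R]_n) (x : R) :
  (forall z, differentiable f z) ->
  is_derive x 1 (fun x => f (a + x *: h)) (lapp (frechet f (a + x *: h)) h).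
Proof.
move=> df; pose l (x : R) := a + x *: h.
have dl : is_diff x l (0 + ( *:%R ^~ h)).
  exact: is_diffD (is_diff_cst a x) (is_diff_scalel x h).
have dfl : differentiable (f \o l) x by apply: differentiable_comp; [case: dl|exact: df].
split; first exact: diff_derivable.
rewrite deriveE// diff_comp /=; [|by case: dl|exact: df].
by rewrite frechetE (diff_val (is_diff_def := dl)) /= add0r scale1r.
Qed.

End MeanValue.

(** * Bounded smooth functions and compositions *)

Section SmoothBounds.
Context {R : realType} {n : nat}.
Local Notation nn := (n%:R : R).

(** The derivative is an argument and is tested along lines, so that pairs such as [f - f1] and
    [Df - Df1] qualify directly and the bound [F] can be changed without touching the functions. *)
Definition C1bd {m1 m2 : nat} (F : R) (f : 'rV[R]_n -> 'M[R]_(m1, m2))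
    (Df : 'rV[R]_n -> linmx R n m1 m2) : Prop :=
  [/\ (forall a h (x : R), is_derive x 1 (fun x : R => f (a + x *: h))
                       (lapp (Df (a + x *: h)) h)),
      (forall x, `|f x| <= F) & (forall x, `|Df x| <= F)].

Definition C2bd {m1 m2 : nat} (F : R) (f : 'rV[R]_n -> 'M[R]_(m1, m2))
    (Df : 'rV[R]_n -> linmx R n m1 m2) (D2f : 'rV[R]_n -> linmx R n n (m1 * m2)) : Prop :=
  C1bd F f Df /\ C1bd F Df D2f.

Definition C3bd {m1 m2 : nat} (F : R) (f : 'rV[R]_n -> 'M[R]_(m1, m2))
    (Df : 'rV[R]_n -> linmx R n m1 m2) (D2f : 'rV[R]_n -> linmx R n n (m1 * m2))
    (D3f : 'rV[R]_n -> linmx R n n (n * (m1 * m2))) : Prop :=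
  C1bd F f Df /\ C2bd F Df D2f D3f.

Lemma is_derive_scale (m1 m2 : nat) (c : 'M[R]_(m1, m2)) (x : R) :
  is_derive x 1 (fun x => x *: c) c.
Proof.
have dl := is_diff_scalel x c.
split; first by apply: diff_derivable; case: dl.
by rewrite deriveE ?(diff_val (is_diff_def := dl)) ?scale1r//; case: dl.
Qed.

Lemma C1bd_ge0 (m1 m2 : nat) (F : R) (f : 'rV[R]_n -> 'M[R]_(m1, m2))
    (Df : 'rV[R]_n -> linmx R n m1 m2) : C1bd F f Df -> 0 <= F.
Proof. by case=> _ /(_ 0) H _; apply: le_trans H. Qed.

Lemma C1bd_lipschitz (m1 m2 : nat) (F : R) (f : 'rV[R]_n -> 'M[R]_(m1, m2))
    (Df : 'rV[R]_n -> linmx R n m1 m2)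
    (a b : 'rV[R]_n) : C1bd F f Df ->
  `|f a - f b| <= nn * F * `|a - b|.
Proof.
case=> df _ bDf.
have := @mean_value_ineq R _ _ (fun x => f (b + x *: (a - b))) _ (nn * F * `|a - b|)
   (fun x => df b (a - b) x).
rewrite scale1r scale0r addr0 [b + (a - b)]addrC subrK; apply=> x _ _.
by rewrite (le_trans (lapp_norm _ _))// -mulrA ler_wpM2l// ler_wpM2r.
Qed.

Lemma C2bd_taylor (m1 m2 : nat) (F : R) (f : 'rV[R]_n -> 'M[R]_(m1, m2))
    (Df : 'rV[R]_n -> linmx R n m1 m2) (D2f : 'rV[R]_n -> linmx R n n (m1 * m2))
    (a h : 'rV[R]_n) : C2bd F f Df D2f ->
  `|f (a + h) - f a - lapp (Df a) h| <= nn ^+ 2 * F * `|h| ^+ 2.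
Proof.
case=> -[df _ _] bDf.
have := @mean_value_ineq R _ _
  (fun x => f (a + x *: h) - x *: lapp (Df a) h) _ (nn ^+ 2 * F * `|h| ^+ 2)
  (fun x => is_deriveB (df a h x) (is_derive_scale (lapp (Df a) h) x)).
rewrite scale1r !scale0r addr0 subr0 scale1r.
have -> : f (a + h) - lapp (Df a) h - f a = f (a + h) - f a - lapp (Df a) h.
  by rewrite addrAC.
apply=> x x0 x1; rewrite -(lappBl (Df _)) (le_trans (lapp_norm _ _))//.
have := C1bd_lipschitz (a + x *: h) a bDf.
have -> : a + x *: h - a = x *: h by rewrite addrC addKr.
rewrite normrZ ger0_norm// => H.
have Hh : `|Df (a + x *: h) - Df a| <= nn * F * `|h|.
  apply: le_trans H _; rewrite ler_wpM2l ?ler_piMl//.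
  by rewrite mulr_ge0 ?(C1bd_ge0 bDf).
apply: (@le_trans _ _ (nn * (nn * F * `|h| * `|h|))); last first.
  by rewrite le_eqVlt; apply/orP; left; apply/eqP; ring.
by rewrite ler_wpM2l// ler_wpM2r.
Qed.

(** Mean value inequality for the difference of [f] along the segments from [b] to [a] and from [b1]
    to [a1]. It turns closeness of two paths into closeness of the increments of [f] along them. *)
Lemma C2bd_four_point (m1 m2 : nat) (F : R) (f : 'rV[R]_n -> 'M[R]_(m1, m2))
    (Df : 'rV[R]_n -> linmx R n m1 m2) (D2f : 'rV[R]_n -> linmx R n n (m1 * m2))
    (a b a1 b1 : 'rV[R]_n) : C2bd F f Df D2f ->
  `|f a - f b - (f a1 - f b1)| <=
  nn * F * `|(a - b) - (a1 - b1)| +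
  nn ^+ 2 * F * (`|a - a1| + `|b - b1|) * `|a - b|.
Proof.
case=> -[df _ Df0] bDf; have F0 : 0 <= F by apply: le_trans (Df0 0).
have := @mean_value_ineq R _ _
  (fun x => f (b + x *: (a - b)) - f (b1 + x *: (a1 - b1))) _ _
  (fun x => is_deriveB (df b (a - b) x) (df b1 (a1 - b1) x)).
rewrite !scale1r !scale0r !addr0 [b + (a - b)]addrC [b1 + (a1 - b1)]addrC !subrK.
have -> : f a - f a1 - (f b - f b1) = f a - f b - (f a1 - f b1) by mxring.
apply=> x x0 x1.
set p := b + _ *: _; set p1 := b1 + _ *: _.
rewrite (lapp_sub2 (Df p) (Df p1)).
apply: (le_trans (ler_normD _ _)); apply: lerD.
  by rewrite (le_trans (lapp_norm _ _))// -mulrA ler_wpM2l// ler_wpM2r.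
rewrite (le_trans (lapp_norm _ _))//.
have pp1 : `|p - p1| <= `|a - a1| + `|b - b1|.
  have -> : p - p1 = x *: (a - a1) + (1 - x) *: (b - b1).
    by rewrite /p /p1; mxring.
  apply: (le_trans (ler_normD _ _)); rewrite !normrZ; apply: lerD.
    by rewrite ler_piMl// ger0_norm.
  by rewrite ler_piMl// ger0_norm; lra.
have H := C1bd_lipschitz p p1 bDf.
apply: (@le_trans _ _ (nn * (nn * F * (`|a - a1| + `|b - b1|) * `|a - b|))).
  rewrite ler_wpM2l// ler_wpM2r//; apply: (le_trans H).
  by rewrite ler_wpM2l// mulr_ge0.
by rewrite le_eqVlt; apply/orP; left; apply/eqP; ring.
Qed.

(** The derivative along the segment is a difference of increments of [Df] at two base points, so
    the four-point estimate is applied to [Df]; this is where the third derivative enters. *)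
Lemma C3bd_taylor_diff (m1 m2 : nat) (F : R) (f : 'rV[R]_n -> 'M[R]_(m1, m2))
    (Df : 'rV[R]_n -> linmx R n m1 m2) (D2f : 'rV[R]_n -> linmx R n n (m1 * m2))
    (D3f : 'rV[R]_n -> linmx R n n (n * (m1 * m2)))
    (a h a1 h1 : 'rV[R]_n) : C3bd F f Df D2f D3f ->
  `|f (a + h) - f a - lapp (Df a) h -
    (f (a1 + h1) - f a1 - lapp (Df a1) h1)| <=
  nn ^+ 2 * F * `|h - h1| * (`|h| + `|h1|) +
  nn ^+ 3 * F * (2 * `|a - a1| + `|h - h1|) * `|h| ^+ 2.
Proof.
case=> -[df _ Df0] bDf; have F0 : 0 <= F by apply: le_trans (Df0 0).
move Ec: (lapp (Df a) h) => c; move Ec1: (lapp (Df a1) h1) => c1.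
have := @mean_value_ineq R _ _
  (fun x => f (a + x *: h) - x *: c - (f (a1 + x *: h1) - x *: c1)) _ _
  (fun x => is_deriveB
    (is_deriveB (df a h x) (is_derive_scale c x))
    (is_deriveB (df a1 h1 x) (is_derive_scale c1 x))).
rewrite !scale1r !scale0r !addr0 !subr0.
have -> : f (a + h) - c - (f (a1 + h1) - c1) - (f a - f a1) =
    f (a + h) - f a - c - (f (a1 + h1) - f a1 - c1) by mxring.
apply=> x x0 x1.
rewrite -Ec -Ec1; set p := a + _ *: _; set p1 := a1 + _ *: _.
rewrite -(lappBl (Df p)) -(lappBl (Df p1)).
rewrite (lapp_sub2 (Df p - Df a) (Df p1 - Df a1)).
have hx (z : 'rV[R]_n) : `|x *: z| <= `|z| by rewrite normrZ ger0_norm// ler_piMl.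
have pa : p - a = x *: h by rewrite /p addrC addKr.
have pa1 : p1 - a1 = x *: h1 by rewrite /p1 addrC addKr.
have H1 : `|Df p1 - Df a1| <= nn * F * `|h1|.
  apply: (le_trans (C1bd_lipschitz p1 a1 bDf.1)).
  by rewrite pa1 ler_wpM2l// mulr_ge0.
have H2 := C2bd_four_point p a p1 a1 bDf.
have hh : `|x *: h - x *: h1| <= `|h - h1| by rewrite -scalerBr.
have pp1 : `|p - p1| <= `|a - a1| + `|h - h1|.
  have -> : p - p1 = (a - a1) + (x *: h - x *: h1) by rewrite /p /p1; mxring.
  by apply: (le_trans (ler_normD _ _)); rewrite lerD2l.
rewrite pa pa1 in H2.
have H3 : `|Df p - Df a - (Df p1 - Df a1)| <=
    nn * F * `|h - h1| + nn ^+ 2 * F * (2 * `|a - a1| + `|h - h1|) * `|h|.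
  apply: (le_trans H2); apply: lerD; first by rewrite ler_wpM2l// mulr_ge0.
  by apply: ler_pM; rewrite ?mulr_ge0 ?addr_ge0 ?exprn_ge0// ler_wpM2l ?mulr_ge0 ?exprn_ge0//; lra.
apply: (le_trans (ler_normD _ _)).
apply: (le_trans (lerD (lapp_norm _ _) (lapp_norm _ _))).
apply: (@le_trans _ _ (nn * (nn * F * `|h1| * `|h - h1|) + nn *
   ((nn * F * `|h - h1| + nn ^+ 2 * F * (2 * `|a - a1| + `|h - h1|) * `|h|) * `|h|))).
  by apply: lerD; rewrite ler_wpM2l// ler_wpM2r.
by rewrite le_eqVlt; apply/orP; left; apply/eqP; ring.
Qed.

End SmoothBounds.

Ltac nneg := repeat first
  [ assumption | exact: normr_ge0 | exact: ler0n | apply: mulr_ge0 | apply: addr_ge0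
  | apply: exprn_ge0 | exact: ler01 | exact: powR_ge0 | lra ].

Ltac prod_le := lazymatch goal with
  | |- is_true (?a * ?b <= ?a' * ?b') => apply: ler_pM; [nneg|nneg|prod_le|prod_le]
  | |- is_true (?a ^+ _ <= ?a' ^+ _) => apply: lerXn2r; rewrite ?nnegrE; [nneg|nneg|prod_le]
  | |- is_true (?a + ?b <= ?a' + ?b') => apply: lerD; prod_le
  | |- _ => first [exact: lexx | assumption | solve [match goal with H : forall _, is_true _ |- _ => exact: H end] | lra]
  end.

Section Composition.
Context {R : realType}.
Variables (n d m1 m2 : nat) (c : R).
Hypotheses (c1 : 1 <= c) (nc : n%:R <= c) (dc : d%:R <= c).

Let c0 : 0 <= c. Proof. exact: le_trans ler01 c1. Qed.

(** Used to raise every term to a common power of [c]; this is the origin of the large exponents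
    below. *)
Let mono i j (y : R) : (i <= j)%N -> 0 <= y -> c ^+ i * y <= c ^+ j * y.
Proof. by move=> ij y0; rewrite ler_wpM2r// ler_weXn2l. Qed.

Section Single.
Variables (F : R) (f : 'rV[R]_n -> 'M[R]_(m1, m2)) (Df : 'rV[R]_n -> linmx R n m1 m2)
  (D2f : 'rV[R]_n -> linmx R n n (m1 * m2)).
Hypothesis fF : C2bd F f Df D2f.
Variables (x : 'rV[R]_d) (z w : 'rV[R]_n) (A B : 'M[R]_(d, n)) (h r : R).
Hypotheses (h0 : 0 <= h) (r0 : 0 <= r) (xh : `|x| <= c * h) (Ac : `|A| <= c)
  (rho : `|w - z - x *m A| <= r * h ^+ 2).

Let F0 : 0 <= F. Proof. exact: C1bd_ge0 fF.1. Qed.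

(** In the application [z] and [w] are the values of the joint path at two times, [A] and [B] its
    derivatives there, [x] is the increment of [X], [h] is [hw p W u v], and [r] is the constant of
    the remainder. *)
Lemma norm_xA : `|x *m A| <= c ^+ 3 * h.
Proof.
have [[Hc0 HF0] [Hh0 Hr0]] := ((c0, F0), (h0, r0)); have HxA := xh; have Hrho := rho; have HA := Ac.
have [Hnc Hdc] := (nc, dc).
apply: (le_trans (mulmx_norm _ _)).
have -> : c ^+ 3 * h = c * (c * h * c) by ring.
prod_le.
Qed.

Lemma incr_bound : `|w - z| <= (c ^+ 3 + r * h) * h.
Proof.
have [[Hc0 HF0] [Hh0 Hr0]] := ((c0, F0), (h0, r0)); have HxA := xh; have Hrho := rho; have HA := Ac.
have [Hnc Hdc] := (nc, dc).
have -> : w - z = x *m A + (w - z - x *m A) by rewrite [RHS]addrC subrK.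
apply: (le_trans (ler_normD _ _)); have := norm_xA; lra.
Qed.

Lemma comp_bound0 : `|A *m Df z| <= c ^+ 2 * F.
Proof.
have [[Hc0 HF0] [Hh0 Hr0]] := ((c0, F0), (h0, r0)); have HxA := xh; have Hrho := rho; have HA := Ac.
have [Hnc Hdc] := (nc, dc).
have [_ _ bDf] := fF.1.
apply: (le_trans (mulmx_norm _ _)).
have -> : c ^+ 2 * F = c * (c * F) by ring.
prod_le.
Qed.

(** The constant [r] comes with an extra factor [h], since the remainder is of order [h ^+ 2]. This
    gain makes the solution map improve bounds on short pieces. *)
Lemma comp_bound1 : `|f w - f z| <= c ^+ 4 * F * (1 + r * h) * h.
Proof.
have [[Hc0 HF0] [Hh0 Hr0]] := ((c0, F0), (h0, r0)); have HxA := xh; have Hrho := rho; have HA := Ac.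
have [Hnc Hdc] := (nc, dc).
apply: (le_trans (C1bd_lipschitz w z fF.1)).
apply: (@le_trans _ _ (c * F * ((c ^+ 3 + r * h) * h))); first by (have HB := incr_bound; prod_le).
have := mono (i := 1) (j := 4) isT (y := r * h * h * F) ltac:(nneg); lra.
Qed.

(** Taylor expansion is applied at the increment [x *m A] predicted by the derivative; the mismatch
    between [w] and [z + x *m A] is the remainder of the path, treated by the Lipschitz bound. *)
Lemma comp_bound2 :
  `|f w - f z - lapp (Df z) (x *m A)| <= c ^+ 8 * F * (1 + r) * h ^+ 2.
Proof.
have [[Hc0 HF0] [Hh0 Hr0]] := ((c0, F0), (h0, r0)); have HxA := xh; have Hrho := rho; have HA := Ac.
have [Hnc Hdc] := (nc, dc).
have -> : f w - f z - lapp (Df z) (x *m A) =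
    (f w - f (z + x *m A)) + (f (z + x *m A) - f z - lapp (Df z) (x *m A)) by mxring.
apply: (le_trans (ler_normD _ _)).
have h1 := C1bd_lipschitz w (z + x *m A) fF.1; rewrite opprD addrA in h1.
have h2 := C2bd_taylor z (x *m A) fF.
have h3 : n%:R * F * `|w - z - x *m A| <= c * F * (r * h ^+ 2) by prod_le.
have h4 : n%:R ^+ 2 * F * `|x *m A| ^+ 2 <= c ^+ 2 * F * (c ^+ 3 * h) ^+ 2.
  by (have HB := norm_xA; prod_le).
have := mono (i := 1) (j := 8) isT (y := r * h * h * F) ltac:(nneg); lra.
Qed.

Lemma comp_bound3 b : 0 <= b -> `|B - A| <= b * h ->
  `|B *m Df w - A *m Df z| <= c ^+ 6 * F * (1 + b + r * h) * h.
Proof.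
have [[Hc0 HF0] [Hh0 Hr0]] := ((c0, F0), (h0, r0)); have HxA := xh; have Hrho := rho; have HA := Ac.
have [Hnc Hdc] := (nc, dc).
move=> b0 BA; have [_ _ bDf] := fF.1.
have -> : B *m Df w - A *m Df z = (B - A) *m Df w + A *m (Df w - Df z).
  by rewrite mulmxBl mulmxBr; set u := _ *m _; set v := _ *m _; set t := _ *m _; mxring.
apply: (le_trans (ler_normD _ _)).
apply: (le_trans (lerD (mulmx_norm _ _) (mulmx_norm _ _))).
have h1 := C1bd_lipschitz w z fF.2.
have h2 : n%:R * F * `|w - z| <= c * F * ((c ^+ 3 + r * h) * h) by (have HB := incr_bound; prod_le).
have h3 : n%:R * (`|B - A| * `|Df w|) <= c * (b * h * F) by prod_le.
have h4 : n%:R * (`|A| * `|Df w - Df z|) <= c * (c * (c * F * ((c ^+ 3 + r * h) * h))).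
  by (have HB := le_trans h1 h2; prod_le).
have := mono (i := 1) (j := 6) isT (y := b * h * F) ltac:(nneg).
have := mono (i := 3) (j := 6) isT (y := r * h * h * F) ltac:(nneg); lra.
Qed.

End Single.

Section Difference.
Variables (E : R) (f f1 : 'rV[R]_n -> 'M[R]_(m1, m2)) (Df Df1 : 'rV[R]_n -> linmx R n m1 m2)
  (D2f D2f1 : 'rV[R]_n -> linmx R n n (m1 * m2))
  (D3f : 'rV[R]_n -> linmx R n n (n * (m1 * m2))).
(** The change of vector field is separated from the change of path: [f] is compared along both
    paths, which takes three derivatives of [f], while [g] is evaluated along the second path only,
    which takes two. Hence the norm of [f - f1] is needed in [C^2] only. *)
Let g z := f z - f1 z.
Let Dg z := Df z - Df1 z.
Hypothesis fF : C3bd c f Df D2f D3f.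
Hypothesis gE : C2bd E g Dg (fun z => D2f z - D2f1 z).
Variables (x : 'rV[R]_d) (z w z1 w1 : 'rV[R]_n) (A B A1 B1 : 'M[R]_(d, n)) (h Q : R).
Hypotheses (h0 : 0 <= h) (hc : h <= c) (xh : `|x| <= c * h) (EQ : E <= Q).
Hypotheses (zQ : `|z - z1| <= Q).

Let E0 : 0 <= E. Proof. exact: C1bd_ge0 gE.1. Qed.
Let Q0 : 0 <= Q. Proof. exact: le_trans E0 EQ. Qed.

Lemma comp_diff0 : `|f z - f1 z1| <= 2 * c ^+ 2 * Q.
Proof.
have [[Hc0 HE0] [Hh0 HQ0]] := ((c0, E0), (h0, Q0)).
have [[Hnc Hdc] [HEQ HzQ]] := ((nc, dc), (EQ, zQ)).
have [_ gb _] := gE.1.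
have -> : f z - f1 z1 = (f z - f z1) + g z1 by rewrite /g; mxring.
apply: (le_trans (ler_normD _ _)).
have h1 := C1bd_lipschitz z z1 fF.1.
have h2 : n%:R * c * `|z - z1| <= c * c * Q by prod_le.
have h3 := gb z1.
have := mono (i := 0) (j := 2) isT (y := Q) ltac:(nneg); lra.
Qed.

Lemma comp_diff_deriv : `|A| <= c -> `|A1| <= c -> `|A - A1| <= Q ->
  `|A *m Df z - A1 *m Df1 z1| <= 3 * c ^+ 4 * Q.
Proof.
have [[Hc0 HE0] [Hh0 HQ0]] := ((c0, E0), (h0, Q0)).
have [[Hnc Hdc] [HEQ HzQ]] := ((nc, dc), (EQ, zQ)).
move=> Ac A1c AQ; have [_ _ Dgb] := gE.1; have [_ _ Dfb] := fF.1.
have -> : A *m Df z - A1 *m Df1 z1 =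
    A *m (Df z - Df z1) + ((A - A1) *m Df z1 + A1 *m Dg z1).
  rewrite /Dg !mulmxBl !mulmxBr; set u := A *m _; set v := A *m _; set t := _ *m _.
  by set s := _ *m _; mxring.
apply: (le_trans (ler_normD _ _)); apply: (le_trans (lerD (mulmx_norm _ _) (ler_normD _ _))).
have h1 : `|Df z - Df z1| <= c * c * Q.
  by apply: (le_trans (C1bd_lipschitz z z1 fF.2.1)); prod_le.
have h2 : n%:R * (`|A| * `|Df z - Df z1|) <= c * (c * (c * c * Q)) by prod_le.
have h3 : `|(A - A1) *m Df z1| <= c * (Q * c).
  by apply: (le_trans (mulmx_norm _ _)); prod_le.
have h4 : `|A1 *m Dg z1| <= c * (c * Q).
  by apply: (le_trans (mulmx_norm _ _)); have HD := le_trans (Dgb z1) HEQ; prod_le.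
have := mono (i := 2) (j := 4) isT (y := Q) ltac:(nneg); lra.
Qed.

Hypotheses (wQ : `|w - w1| <= Q) (zwQ : `|(w - z) - (w1 - z1)| <= Q * h).
Hypotheses (wz : `|w - z| <= c * h) (wz1 : `|w1 - z1| <= c * h).

Lemma comp_diff1 : `|f w - f z - (f1 w1 - f1 z1)| <= 4 * c ^+ 5 * Q * h.
Proof.
have [[Hc0 HE0] [Hh0 HQ0]] := ((c0, E0), (h0, Q0)).
have [[Hnc Hdc] [HEQ HzQ]] := ((nc, dc), (EQ, zQ)).
have [[HwQ HzwQ] [Hwz Hwz1]] := ((wQ, zwQ), (wz, wz1)).
have -> : f w - f z - (f1 w1 - f1 z1) =
    (f w - f z - (f w1 - f z1)) + (g w1 - g z1) by rewrite /g; mxring.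
apply: (le_trans (ler_normD _ _)).
have h1 := C2bd_four_point w z w1 z1 (conj fF.1 fF.2.1).
have h2 : n%:R * c * `|w - z - (w1 - z1)| <= c * c * (Q * h) by prod_le.
have h3 : n%:R ^+ 2 * c * (`|w - w1| + `|z - z1|) * `|w - z| <=
   c ^+ 2 * c * (Q + Q) * (c * h) by prod_le.
have h4 := C1bd_lipschitz w1 z1 gE.1.
have h5 : n%:R * E * `|w1 - z1| <= c * Q * (c * h) by prod_le.
have := mono (i := 2) (j := 5) isT (y := Q * h) ltac:(nneg).
have := mono (i := 4) (j := 5) isT (y := Q * h) ltac:(nneg); lra.
Qed.

Hypotheses (Ac : `|A| <= c) (A1c : `|A1| <= c) (Bc : `|B| <= c).

Lemma comp_diff_deriv1 : `|B - A| <= c * h -> `|B1 - A1| <= c * h ->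
  `|A - A1| <= Q -> `|B - B1| <= Q -> `|(B - A) - (B1 - A1)| <= Q * h ->
  `|B *m Df w - A *m Df z - (B1 *m Df1 w1 - A1 *m Df1 z1)| <= 9 * c ^+ 6 * Q * h.
Proof.
have [[Hc0 HE0] [Hh0 HQ0]] := ((c0, E0), (h0, Q0)).
have [[Hnc Hdc] [HEQ HzQ]] := ((nc, dc), (EQ, zQ)).
have [[HwQ HzwQ] [Hwz Hwz1]] := ((wQ, zwQ), (wz, wz1)).
have [[HAc HA1c] HBc] := ((Ac, A1c), Bc).
move=> BA BA1 AQ BQ BAQ; have [_ _ Dgb] := gE.1; have [_ _ Dfb] := fF.1.
(* Discrete product rule: four terms compare [Df] along both paths, the last two contain [Dg] along
   the second path. *)
have -> : B *m Df w - A *m Df z - (B1 *m Df1 w1 - A1 *m Df1 z1) =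
    (B *m (Df w - Df z - (Df w1 - Df z1)) + (B - B1) *m (Df w1 - Df z1) +
     (B - A) *m (Df z - Df z1) + ((B - A) - (B1 - A1)) *m Df z1) +
    ((B1 - A1) *m Dg w1 + A1 *m (Dg w1 - Dg z1)).
  rewrite /Dg !(mulmxBl, mulmxBr).
  set u1 := B *m Df w; set u2 := B *m Df z; set u3 := B *m Df w1; set u4 := B *m Df z1.
  set u5 := B1 *m Df w1; set u6 := B1 *m Df z1; set u7 := A *m Df z; set u8 := A *m Df z1.
  set u9 := A1 *m Df z1; set v1 := B1 *m Df1 w1; set v2 := A1 *m Df w1; set v3 := A1 *m Df1 w1.
  by set v4 := A1 *m Df1 z1; mxring.
have k1 : `|Df w - Df z - (Df w1 - Df z1)| <= c * c * (Q * h) + c ^+ 2 * c * (Q + Q) * (c * h).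
  by apply: (le_trans (C2bd_four_point w z w1 z1 fF.2)); prod_le.
have h1 : `|B *m (Df w - Df z - (Df w1 - Df z1))| <=
    c * (c * (c * c * (Q * h) + c ^+ 2 * c * (Q + Q) * (c * h))).
  by apply: (le_trans (mulmx_norm _ _)); prod_le.
have k2 : `|Df w1 - Df z1| <= c * c * (c * h).
  by apply: (le_trans (C1bd_lipschitz w1 z1 fF.2.1)); prod_le.
have h2 : `|(B - B1) *m (Df w1 - Df z1)| <= c * (Q * (c * c * (c * h))).
  by apply: (le_trans (mulmx_norm _ _)); prod_le.
have k3 : `|Df z - Df z1| <= c * c * Q.
  by apply: (le_trans (C1bd_lipschitz z z1 fF.2.1)); prod_le.
have h3 : `|(B - A) *m (Df z - Df z1)| <= c * (c * h * (c * c * Q)).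
  by apply: (le_trans (mulmx_norm _ _)); prod_le.
have h4 : `|((B - A) - (B1 - A1)) *m Df z1| <= c * (Q * h * c).
  by apply: (le_trans (mulmx_norm _ _)); prod_le.
have h5 : `|(B1 - A1) *m Dg w1| <= c * (c * h * Q).
  by apply: (le_trans (mulmx_norm _ _)); have HD := le_trans (Dgb w1) HEQ; prod_le.
have k6 : `|Dg w1 - Dg z1| <= c * Q * (c * h).
  by apply: (le_trans (C1bd_lipschitz w1 z1 gE.2)); prod_le.
have h6 : `|A1 *m (Dg w1 - Dg z1)| <= c * (c * (c * Q * (c * h))).
  by apply: (le_trans (mulmx_norm _ _)); prod_le.
apply: (le_trans (ler_normD _ _)).
apply: (le_trans (lerD (ler_normD _ _) (ler_normD _ _))).
apply: (le_trans (lerD (lerD (ler_normD _ _) (lexx _)) (lexx _))).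
apply: (le_trans (lerD (lerD (lerD (ler_normD _ _) (lexx _)) (lexx _)) (lexx _))).
have := mono (i := 2) (j := 6) isT (y := Q * h) ltac:(nneg).
have := mono (i := 4) (j := 6) isT (y := Q * h) ltac:(nneg).
have : 0 <= c ^+ 6 * (Q * h) by nneg.
lra.
Qed.

Lemma comp_diff_rem : 
  `|w - z - x *m A| <= c * h ^+ 2 -> `|w1 - z1 - x *m A1| <= c * h ^+ 2 ->
  `|(w - z - x *m A) - (w1 - z1 - x *m A1)| <= Q * h ^+ 2 ->
  `|f w - f z - lapp (Df z) (x *m A) - (f1 w1 - f1 z1 - lapp (Df1 z1) (x *m A1))|
   <= 10 * c ^+ 9 * Q * h ^+ 2.
Proof.
have [[Hc0 HE0] [Hh0 HQ0]] := ((c0, E0), (h0, Q0)).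
have [[Hnc Hdc] [HEQ HzQ]] := ((nc, dc), (EQ, zQ)).
have [[HwQ HzwQ] [Hwz Hwz1]] := ((wQ, zwQ), (wz, wz1)).
have [[HAc HA1c] HBc] := ((Ac, A1c), Bc).
have [Hxh Hhc] := (xh, hc); have C1 := c1.
move=> rc rc1 rQ.
(* Three sources: the Taylor remainders of [f] for the true increments, the derivative applied to
   the remainders of the paths, and the composition of [g] with the second path. *)
have -> : f w - f z - lapp (Df z) (x *m A) - (f1 w1 - f1 z1 - lapp (Df1 z1) (x *m A1)) =
  (f (z + (w - z)) - f z - lapp (Df z) (w - z) -
     (f (z1 + (w1 - z1)) - f z1 - lapp (Df z1) (w1 - z1))) +
  (lapp (Df z) (w - z - x *m A) - lapp (Df z1) (w1 - z1 - x *m A1)) +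
  (g w1 - g z1 - lapp (Dg z1) (x *m A1)).
  rewrite (lappBr (Df z) (w - z)) (lappBr (Df z1) (w1 - z1)) (lappBl (Df z1) (Df1 z1)).
  have -> : z + (w - z) = w by rewrite addrC subrK.
  have -> : z1 + (w1 - z1) = w1 by rewrite addrC subrK.
  rewrite /g; set u1 := lapp (Df z) (w - z); set u2 := lapp (Df z1) (w1 - z1).
  set u3 := lapp (Df z) (x *m A); set u4 := lapp (Df z1) (x *m A1).
  by set u5 := lapp (Df1 z1) (x *m A1); mxring.
apply: (le_trans (ler_normD _ _)).
apply: (le_trans (lerD (ler_normD _ _) (lexx _))).
have h1 : `|f (z + (w - z)) - f z - lapp (Df z) (w - z) -
     (f (z1 + (w1 - z1)) - f z1 - lapp (Df z1) (w1 - z1))| <=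
   c ^+ 2 * c * (Q * h) * (c * h + c * h) + c ^+ 3 * c * (2 * Q + Q * c) * (c * h) ^+ 2.
  apply: (le_trans (C3bd_taylor_diff z (w - z) z1 (w1 - z1) fF)).
  have HQc : `|w - z - (w1 - z1)| <= Q * c by apply: (le_trans HzwQ); prod_le.
  by prod_le.
have h2 : `|lapp (Df z) (w - z - x *m A) - lapp (Df z1) (w1 - z1 - x *m A1)| <=
    c * (c * (Q * h ^+ 2)) + c * (c * c * Q * (c * h ^+ 2)).
  rewrite (lapp_sub2 (Df z) (Df z1)).
  apply: (le_trans (ler_normD _ _)); apply: (le_trans (lerD (lapp_norm _ _) (lapp_norm _ _))).
  have [_ _ Dfb] := fF.1.
  have k3 : `|Df z - Df z1| <= c * c * Q.
    by apply: (le_trans (C1bd_lipschitz z z1 fF.2.1)); prod_le.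
  by prod_le.
have h3 : `|g w1 - g z1 - lapp (Dg z1) (x *m A1)| <= c ^+ 8 * Q * (1 + c) * h ^+ 2.
  apply: (le_trans (comp_bound2 gE h0 c0 xh A1c rc1)).
  by prod_le.
have := mono (i := 2) (j := 9) isT (y := Q * h ^+ 2) ltac:(nneg).
have := mono (i := 4) (j := 9) isT (y := Q * h ^+ 2) ltac:(nneg).
have := mono (i := 6) (j := 9) isT (y := Q * h ^+ 2) ltac:(nneg).
have := mono (i := 7) (j := 9) isT (y := Q * h ^+ 2) ltac:(nneg).
have := mono (i := 8) (j := 9) isT (y := Q * h ^+ 2) ltac:(nneg).
have : 0 <= c ^+ 9 * (Q * h ^+ 2) by nneg.
lra.
Qed.

End Difference.
End Composition.

(** * Rough integrals with respect to a control *)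

Section HolderControl.
Context {R : realType}.
Implicit Types (p T : R) (W : R -> R).

(** The scale of the Hoelder bounds: increments are of order [hw], remainders and [XX] of order its
    square, defects of the germ of order its cube. *)
Definition hw p W (u v : R) : R := (W v - W u) `^ p^-1.

Lemma hw_ge0 p W u v : 0 <= hw p W u v.
Proof. exact: powR_ge0. Qed.

Lemma hw_le p T W a b u v : 2 < p -> is_control T W ->
  0 <= u -> u <= a -> a <= b -> b <= v -> v <= T -> hw p W a b <= hw p W u v.
Proof.
move=> p2 [_ mW _] u0 ua ab bv vT.
have h1 := mW u a u0 ua ltac:(lra).
have h2 := mW a b ltac:(lra) ab ltac:(lra).
have h3 := mW b v ltac:(lra) bv vT.
by apply: ge0_ler_powR; rewrite ?nnegrE ?invr_ge0; lra.
Qed.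

Lemma hw_exp p W u v k : W u <= W v -> hw p W u v ^+ k = (W v - W u) `^ (k%:R / p).
Proof.
move=> uv; rewrite /hw -powR_mulrn ?powR_ge0// -powRrM.
by rewrite mulrC.
Qed.

Lemma hwxx p W u : 2 < p -> hw p W u u = 0.
Proof. by move=> p2; rewrite /hw subrr powR0// invr_eq0; apply/eqP; lra. Qed.

End HolderControl.

Section RoughIntegral.
Context {R : realType}.
Variables (d k : nat).

Record holder_rough (c p T : R) (W : R -> R) (X : R -> 'rV[R]_d) (XX : R -> R -> 'M[R]_d)
    : Prop := HolderRough {
  hr_p : 2 < p /\ p < 3;
  hr_T : 0 < T;
  hr_W : is_control T W;
  hr_X : forall u v, 0 <= u -> u <= v -> v <= T -> `|incr X u v| <= c * hw p W u v;
  hr_XX : forall u v, 0 <= u -> u <= v -> v <= T -> `|XX u v| <= c * hw p W u v ^+ 2;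
  hr_chen : forall s u t, 0 <= s -> s <= u -> u <= t -> t <= T ->
        XX s t = XX s u + XX u t + tensor (incr X s u) (incr X u t) }.

Variables (c p T : R) (W : R -> R) (X : R -> 'rV[R]_d) (XX : R -> R -> 'M[R]_d).

Definition rough_germ (V : R -> linmx R d 1 k) (V' : R -> linmx R d d (1 * k)) (u v : R)
    : 'rV[R]_k :=
  lapp (V u) (incr X u v) + lapp2 (V' u) (XX u v).

(** The strict inequality [b < t] is the form in which a half-open piece enters the sewing lemma. *)
Definition integrand_bd (D s t : R) (V : R -> linmx R d 1 k) (V' : R -> linmx R d d (1 * k))
    : Prop :=
  forall a b, s <= a -> a <= b -> b < t ->
    `|V' b - V' a| <= D * hw p W a b /\
    `|V b - V a - lapp (V' a) (incr X a b)| <= D * hw p W a b ^+ 2.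

Hypotheses (c1 : 1 <= c) (dc : d%:R <= c) (HX : holder_rough c p T W X XX).

Let p2 : 2 < p. Proof. by case: (hr_p HX). Qed.

Lemma rough_germ_defect V V' s u t : 0 <= s -> s <= u -> u <= t -> t <= T ->
  rough_germ V V' s t - rough_germ V V' s u - rough_germ V V' u t =
  - lapp (V u - V s - lapp (V' s) (incr X s u)) (incr X u t) - lapp2 (V' u - V' s) (XX u t).
Proof.
move=> s0 su ut tT; rewrite /rough_germ (hr_chen HX s0 su ut tT) !lapp2Dr lapp2_tensor.
have -> : incr X s t = incr X s u + incr X u t by rewrite /incr; mxring.
rewrite lappDr lapp2Bl (lappBl (V u - V s)) (lappBl (V u)).
move: (lapp (V s) (incr X s u)) (lapp (V s) (incr X u t)) (lapp (V u) (incr X u t)).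
move: (lapp (lapp (V' s) (incr X s u)) (incr X u t)) => A1 A2 A3 A4.
move: (lapp2 (V' s) (XX s u)) (lapp2 (V' s) (XX u t)) (lapp2 (V' u) (XX u t)) => A5 A6 A7.
by mxring.
Qed.

Lemma rough_germxx V V' u : 0 <= u -> u <= T -> rough_germ V V' u u = 0.
Proof.
move=> u0 uT; rewrite /rough_germ /incr subrr lapp0r add0r.
have := hr_XX HX u0 (lexx u) uT; rewrite hwxx// expr0n mulr0 normr_le0 => /eqP ->.
exact: lapp20r.
Qed.

(** The two halves stay separate factors, instead of a cube over [s, t], because the existence proof
    gains from whichever half is small. In [c ^+ 5], four powers come from [lapp2_norm] and one from
    the bound on [XX]. *)
Lemma rough_germ_defect_le D V V' s0 t0 s u t : 0 <= D -> 0 <= s0 -> t0 <= T ->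
  integrand_bd D s0 t0 V V' -> s0 <= s -> s <= u -> u <= t -> t <= t0 -> u < t0 ->
  `|rough_germ V V' s t - rough_germ V V' s u - rough_germ V V' u t| <=
  c ^+ 5 * D * hw p W s u * hw p W u t * (hw p W s u + hw p W u t).
Proof.
move=> D0 s00 tT HV ss su ut tt ut0.
rewrite rough_germ_defect//; [|lra..].
have [H1 H2] := HV s u ss su ut0.
have H3 := hr_X HX (u := u) (v := t) ltac:(lra) ut ltac:(lra).
have H4 := hr_XX HX (u := u) (v := t) ltac:(lra) ut ltac:(lra).
have [a0 b0] := (hw_ge0 p W s u, hw_ge0 p W u t).
set a := hw p W s u in H1 H2 a0 *; set b := hw p W u t in H3 H4 b0 *.
have [C1 C0] : 1 <= c /\ 0 <= c by split => //; exact: le_trans ler01 c1.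
have Hdc := dc.
apply: (le_trans (ler_normB _ _)); rewrite normrN.
apply: (le_trans (lerD (lapp_norm _ _) (lapp2_norm _ _))).
have h1 : d%:R * (`|V u - V s - lapp (V' s) (incr X s u)| * `|incr X u t|) <=
    c * (D * a ^+ 2 * (c * b)) by prod_le.
have h2 : d%:R ^+ 4 * (`|V' u - V' s| * `|XX u t|) <= c ^+ 4 * (D * a * (c * b ^+ 2)).
  by prod_le.
have : c ^+ 2 * (D * a ^+ 2 * b) <= c ^+ 5 * (D * a ^+ 2 * b).
  by rewrite ler_wpM2r ?ler_weXn2l//; nneg.
lra.
Qed.

Lemma hw_cube_sum a b e : 0 <= a -> a <= b -> b <= e -> e <= T ->
  hw p W a b * hw p W b e * (hw p W a b + hw p W b e) <= 2 * hw p W a e ^+ 3.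
Proof.
move=> a0 ab be eT.
have h1 : hw p W a b <= hw p W a e by apply: (hw_le p2 (hr_W HX)) => //; lra.
have h2 : hw p W b e <= hw p W a e by apply: (hw_le p2 (hr_W HX)) => //; lra.
have := hw_ge0 p W a b; have := hw_ge0 p W b e; have := hw_ge0 p W a e => x0 y0 z0.
have -> : 2 * hw p W a e ^+ 3 = hw p W a e * hw p W a e * (hw p W a e + hw p W a e) by ring.
by prod_le.
Qed.

Lemma rough_germ_sewing D V V' s0 t0 : 0 <= D -> 0 <= s0 -> t0 <= T ->
  integrand_bd D s0 t0 V V' ->
  forall pi s t, s0 <= s -> t <= t0 -> itv_partition s t pi ->
  `|psum (rough_germ V V') s pi - rough_germ V V' s t| <=
    2 * sew_const (3 / p) * c ^+ 5 * D * hw p W s t ^+ 3.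
Proof.
move=> D0 s00 t0T HV pi s t ss tt Hpi.
have [P2 P3] := hr_p HX; have C0 : 0 <= c by exact: le_trans ler01 c1.
have [_ mW _] := hr_W HX.
have st := itv_partition_le Hpi.
have k1 : 1 < 3 / p by rewrite ltr_pdivlMr; lra.
have := @sewing R 1 k W (rough_germ V V') (3 / p) (2 * c ^+ 5 * D) s0 t0 k1.
rewrite hw_exp; last by apply: mW => //; lra.
have -> : 2 * sew_const (3 / p) * c ^+ 5 * D = sew_const (3 / p) * (2 * c ^+ 5 * D) by ring.
move=> H; apply: H Hpi => //; first by nneg.
- by move=> ? ? ? ? ?; apply: mW => //; lra.
- by move=> ? ? ?; apply: rough_germxx; lra.
move=> a b e sa ab be et bt.
apply: (le_trans (rough_germ_defect_le D0 s00 t0T HV sa ab be et bt)).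
rewrite -(@hw_exp _ p W a e 3); last by apply: mW => //; lra.
have H := @hw_cube_sum a b e ltac:(lra) ab be ltac:(lra).
have : c ^+ 5 * D * (hw p W a b * hw p W b e * (hw p W a b + hw p W b e)) <=
   c ^+ 5 * D * (2 * hw p W a e ^+ 3) by rewrite ler_wpM2l//; nneg.
lra.
Qed.

(** The integrals all start at 0: a fine partition of [0, s] is continued by one of [s, t], so that
    [I t - I s] is approximated by sums over [s, t]. Before [s0] the integrand enters only through
    the existence of these integrals. *)
Lemma rough_integral_local D V V' s0 t0 (I : R -> 'rV[R]_k) : 0 <= D -> 0 <= s0 -> t0 <= T ->
  (forall t, 0 <= t -> t <= t0 -> is_rough_integral X XX V V' 0 t (I t)) ->
  integrand_bd D s0 t0 V V' ->
  forall s t, s0 <= s -> s <= t -> t <= t0 ->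
  `|I t - I s - rough_germ V V' s t| <= 2 * sew_const (3 / p) * c ^+ 5 * D * hw p W s t ^+ 3.
Proof.
move=> D0 s00 t0T HI HV s t ss st tt.
apply/ler_addgt0Pr => eps eps0.
have [d1 d10 H1] := HI s ltac:(lra) ltac:(lra) (eps / 2) ltac:(lra).
have [d2 d20 H2] := HI t ltac:(lra) ltac:(lra) (eps / 2) ltac:(lra).
have dm0 : 0 < Num.min d1 d2 by rewrite lt_min d10.
have [p1 P1 /mesh_ltP M1] := itv_partition_mesh dm0 (le_trans s00 ss).
have [q1 Q1 /mesh_ltP N1] := itv_partition_mesh dm0 st.
have P1l : last 0 p1 = s by case: P1 => _ /eqP.
have {}H1 := H1 p1 P1; rewrite part_sumE in H1.
have {}H2 := H2 (p1 ++ q1) (itv_partition_cat P1 Q1).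
rewrite part_sumE psum_cat P1l in H2.
have {}H1 : `|psum (rough_germ V V') 0 p1 - I s| < eps / 2.
  apply: H1; apply/mesh_ltP; apply: sub_path M1 => u v /=.
  by rewrite lt_min => /andP[].
have {}H2 : `|psum (rough_germ V V') 0 p1 + psum (rough_germ V V') s q1 - I t| < eps / 2.
  apply: H2; apply/mesh_ltP; rewrite cat_path P1l.
  apply/andP; split; [apply: sub_path M1|apply: sub_path N1] => u v /=;
  by rewrite lt_min => /andP[].
have H3 := rough_germ_sewing D0 s00 t0T HV ss tt Q1.
set K := 2 * _ * _ * _ * _ in H3 *.
set A := psum _ 0 p1 in H1 H2; set B := psum _ s q1 in H2 H3.
have -> : I t - I s - rough_germ V V' s t =
   - (A + B - I t) + (A - I s) + (B - rough_germ V V' s t) by mxring.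
apply: (le_trans (ler_normD _ _)); apply: (le_trans (lerD (ler_normD _ _) (lexx _))).
rewrite normrN; lra.
Qed.

(** The bound [D] of the integrand gains a factor [hw] over the size [v] of its derivative. In the
    contraction, the constants to be improved are inside [D]. *)
Lemma rough_integral_rem D v V V' s0 t0 (I : R -> 'rV[R]_k) :
  0 <= D -> 0 <= v -> 0 <= s0 -> t0 <= T ->
  (forall t, 0 <= t -> t <= t0 -> is_rough_integral X XX V V' 0 t (I t)) ->
  integrand_bd D s0 t0 V V' ->
  forall s t, s0 <= s -> s <= t -> t <= t0 -> `|V' s| <= v ->
  `|I t - I s - lapp (V s) (incr X s t)| <=
    c ^+ 5 * v * hw p W s t ^+ 2 + 2 * sew_const (3 / p) * c ^+ 5 * D * hw p W s t ^+ 3.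
Proof.
move=> D0 v0 s00 t0T HI HV s t ss st tt Vv.
have H := rough_integral_local D0 s00 t0T HI HV ss st tt.
have -> : I t - I s - lapp (V s) (incr X s t) =
   lapp2 (V' s) (XX s t) + (I t - I s - rough_germ V V' s t).
  by rewrite /rough_germ; move: (lapp _ _) (lapp2 _ _) => A B; mxring.
apply: (le_trans (ler_normD _ _)); apply: lerD => //.
apply: (le_trans (lapp2_norm _ _)).
have H4 := hr_XX HX (u := s) (v := t) ltac:(lra) st ltac:(lra).
have [Hdc C0] : d%:R <= c /\ 0 <= c by split => //; exact: le_trans ler01 c1.
have -> : c ^+ 5 * v * hw p W s t ^+ 2 = c ^+ 4 * (v * (c * hw p W s t ^+ 2)) by ring.
by prod_le.
Qed.

End RoughIntegral.

(** Splits off a power [g] of a small quantity, while the remaining power is left to the full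
    control. *)
Lemma powR_interpolate (R : realType) (x y z a g : R) : 0 <= x -> x <= z -> x <= y ->
  0 <= g -> g < a -> x `^ a <= z `^ g * y `^ (a - g).
Proof.
move=> x0 xz xy g0 ga.
have -> : x `^ a = x `^ g * x `^ (a - g).
  rewrite -powRD; first by congr (_ `^ _); lra.
  by apply/implyP => /eqP; lra.
by apply: ler_pM; rewrite ?powR_ge0//; apply: ge0_ler_powR; rewrite ?nnegrE; lra.
Qed.

Section RoughIntegralExistence.
Context {R : realType}.
Variables (d k : nat) (c p T : R) (W : R -> R) (X : R -> 'rV[R]_d) (XX : R -> R -> 'M[R]_d).
Hypotheses (c1 : 1 <= c) (dc : d%:R <= c) (HX : holder_rough c p T W X XX).

Let p2 : 2 < p. Proof. by case: (hr_p HX). Qed.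

Lemma is_rough_integralB (V V1 : R -> linmx R d 1 k) (V' V1' : R -> linmx R d d (1 * k)) s t I J :
  is_rough_integral X XX V V' s t I -> is_rough_integral X XX V1 V1' s t J ->
  is_rough_integral X XX (fun u => V u - V1 u) (fun u => V' u - V1' u) s t (I - J).
Proof.
move=> HI HJ eps eps0.
have [d1 d10 H1] := HI (eps / 2) ltac:(lra).
have [d2 d20 H2] := HJ (eps / 2) ltac:(lra).
exists (Num.min d1 d2); first by rewrite lt_min d10.
move=> pi Hpi /mesh_ltP mpi.
have {}H1 := H1 pi Hpi; have {}H2 := H2 pi Hpi.
have {}H1 := H1 ltac:(apply/mesh_ltP; apply: sub_path mpi => u v; rewrite lt_min => /andP[]; done).
have {}H2 := H2 ltac:(apply/mesh_ltP; apply: sub_path mpi => u v; rewrite lt_min => /andP[]; done).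
rewrite part_sumE in H1; rewrite part_sumE in H2; rewrite part_sumE.
have -> : psum (fun u v => lapp (V u - V1 u) (incr X u v) + lapp2 (V' u - V1' u) (XX u v)) s pi =
   psum (rough_germ X XX V V') s pi - psum (rough_germ X XX V1 V1') s pi.
  rewrite -psumB; congr (psum _ s pi); apply/funext => u; apply/funext => v.
  rewrite /rough_germ lappBl lapp2Bl.
  by move: (lapp _ _) (lapp _ _) (lapp2 _ _) (lapp2 _ _) => x1 x2 x3 x4; mxring.
rewrite -/(rough_germ X XX V V') -/(rough_germ X XX V1 V1') in H1 H2.
have -> : psum (rough_germ X XX V V') s pi - psum (rough_germ X XX V1 V1') s pi - (I - J) =
  (psum (rough_germ X XX V V') s pi - I) - (psum (rough_germ X XX V1 V1') s pi - J) by mxring.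
apply: (le_lt_trans (ler_normB _ _)); rewrite [eps]splitr; exact: ltrD.
Qed.

(** A second sewing, with an exponent closer to 1: part of the surplus [3 / p - 1] is traded for a
    small factor coming from the small half given by [control_modulus]. The error becomes [eta]
    times the control, as [sewing_limit] requires. *)
Lemma rough_germ_sewing_fine D V V' : 0 <= D -> integrand_bd p W X D 0 T V V' ->
  forall eta, 0 < eta -> exists2 delta, 0 < delta &
     forall u v q, 0 <= u -> v <= T -> v - u < delta -> itv_partition u v q ->
     `|psum (@rough_germ R d k X XX V V') u q - rough_germ X XX V V' u v| <= eta * (W v - W u).
Proof.
move=> D0 HV eta eta0.
have [P2 P3] := hr_p HX; have C0 : 0 <= c by exact: le_trans ler01 c1.
have T0 := hr_T HX; have [W0 mW _] := hr_W HX.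
(* Half of the surplus: [3 / p - g = 1 + g], so the exponent still exceeds 1 after [g] has been
   given away. *)
pose g := (3 / p - 1) / 2.
have k3 : 1 < 3 / p by rewrite ltr_pdivlMr; lra.
have ip : 3 / p - 1 < 2 * p^-1.
  by rewrite -subr_lt0; have -> : 3 / p - 1 - 2 * p^-1 = - (p - 1) / p by [field; apply/eqP; lra];
    rewrite mulNr oppr_lt0 divr_gt0; lra.
have g0 : 0 < g by rewrite /g; lra.
have gp : 0 < p^-1 - g by rewrite /g; lra.
have k1 : 1 < 1 + g by lra.
pose Wg := (W T) `^ g.
have Wg0 : 0 <= Wg by exact: powR_ge0.
pose K := sew_const (1 + g) * (2 * c ^+ 5 * D) * Wg.
have K0 : 0 <= K by (have S0 := sew_const_ge0 k1; rewrite /K; nneg).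
pose z := (eta / (K + 1)) `^ g^-1.
have ez : 0 < eta / (K + 1) by rewrite divr_gt0//; lra.
have z0 : 0 < z by exact: powR_gt0.
have zg : z `^ g = eta / (K + 1).
  by rewrite -powRrM mulVf ?powRr1 ?ltW//; apply/eqP; lra.
have [delta d0 Hd] := control_modulus T0 (hr_W HX) z0.
exists delta => // u v q u0 vT uv Hq.
have uv' := itv_partition_le Hq.
have Wuv := mW u v u0 uv' vT.
have := @sewing R 1 k W (rough_germ X XX V V') (1 + g) (2 * c ^+ 5 * D * z `^ g) u v k1.
move=> H; have {}H := H _ _ _ _ q u v (lexx u) (lexx v) Hq.
have {H} : `|psum (rough_germ X XX V V') u q - rough_germ X XX V V' u v| <=
   sew_const (1 + g) * (2 * c ^+ 5 * D * z `^ g) * (W v - W u) `^ (1 + g).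
  apply: H.
  - by nneg.
  - by move=> *; apply: mW => //; lra.
  - by move=> *; apply: (rough_germxx HX); lra.
  move=> a b e ua ab be ev bv.
  have a0 : 0 <= a by lra.
  have eT : e <= T by lra.
  apply: (le_trans (rough_germ_defect_le c1 dc HX D0 (lexx 0) (lexx T) HV a0 ab be eT _)); first lra.
  have Wab := mW a b a0 ab ltac:(lra); have Wbe := mW b e ltac:(lra) be eT.
  have [h1 h2] : hw p W a b <= hw p W a e /\ hw p W b e <= hw p W a e.
    by split; apply: (hw_le p2 (hr_W HX)).
  have small x : 0 <= x -> x <= z -> x <= W e - W a ->
      x `^ p^-1 <= z `^ g * (W e - W a) `^ (p^-1 - g).
    by move=> x0 xz xW; apply: powR_interpolate => //; [exact: ltW|rewrite -subr_gt0].
  have hmin : hw p W a b * hw p W b e <= z `^ g * (W e - W a) `^ (p^-1 - g) * hw p W a e.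
    have [Hab|Hbe] := Hd a b e a0 ab be eT ltac:(lra).
      by apply: ler_pM; rewrite ?hw_ge0//; apply: small; rewrite ?subr_ge0 ?lerD2r.
    by rewrite mulrC; apply: ler_pM; rewrite ?hw_ge0//; apply: small; rewrite ?subr_ge0 ?lerD2l ?lerN2.
  have -> : (W e - W a) `^ (1 + g) = (W e - W a) `^ (p^-1 - g) * hw p W a e ^+ 2.
    rewrite hw_exp; last lra.
    rewrite -powRD; last by apply/implyP => /eqP; rewrite /g; lra.
    by congr (_ `^ _); rewrite /g; lra.
  have h30 := hw_ge0 p W a e.
  have hs : hw p W a b + hw p W b e <= 2 * hw p W a e by lra.
  have := ler_pM (mulr_ge0 (hw_ge0 p W a b) (hw_ge0 p W b e))
     (addr_ge0 (hw_ge0 p W a b) (hw_ge0 p W b e)) hmin hs.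
  have CD : 0 <= c ^+ 5 * D by nneg.
  move=> /(ler_wpM2l CD) Hm.
  apply: (le_trans _ (le_trans Hm _)); first by rewrite le_eqVlt; apply/orP; left; apply/eqP; ring.
  by rewrite le_eqVlt; apply/orP; left; apply/eqP; ring.
move=> H; apply: (le_trans H).
rewrite powRD; last by apply/implyP => /eqP; lra.
rewrite powRr1 ?subr_ge0// zg.
have WvT : (W v - W u) `^ g <= Wg.
  apply: ge0_ler_powR; rewrite ?nnegrE; [lra|lra| |].
    by have := mW 0 T (lexx 0) (ltW T0) (lexx T); lra.
  by have := mW 0 u (lexx 0) u0 ltac:(lra); have := mW v T ltac:(lra) vT (lexx T); lra.
apply: (@le_trans _ _ (sew_const (1 + g) * (2 * c ^+ 5 * D * (eta / (K + 1))) * ((W v - W u) * Wg))).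
  apply: ler_wpM2l; last by rewrite ler_wpM2l// subr_ge0.
  have [S0 ez0] := (sew_const_ge0 k1, ltW ez); by rewrite mulr_ge0// mulr_ge0// mulr_ge0// mulr_ge0// exprn_ge0.
have -> : sew_const (1 + g) * (2 * c ^+ 5 * D * (eta / (K + 1))) * ((W v - W u) * Wg) =
   (K / (K + 1)) * (eta * (W v - W u)) by rewrite /K; ring.
apply: ler_piMl; first by rewrite mulr_ge0 ?subr_ge0// ltW.
by rewrite ler_pdivrMr; lra.
Qed.

Lemma rough_integral_exists D V V' : 0 <= D -> integrand_bd p W X D 0 T V V' ->
  forall t, 0 <= t -> t <= T -> exists I : 'rV[R]_k, is_rough_integral X XX V V' 0 t I.
Proof.
move=> D0 HV t t0 tT; have [_ mW _] := hr_W HX.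
apply: (@sewing_limit R 1 k (rough_germ X XX V V') W 0 t t0); first exact: mW.
move=> eta eta0; have [delta d0 Hd] := rough_germ_sewing_fine D0 HV eta0.
by exists delta => // u v q u0 vt; apply: Hd => //; exact: le_trans tT.
Qed.

Lemma rough_integral0 V V' (I : 'rV[R]_k) : is_rough_integral X XX V V' 0 0 I -> I = 0.
Proof.
move=> HI; apply/eqP; rewrite -normr_le0; apply/ler_addgt0Pr => eps eps0; rewrite add0r.
have [delta d0 H] := HI eps eps0.
have := H [::] (conj isT (eqxx 0)).
rewrite part_sumE /= sub0r normrN => H'; apply/ltW/H'.
by move=> u i.
Qed.

End RoughIntegralExistence.

(** * Controlled paths and one step of the solution map *)

Section JointPath.
Context {R : realType}.
Variables (d : nat).

(* Removes the [mxvec] encoding of the target of a linear map into row vectors. *)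
Definition unlin {m : nat} (A : linmx R d 1 m) : 'M[R]_(d, m) :=
  \matrix_(i, j) A i (mxvec_index ord0 j).

Lemma unlinE m (A : linmx R d 1 m) x : x *m unlin A = lapp A x.
Proof.
apply/matrixP => i j; rewrite [i]ord1 !mxE.
by apply: eq_bigr => l _; rewrite !mxE.
Qed.

Lemma unlinB m (A B : linmx R d 1 m) : unlin (A - B) = unlin A - unlin B.
Proof. by apply/matrixP => i j; rewrite !mxE. Qed.

Lemma unlin_norm m (A : linmx R d 1 m) : `|unlin A| <= `|A|.
Proof. by apply/mx_norm_leP => // i j; rewrite mxE mx_norm_entry. Qed.

Variables (e k : nat) (alpha : R -> 'rV[R]_e) (alpha' : R -> linmx R d 1 e)
  (Y : R -> 'rV[R]_k) (Y' : R -> linmx R d 1 k).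

Definition joint (u : R) : 'rV[R]_(e + k) := row_mx (alpha u) (Y u).
Definition joint' (u : R) : 'M[R]_(d, e + k) := row_mx (unlin (alpha' u)) (unlin (Y' u)).

Lemma mul_joint' (x : 'rV[R]_d) u :
  x *m joint' u = row_mx (lapp (alpha' u) x) (lapp (Y' u) x).
Proof. by rewrite mul_mx_row !unlinE. Qed.

(** Brings the derivative of the integrand to the form [A *m Df z] for which the composition
    estimates are stated. *)
Lemma fpath'E (f : 'rV[R]_(e + k) -> linmx R d 1 k) u :
  fpath' f alpha alpha' Y Y' u = joint' u *m frechet f (joint u).
Proof.
rewrite /fpath' -/(joint u); move: (frechet f (joint u)) => A.
apply/matrixP => i j; rewrite /mklin mxE -mul_joint' /lapp vec_mxK -mulmxA -rowE.
by rewrite mxE.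
Qed.

Lemma remainder_joint (X : R -> 'rV[R]_d) u v :
  joint v - joint u - incr X u v *m joint' u =
  row_mx (remainder X alpha alpha' u v) (remainder X Y Y' u v).
Proof.
by rewrite mul_joint' /joint /remainder /incr !opp_row_mx !add_row_mx.
Qed.

End JointPath.

Section Steps.
Context {R : realType}.
Variables (d e k : nat).

(** The path itself is not bounded here: [f] and its derivatives are bounded globally, so only
    increments of the path enter. The set [D] will be a closed or half-open piece. *)
Definition ctl_bd {m : nat} (p : R) (W : R -> R) (X : R -> 'rV[R]_d) (D : set R) (a b r : R)
    (Y : R -> 'rV[R]_m) (Y' : R -> linmx R d 1 m) : Prop :=
  forall u v, D u -> D v -> u <= v ->
    [/\ `|Y' u| <= a, `|Y' v| <= a, `|Y' v - Y' u| <= b * hw p W u v &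
        `|remainder X Y Y' u v| <= r * hw p W u v ^+ 2].

Lemma incr_remainder m (X : R -> 'rV[R]_d) (Y : R -> 'rV[R]_m) Y' u v :
  Y v - Y u = lapp (Y' u) (incr X u v) + remainder X Y Y' u v.
Proof. by rewrite /remainder [RHS]addrC subrK. Qed.

Section Integrand.
Variables (c p T : R) (W : R -> R) (X : R -> 'rV[R]_d) (XX : R -> R -> 'M[R]_d).
Hypotheses (c1 : 1 <= c) (dc : d%:R <= c) (nc : (e + k)%:R <= c).
Hypothesis HX : holder_rough c p T W X XX.
Hypothesis hc : forall u v, 0 <= u -> u <= v -> v <= T -> hw p W u v <= c.
Variables (f : 'rV[R]_(e + k) -> linmx R d 1 k) (Df : 'rV[R]_(e + k) -> linmx R (e + k) d (1 * k))
  (D2f : 'rV[R]_(e + k) -> linmx R (e + k) (e + k) (d * (1 * k))).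
Hypothesis fc : C2bd c f Df D2f.
Variables (D : set R) (b r : R) (alpha : R -> 'rV[R]_e) (alpha' : R -> linmx R d 1 e)
  (Y : R -> 'rV[R]_k) (Y' : R -> linmx R d 1 k).
Hypotheses (DT : forall u, D u -> 0 <= u <= T) (b0 : 0 <= b) (r0 : 0 <= r).
Hypothesis Hal : ctl_bd p W X D c c c alpha alpha'.
Hypothesis HY : ctl_bd p W X D (2 * c) b r Y Y'.

Local Notation V := (fun u => f (joint alpha Y u)).
Local Notation V' := (fun u => joint' alpha' Y' u *m Df (joint alpha Y u)).

Lemma integrand_bounds u v : D u -> D v -> u <= v ->
  [/\ `|V v - V u| <= (3 * c) ^+ 4 * c * (1 + (c + r) * hw p W u v) * hw p W u v,
      `|V' u| <= (3 * c) ^+ 2 * c,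
      `|V' v - V' u| <= (3 * c) ^+ 6 * c * (1 + (c + b) + (c + r) * hw p W u v) * hw p W u v &
      `|V v - V u - lapp (V' u) (incr X u v)| <= (3 * c) ^+ 8 * c * (1 + (c + r)) * hw p W u v ^+ 2].
Proof.
move=> Du Dv uv; have /andP[u0 uT] := DT Du; have /andP[v0 vT] := DT Dv.
have [A1 A2 A3 A4] := Hal Du Dv uv; have [B1 B2 B3 B4] := HY Du Dv uv.
have HXuv := hr_X HX u0 uv vT.
have [C1 [Hd Hn]] := (c1, (dc, nc)); have C0 : 0 <= c by lra.
have [Hb0 Hr0] := (b0, r0).
have h0 := hw_ge0 p W u v; set h := hw p W u v in A3 A4 B3 B4 HXuv h0 *.
(* The derivative of the joint path is bounded by [c] for [alpha'] plus [2 * c] for [Y'], so the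
   composition estimates are used with [3 * c]. *)
have g1 : 1 <= 3 * c by lra.
have gn : (e + k)%:R <= 3 * c by lra.
have gd : d%:R <= 3 * c by lra.
have xh : `|incr X u v| <= 3 * c * h by apply: (le_trans HXuv); rewrite ler_wpM2r//; lra.
have nZ w : `|alpha' w| <= c -> `|Y' w| <= 2 * c -> `|joint' alpha' Y' w| <= 3 * c.
  move=> a1 a2; apply: (le_trans (row_mx_norm _ _)).
  have := unlin_norm (alpha' w); have := unlin_norm (Y' w); lra.
have Zc := nZ u A1 B1.
have cr0 : 0 <= c + r by lra.
have rho : `|joint alpha Y v - joint alpha Y u - incr X u v *m joint' alpha' Y' u| <= (c + r) * h ^+ 2.
  rewrite remainder_joint; apply: (le_trans (row_mx_norm _ _)); lra.
have dZ : `|joint' alpha' Y' v - joint' alpha' Y' u| <= (c + b) * h.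
  rewrite /joint' opp_row_mx add_row_mx -!unlinB; apply: (le_trans (row_mx_norm _ _)).
  have := unlin_norm (alpha' v - alpha' u); have := unlin_norm (Y' v - Y' u); lra.
have cb0 : 0 <= c + b by lra.
split.
- exact: (comp_bound1 g1 gn gd fc h0 cr0 xh Zc rho).
- exact: (comp_bound0 g1 gn gd fc h0 cr0 xh Zc rho).
- exact: (comp_bound3 g1 gn gd fc h0 cr0 xh Zc rho cb0 dZ).
- have := comp_bound2 g1 gn gd fc h0 cr0 xh Zc rho.
  by rewrite /lapp mulmxA.
Qed.

(** All constants are merged into one, but the affine dependence on [b] and [r] and the factor [hw]
    next to [r] are kept, since the contraction is read off from them. *)
Lemma integrand_bounds' u v : D u -> D v -> u <= v -> let K := (3 * c) ^+ 10 in
  [/\ `|V v - V u| <= K * (1 + r * hw p W u v) * hw p W u v,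
      `|V' u| <= K,
      `|V' v - V' u| <= K * (1 + b + r * hw p W u v) * hw p W u v &
      `|V v - V u - lapp (V' u) (incr X u v)| <= K * (1 + r) * hw p W u v ^+ 2].
Proof.
move=> Du Dv uv K; have [H1 H2 H3 H4] := integrand_bounds Du Dv uv.
have /andP[u0 uT] := DT Du; have /andP[v0 vT] := DT Dv.
have hh := hc u0 uv vT; have h0 := hw_ge0 p W u v.
set h := hw p W u v in H1 H3 H4 hh h0 *.
have [C1 [Hb0 Hr0]] := (c1, (b0, r0)); have C0 : 0 <= c by lra.
have pw i : 0 <= (3 * c) ^+ i by rewrite exprn_ge0//; lra.
have mono i j : (i <= j)%N -> (3 * c) ^+ i <= (3 * c) ^+ j by move=> ij; rewrite ler_weXn2l//; lra.
have ch : c * h <= c * c by rewrite ler_wpM2l.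
have c2 : 1 <= c * c by rewrite -[leLHS]mulr1 ler_pM.
have cc : c <= c * c by rewrite -[leLHS]mulr1 ler_wpM2l.
have rh : 0 <= r * h by rewrite mulr_ge0.
have c2b : b <= c * c * b by rewrite ler_peMl.
have c2r : r <= c * c * r by rewrite ler_peMl.
have c2rh : r * h <= c * c * (r * h) by rewrite ler_peMl.
have ccc : c <= c ^+ 3 by rewrite -[leLHS]expr1 ler_weXn2l.
split.
- apply: (le_trans H1); apply: ler_wpM2r => //.
  apply: (@le_trans _ _ ((3 * c) ^+ 4 * c * (2 * (c * c) * (1 + r * h)))).
    by apply: ler_wpM2l; [rewrite mulr_ge0|lra].
  have -> : (3 * c) ^+ 4 * c * (2 * (c * c) * (1 + r * h)) =
     (2 / 27) * (3 * c) ^+ 7 * (1 + r * h) by field.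
  apply: ler_wpM2r; first lra.
  have := mono 7%N 10%N isT; have := pw 7%N; rewrite /K; lra.
- apply: (le_trans H2); have -> : (3 * c) ^+ 2 * c = 3^-1 * (3 * c) ^+ 3 by field.
  have := mono 3%N 10%N isT; have := pw 3%N; rewrite /K; lra.
- apply: (le_trans H3); apply: ler_wpM2r => //.
  apply: (@le_trans _ _ ((3 * c) ^+ 6 * c * (3 * (c * c) * (1 + b + r * h)))).
    by apply: ler_wpM2l; [rewrite mulr_ge0|lra].
  have -> : (3 * c) ^+ 6 * c * (3 * (c * c) * (1 + b + r * h)) =
     9^-1 * (3 * c) ^+ 9 * (1 + b + r * h) by field.
  apply: ler_wpM2r; first lra.
  have := mono 9%N 10%N isT; have := pw 9%N; rewrite /K; lra.
- apply: (le_trans H4); apply: ler_wpM2r; first exact: exprn_ge0.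
  apply: (@le_trans _ _ ((3 * c) ^+ 8 * c * (2 * c * (1 + r)))).
    have : r <= c * r by rewrite ler_peMl.
    by move=> ?; apply: ler_wpM2l; [rewrite mulr_ge0|lra].
  have -> : (3 * c) ^+ 8 * c * (2 * c * (1 + r)) = (2 / 9) * (3 * c) ^+ 10 * (1 + r) by field.
  apply: ler_wpM2r; first lra.
  have := pw 10%N; rewrite /K; lra.
Qed.

End Integrand.

(** A relation rather than a map, since the integral is known through its defining limit only. *)
Definition picard_image (X : R -> 'rV[R]_d) (XX : R -> R -> 'M[R]_d) (T : R)
    (V : R -> linmx R d 1 k) (V' : R -> linmx R d d (1 * k)) (y : R -> 'rV[R]_k)
    (y' : R -> linmx R d 1 k) (U : R -> 'rV[R]_k) (U' : R -> linmx R d 1 k) : Prop :=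
  forall t, 0 <= t -> t <= T ->
    U' t = y' t + V t /\ is_rough_integral X XX V V' 0 t (U t - y t).

Lemma picard_image_rem X XX T V V' y y' U U' u v : picard_image X XX T V V' y y' U U' ->
  0 <= u -> u <= v -> v <= T ->
  remainder X U U' u v = remainder X y y' u v +
    ((U v - y v) - (U u - y u) - lapp (V u) (incr X u v)).
Proof.
move=> H u0 uv vT; have [EU _] := H u u0 (le_trans uv vT).
rewrite /remainder EU lappDl /incr; move: (lapp _ _) (lapp _ _) => A B; mxring.
Qed.

Section Step.
Variables (c p T : R) (W : R -> R) (X : R -> 'rV[R]_d) (XX : R -> R -> 'M[R]_d).
Hypotheses (c1 : 1 <= c) (dc : d%:R <= c) (nc : (e + k)%:R <= c).
Hypothesis HX : holder_rough c p T W X XX.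
Hypothesis hc : forall u v, 0 <= u -> u <= v -> v <= T -> hw p W u v <= c.
Hypothesis sc : sew_const (3 / p) <= c.
Variables (f : 'rV[R]_(e + k) -> linmx R d 1 k) (Df : 'rV[R]_(e + k) -> linmx R (e + k) d (1 * k))
  (D2f : 'rV[R]_(e + k) -> linmx R (e + k) (e + k) (d * (1 * k))).
Hypothesis fc : C2bd c f Df D2f.
Variables (alpha : R -> 'rV[R]_e) (alpha' : R -> linmx R d 1 e)
  (Y U y : R -> 'rV[R]_k) (Y' U' y' : R -> linmx R d 1 k).
Hypothesis Hal : ctl_bd p W X `[0, T] c c c alpha alpha'.
Hypothesis Hy : ctl_bd p W X `[0, T] c c c y y'.

Local Notation V := (fun u => f (joint alpha Y u)).
Local Notation V' := (fun u => joint' alpha' Y' u *m Df (joint alpha Y u)).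
Hypothesis HU : picard_image X XX T V V' y y' U U'.

Let in0T u : 0 <= u -> u <= T -> `[0, T]%classic u.
Proof. by move=> u0 uT; rewrite /= in_itv/= u0. Qed.

(** It holds for every argument [Y] because [f] is bounded, so this bound never deteriorates under
    iteration. *)
Lemma step_sup u : 0 <= u -> u <= T -> `|U' u| <= 2 * c.
Proof.
move=> u0 uT; have [-> _] := HU u0 uT.
have [H _ _ _] := Hy (in0T u0 uT) (in0T u0 uT) (lexx u).
have [_ fb _] := fc.1; have := fb (joint alpha Y u).
by move=> H2; apply: le_trans (ler_normD _ _) _; lra.
Qed.

Variables (b r : R).
Hypotheses (b0 : 0 <= b) (r0 : 0 <= r).
Let K1 := (3 * c) ^+ 20.

(** The bound contains [r] but not [b]: [U'] depends on [Y] through its values only, and their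
    increments are given by the sup bound of [Y'] and the remainder. Closed pieces rely on this. *)
Lemma step_deriv (D : set R) u v : (forall u, D u -> 0 <= u <= T) ->
  ctl_bd p W X D (2 * c) b r Y Y' -> D u -> D v -> u <= v ->
  `|U' v - U' u| <= K1 * (1 + r * hw p W u v) * hw p W u v.
Proof.
move=> DT HY Du Dv uv; have /andP[u0 uT] := DT u Du; have /andP[v0 vT] := DT v Dv.
have HalD : ctl_bd p W X D c c c alpha alpha'.
  by move=> x z Dx Dz; apply: Hal; apply/in0T; case/andP: (DT _ Dx); case/andP: (DT _ Dz).
have [H _ _ _] := integrand_bounds' c1 dc nc HX hc fc DT b0 r0 HalD HY Du Dv uv.
have [-> _] := HU v0 vT; have [-> _] := HU u0 uT.
have [_ _ Hb _] := Hy (in0T u0 uT) (in0T v0 vT) uv.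
have h0 := hw_ge0 p W u v; set h := hw p W u v in H Hb h0 *.
have -> : y' v + f (joint alpha Y v) - (y' u + f (joint alpha Y u)) =
  (y' v - y' u) + (f (joint alpha Y v) - f (joint alpha Y u)) by mxring.
apply: (le_trans (ler_normD _ _)); apply: (le_trans (lerD Hb H)).
have [C1 [Hb0 Hr0]] := (c1, (b0, r0)).
rewrite -mulrDl; apply: ler_wpM2r => //.
have rh : 0 <= r * h by rewrite mulr_ge0.
have mono i j : (i <= j)%N -> (3 * c) ^+ i <= (3 * c) ^+ j by move=> ij; rewrite ler_weXn2l//; lra.
have K1E : 2 * (3 * c) ^+ 10 <= K1.
  have -> : K1 = (3 * c) ^+ 10 * (3 * c) ^+ 10 by rewrite /K1 -exprD.
  have h3 : 3 <= (3 * c) ^+ 10 by have := mono 1%N 10%N isT; rewrite expr1; lra.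
  rewrite mulrC ler_wpM2l ?exprn_ge0//; lra.
have cK : c <= (3 * c) ^+ 10 by have := mono 1%N 10%N isT; rewrite expr1; lra.
have cK' : c * 1 <= (3 * c) ^+ 10 * (1 + r * h) by apply: ler_pM; lra.
have : (2 * (3 * c) ^+ 10) * (1 + r * h) <= K1 * (1 + r * h) by apply: ler_wpM2r; lra.
lra.
Qed.

Lemma step_rem s t u v : 0 <= s -> t <= T ->
  ctl_bd p W X `[s, t[ (2 * c) b r Y Y' -> s <= u -> u <= v -> v <= t -> u < t ->
  `|remainder X U U' u v| <= K1 * (1 + (1 + b + r) * hw p W u v) * hw p W u v ^+ 2.
Proof.
move=> s0 tT HY su uv vt ut.
have u0 := le_trans s0 su; have vT := le_trans vt tT; have v0 := le_trans u0 uv.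
rewrite (picard_image_rem HU u0 uv vT).
have [_ _ _ Hry] := Hy (in0T u0 (le_trans uv vT)) (in0T v0 vT) uv.
have DT x : `[s, t[%classic x -> 0 <= x <= T.
  by rewrite /= in_itv/= => /andP[sx xt]; rewrite (le_trans s0 sx) (le_trans (ltW xt)).
have HalD : ctl_bd p W X `[s, t[ c c c alpha alpha'.
  by move=> x z Dx Dz; apply: Hal; apply/in0T; case/andP: (DT _ Dx); case/andP: (DT _ Dz).
have IB x z Dx Dz xz := integrand_bounds' c1 dc nc HX hc fc DT b0 r0 HalD HY (u := x) (v := z) Dx Dz xz.
have [C1 [Hb0 Hr0]] := (c1, (b0, r0)); have C0 : 0 <= c by lra.
have Ssc := sc.
pose K := (3 * c) ^+ 10; have K0 : 0 <= K by rewrite exprn_ge0//; lra.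
(* Inside [D0] the factor [hw] is replaced by its bound [c]; the small factor of the conclusion
   comes from the cube in [rough_integral_rem]. *)
pose D0 := K * (1 + b + c * r).
have D00 : 0 <= D0 by rewrite mulr_ge0//; have := mulr_ge0 C0 Hr0; lra.
have Hint : integrand_bd p W X D0 s t V V'.
  move=> x z sx xz zt.
  have Dx : `[s, t[%classic x by rewrite /= in_itv/= sx (le_lt_trans xz).
  have Dz : `[s, t[%classic z by rewrite /= in_itv/= zt (le_trans sx).
  have [_ _ H3 H4] := IB x z Dx Dz xz.
  have /andP[x0 _] := DT x Dx; have /andP[_ zT] := DT z Dz.
  have hh := hc x0 xz zT.
  split; [apply: (le_trans H3)|apply: (le_trans H4)]; apply: ler_wpM2r; rewrite ?exprn_ge0 ?hw_ge0//.
    by rewrite ler_wpM2l// lerD2l mulrC ler_wpM2r.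
  rewrite ler_wpM2l//; have : r <= c * r by rewrite ler_peMl.
  lra.
have Du : `[s, t[%classic u by rewrite /= in_itv/= su.
have [_ Vu _ _] := IB u u Du Du (lexx u).
have HI : forall z, 0 <= z -> z <= t ->
    is_rough_integral X XX V V' 0 z (U z - y z).
  by move=> z z0 zt; case: (HU z0 (le_trans zt tT)).
have H := rough_integral_rem c1 dc HX D00 K0 s0 tT HI Hint su uv vt Vu.
apply: (le_trans (ler_normD _ _)); apply: (le_trans (lerD Hry H)).
have h0 := hw_ge0 p W u v; have hh := hc u0 uv vT; set h := hw p W u v in h0 hh *.
have -> : c * h ^+ 2 + (c ^+ 5 * K * h ^+ 2 + 2 * sew_const (3 / p) * c ^+ 5 * D0 * h ^+ 3) =
   (c + c ^+ 5 * K + 2 * sew_const (3 / p) * c ^+ 5 * D0 * h) * h ^+ 2 by ring.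
apply: ler_wpM2r; first exact: exprn_ge0.
have S1 : sew_const (3 / p) * (c ^+ 5 * D0 * h) <= c * (c ^+ 5 * D0 * h).
  by apply: ler_wpM2r => //; rewrite mulr_ge0// mulr_ge0// exprn_ge0.
have D1 : D0 <= c * K * (1 + b + r).
  have -> : c * K * (1 + b + r) = K * (c + c * b + c * r) by ring.
  apply: ler_wpM2l => //; have : b <= c * b by rewrite ler_peMl.
  lra.
have S2 : c ^+ 6 * (D0 * h) <= c ^+ 6 * (c * K * (1 + b + r) * h).
  by rewrite ler_wpM2l ?exprn_ge0// ler_wpM2r.
have X0 : 0 <= (1 + b + r) * h by rewrite mulr_ge0//; lra.
have mono i j : (i <= j)%N -> c ^+ i <= c ^+ j by move=> ij; rewrite ler_weXn2l//; lra.
have K1E : 2 * c ^+ 10 * K <= K1.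
  have -> : K1 = (3 * c) ^+ 10 * K by rewrite /K1 /K -exprD.
  apply: ler_wpM2r => //; rewrite exprMn; apply: ler_wpM2r; first exact: exprn_ge0.
  by apply: (@le_trans _ _ (3 ^+ 1)); [by rewrite expr1 ler_nat|by apply: ler_weXn2l; rewrite ?ler1n].
have k1 : c + c ^+ 5 * K <= K1.
  apply: le_trans K1E.
  have K1' : 1 <= K by rewrite /K exprn_ege1//; lra.
  have h1 : c * 1 <= c ^+ 10 * K.
    by apply: ler_pM => //; have := mono 1%N 10%N isT; rewrite expr1.
  have h2 : c ^+ 5 * K <= c ^+ 10 * K by rewrite ler_wpM2r// mono.
  have : 0 <= c ^+ 10 * K by rewrite mulr_ge0// exprn_ge0.
  lra.
have k2 : 2 * c ^+ 7 * K <= K1.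
  apply: le_trans K1E.
  rewrite ler_wpM2r//; have := mono 7%N 10%N isT; have : 0 <= c ^+ 7 by rewrite exprn_ge0.
  lra.
have := ler_wpM2r X0 k2; lra.
Qed.

End Step.
End Steps.

Lemma C3bd_le (R : realType) n m1 m2 (F G : R) (f : 'rV[R]_n -> 'M[R]_(m1, m2)) Df D2f D3f :
  F <= G -> C3bd F f Df D2f D3f -> C3bd G f Df D2f D3f.
Proof.
have H m m' (g : 'rV[R]_n -> 'M[R]_(m, m')) Dg : F <= G -> C1bd F g Dg -> C1bd G g Dg.
  by move=> FG [? h1 h2]; split => // x; exact: le_trans FG.
by move=> FG [h1 [h2 h3]]; split; [exact: H h1|split; [exact: H h2|exact: H h3]].
Qed.

(** * Increments, patching and differences of controlled paths *)

Section ControlledDifference.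
Context {R : realType}.
Variable d : nat.

Lemma remainderB m (X : R -> 'rV[R]_d) (Y Z : R -> 'rV[R]_m) Y' Z' u v :
  remainder X (fun t => Y t - Z t) (fun t => Y' t - Z' t) u v =
  remainder X Y Y' u v - remainder X Z Z' u v.
Proof.
by rewrite /remainder /incr lappBl; move: (lapp _ _) (lapp _ _) => A B; mxring.
Qed.

Section Increments.
Variables (m : nat) (c p T : R) (W : R -> R) (X : R -> 'rV[R]_d) (XX : R -> R -> 'M[R]_d).
Hypotheses (c1 : 1 <= c) (dc : d%:R <= c) (HX : holder_rough c p T W X XX).
Hypothesis hc : forall u v, 0 <= u -> u <= v -> v <= T -> hw p W u v <= c.
Variables (Y : R -> 'rV[R]_m) (Y' : R -> linmx R d 1 m).

Lemma incr_norm a r u v : 0 <= u -> u <= v -> v <= T -> 0 <= r -> `|Y' u| <= a ->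
  `|remainder X Y Y' u v| <= r * hw p W u v ^+ 2 ->
  `|Y v - Y u| <= (c ^+ 2 * a + r * hw p W u v) * hw p W u v.
Proof.
move=> u0 uv vT r0 Ya Hr; rewrite (incr_remainder X Y Y') .
have Hu := hr_X HX u0 uv vT; have [Hd C1] := (dc, c1).
have h0 := hw_ge0 p W u v; set h := hw p W u v in Hr Hu h0 *.
have C0 : 0 <= c by lra.
apply: (le_trans (ler_normD _ _)); apply: (le_trans (lerD (lapp_norm _ _) Hr)).
have : d%:R * (`|Y' u| * `|incr X u v|) <= c * (a * (c * h)) by prod_le.
lra.
Qed.

(** Remainders are not additive: over [u, v] with [t] between them there is the cross term
    [lapp (Y' t - Y' u) (incr X t v)], which costs [c ^+ 2 * b]. *)
Lemma ctl_bd_patch s t t' a b r b2 r2 : 0 <= s -> s <= t -> t <= t' -> t' <= T ->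
  0 <= b -> 0 <= r -> 0 <= b2 -> 0 <= r2 ->
  ctl_bd p W X `[s, t] a b r Y Y' -> ctl_bd p W X `[t, t'] a b2 r2 Y Y' ->
  ctl_bd p W X `[s, t'] a (b + b2) (r + r2 + c ^+ 2 * b) Y Y'.
Proof.
move=> s0 st tt' t'T b0 r0 b20 r20 H1 H2 u v; rewrite /= !in_itv/= => /andP[su ut'] /andP[sv vt'] uv.
have p2 := proj1 (hr_p HX); have cW := hr_W HX.
have I1 x : s <= x -> x <= t -> `[s, t]%classic x by move=> ? ?; rewrite /= in_itv/=; apply/andP.
have I2 x : t <= x -> x <= t' -> `[t, t']%classic x by move=> ? ?; rewrite /= in_itv/=; apply/andP.
have c20 : 0 <= c ^+ 2 by rewrite exprn_ge0//; exact: le_trans ler01 c1.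
have h0 := hw_ge0 p W u v.
have wk (x y z w q : R) : q <= x * y -> y <= z -> 0 <= x -> 0 <= z -> x <= w -> q <= w * z.
  by move=> h1 h2 x0 z0 xw; apply: (le_trans h1); apply: (le_trans (ler_wpM2l x0 h2)); exact: ler_wpM2r.
have [vt|tv] := leP v t.
  have [A1 A2 A3 A4] := H1 u v (I1 u su (le_trans uv vt)) (I1 v sv vt) uv.
  split => //; [apply: (wk _ _ _ _ _ A3)|apply: (wk _ _ _ _ _ A4)] => //; rewrite ?exprn_ge0//; try lra.
  have := mulr_ge0 c20 b0; lra.
have [tu|ut] := leP t u.
  have [A1 A2 A3 A4] := H2 u v (I2 u tu ut') (I2 v (ltW tv) vt') uv.
  split => //; [apply: (wk _ _ _ _ _ A3)|apply: (wk _ _ _ _ _ A4)] => //; rewrite ?exprn_ge0//; try lra.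
  have := mulr_ge0 c20 b0; lra.
have [A1 A2 A3 A4] := H1 u t (I1 u su (ltW ut)) (I1 t st (lexx t)) (ltW ut).
have [B1 B2 B3 B4] := H2 t v (I2 t (lexx t) tt') (I2 v (ltW tv) vt') (ltW tv).
have k1 : hw p W u t <= hw p W u v by apply: (hw_le p2 cW) (le_trans s0 su) (lexx u) (ltW ut) (ltW tv) (le_trans vt' t'T).
have k2 : hw p W t v <= hw p W u v by apply: (hw_le p2 cW) (le_trans s0 su) (ltW ut) (ltW tv) (lexx v) (le_trans vt' t'T).
have [t0 u0] : 0 <= t /\ 0 <= u by split; [exact: le_trans st|exact: le_trans su].
have Hu := hr_X HX t0 (ltW tv) (le_trans vt' t'T).
have C0 : 0 <= c by exact: le_trans ler01 c1.
have Hd := dc.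
have [g1 g2] := (hw_ge0 p W u t, hw_ge0 p W t v).
set h := hw p W u v in h0 k1 k2 *; set h1 := hw p W u t in A3 A4 k1 g1.
set h2 := hw p W t v in B3 B4 Hu k2 g2.
split => //.
  have -> : Y' v - Y' u = (Y' t - Y' u) + (Y' v - Y' t) by mxring.
  apply: (le_trans (ler_normD _ _)); apply: (le_trans (lerD A3 B3)).
  by rewrite mulrDl; apply: lerD; apply: ler_wpM2l.
have -> : remainder X Y Y' u v =
   remainder X Y Y' u t + remainder X Y Y' t v + lapp (Y' t - Y' u) (incr X t v).
  rewrite /remainder (lappBl (Y' t)).
  have -> : incr X u v = incr X u t + incr X t v by rewrite /incr; mxring.
  rewrite lappDr /incr; move: (lapp _ _) (lapp _ _) (lapp _ _) => L1 L2 L3.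
  by mxring.
apply: (le_trans (ler_normD _ _)); apply: (le_trans (lerD (ler_normD _ _) (lapp_norm _ _))).
have k3 : d%:R * (`|Y' t - Y' u| * `|incr X t v|) <= c * (b * h * (c * h)).
  have e1 : `|Y' t - Y' u| <= b * h by apply: (le_trans A3); apply: ler_wpM2l.
  have e2 : `|incr X t v| <= c * h by apply: (le_trans Hu); apply: ler_wpM2l.
  by prod_le.
have k4 : r * h1 ^+ 2 <= r * h ^+ 2 by prod_le.
have k5 : r2 * h2 ^+ 2 <= r2 * h ^+ 2 by prod_le.
lra.
Qed.

End Increments.
End ControlledDifference.

Section IntegrandDifference.
Context {R : realType}.
Variables (d e k : nat).
Variables (c p T : R) (W : R -> R) (X : R -> 'rV[R]_d) (XX : R -> R -> 'M[R]_d).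
Hypotheses (c1 : 1 <= c) (dc : d%:R <= c) (nc : (e + k)%:R <= c).
Hypothesis HX : holder_rough c p T W X XX.
Hypothesis hc : forall u v, 0 <= u -> u <= v -> v <= T -> hw p W u v <= c.

(** Dominates every constant of the joint path; the largest belongs to its increments, where each
    component contributes at most [2 * c ^+ 3]. *)
Let c0 := 4 * c ^+ 3.

Let c0c i j : (j <= 3)%N -> i <= 4 -> i * c ^+ j <= c0.
Proof.
move=> j3 i4; have C1 := c1; rewrite /c0.
have h1 : c ^+ j <= c ^+ 3 by rewrite ler_weXn2l.
have h2 : 0 <= c ^+ j by rewrite exprn_ge0//; lra.
apply: (@le_trans _ _ (4 * c ^+ j)); [exact: ler_wpM2r | exact: ler_wpM2l].
Qed.

Lemma joint_bounds (alpha : R -> 'rV[R]_e) alpha' (Y : R -> 'rV[R]_k) Y' u v :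
  ctl_bd p W X `[0, T] c c c alpha alpha' -> ctl_bd p W X `[0, T] c c c Y Y' ->
  0 <= u -> u <= v -> v <= T ->
  [/\ `|joint' alpha' Y' u| <= c0, `|joint' alpha' Y' v| <= c0,
      `|joint' alpha' Y' v - joint' alpha' Y' u| <= c0 * hw p W u v,
      `|joint alpha Y v - joint alpha Y u| <= c0 * hw p W u v &
      `|joint alpha Y v - joint alpha Y u - incr X u v *m joint' alpha' Y' u|
         <= c0 * hw p W u v ^+ 2].
Proof.
move=> Ha HY u0 uv vT.
have Iu : `[0, T]%classic u by rewrite /= in_itv/= u0 (le_trans uv).
have Iv : `[0, T]%classic v by rewrite /= in_itv/= vT (le_trans u0).
have [A1 A2 A3 A4] := Ha u v Iu Iv uv; have [B1 B2 B3 B4] := HY u v Iu Iv uv.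
have C0 : 0 <= c by exact: le_trans ler01 c1.
have N1 := incr_norm c1 dc HX u0 uv vT C0 A1 A4.
have N2 := incr_norm c1 dc HX u0 uv vT C0 B1 B4.
have hh := hc u0 uv vT; have h0 := hw_ge0 p W u v.
set h := hw p W u v in A3 A4 B3 B4 N1 N2 hh h0 *.
have j1 : 2 * c ^+ 1 <= c0 by apply: c0c => //; rewrite ler_nat.
have j2 : 2 * c ^+ 2 <= c0 by apply: c0c => //; rewrite ler_nat.
have h20 : 0 <= h ^+ 2 by exact: exprn_ge0.
have nZ w : `|alpha' w| <= c -> `|Y' w| <= c -> `|joint' alpha' Y' w| <= c0.
  move=> a1 a2; apply: (le_trans (row_mx_norm _ _)).
  have := unlin_norm (alpha' w); have := unlin_norm (Y' w); rewrite expr1 in j1; lra.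
split; [exact: nZ|exact: nZ| | |].
- rewrite /joint' opp_row_mx add_row_mx -!unlinB; apply: (le_trans (row_mx_norm _ _)).
  have := unlin_norm (alpha' v - alpha' u); have := unlin_norm (Y' v - Y' u).
  have := ler_wpM2r h0 j1; rewrite expr1; lra.
- rewrite /joint opp_row_mx add_row_mx; apply: (le_trans (row_mx_norm _ _)).
  apply: (le_trans (lerD N1 N2)).
  have e1 : c * h <= c ^+ 3.
    by apply: (@le_trans _ _ (c * c)); [exact: ler_wpM2l | rewrite -expr2 ler_weXn2l].
  have e2 : (c ^+ 2 * c + c * h + (c ^+ 2 * c + c * h)) * h <= c0 * h.
    by apply: ler_wpM2r => //; rewrite /c0; lra.
  lra.
- rewrite remainder_joint; apply: (le_trans (row_mx_norm _ _)).
  have := ler_wpM2r h20 j1; rewrite expr1; lra.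
Qed.

Variables (E : R) (f f1 : 'rV[R]_(e + k) -> linmx R d 1 k)
  (Df Df1 : 'rV[R]_(e + k) -> linmx R (e + k) d (1 * k))
  (D2f D2f1 : 'rV[R]_(e + k) -> linmx R (e + k) (e + k) (d * (1 * k)))
  (D3f : 'rV[R]_(e + k) -> linmx R (e + k) (e + k) ((e + k) * (d * (1 * k)))).
Hypothesis fc : C3bd c f Df D2f D3f.
Hypothesis gE : C2bd E (fun z => f z - f1 z) (fun z => Df z - Df1 z) (fun z => D2f z - D2f1 z).
Variables (alpha alpha1 : R -> 'rV[R]_e) (alpha' alpha1' : R -> linmx R d 1 e)
  (Y Y1 : R -> 'rV[R]_k) (Y' Y1' : R -> linmx R d 1 k).
Hypothesis Hal : ctl_bd p W X `[0, T] c c c alpha alpha'.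
Hypothesis Hal1 : ctl_bd p W X `[0, T] c c c alpha1 alpha1'.
Hypothesis HY : ctl_bd p W X `[0, T] c c c Y Y'.
Hypothesis HY1 : ctl_bd p W X `[0, T] c c c Y1 Y1'.
Local Notation dal := (fun t => alpha t - alpha1 t).
Local Notation dal' := (fun t => alpha' t - alpha1' t).
Local Notation dY := (fun t => Y t - Y1 t).
Local Notation dY' := (fun t => Y' t - Y1' t).
Hypothesis Hda : ctl_bd p W X `[0, T] E E E dal dal'.
Hypothesis Hda0 : forall u, 0 <= u -> u <= T -> `|alpha u - alpha1 u| <= E.
Local Notation V := (fun u => f (joint alpha Y u)).
Local Notation V' := (fun u => joint' alpha' Y' u *m Df (joint alpha Y u)).
Local Notation V1 := (fun u => f1 (joint alpha1 Y1 u)).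
Local Notation V1' := (fun u => joint' alpha1' Y1' u *m Df1 (joint alpha1 Y1 u)).
Let K := c0 ^+ 16.

Let E0 : 0 <= E. Proof. exact: C1bd_ge0 gE.1. Qed.
Let C0 : 0 <= c. Proof. exact: le_trans ler01 c1. Qed.
Let c01 : 1 <= c0.
Proof.
have := @c0c 1 0%N isT; rewrite expr0 mulr1; apply; exact: (ler_nat R 1 4).
Qed.
Let g1 : 1 <= c0 := c01.
Let cc0 : c <= c0.
Proof. by have := @c0c 1 1%N isT; rewrite mul1r expr1; apply; rewrite ler1n. Qed.
Let gd : d%:R <= c0 := le_trans dc cc0.
Let gn : (e + k)%:R <= c0 := le_trans nc cc0.
Let gf : C3bd c0 f Df D2f D3f := C3bd_le cc0 fc.

(** Differences of joint paths cost a factor [3 * c ^+ 2] over the differences of their components.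
    Together with a numerical factor up to 16 and nine powers of [c0], it is absorbed in [K]. *)
Let powK i (q : R) : i <= 16 -> 0 <= q -> i * c0 ^+ 9 * (3 * c ^+ 2 * q) <= K * q.
Proof.
move=> i16 q0; rewrite /K; have p9 : 0 <= c0 ^+ 9 by rewrite exprn_ge0// (le_trans ler01 c01).
have h1 : 3 * c ^+ 2 <= c0 by apply: c0c => //; rewrite ler_nat.
have c00 : 0 <= c0 by exact: le_trans ler01 c01.
have h4 : 4 <= c0.
  by have := ler_weXn2l c1 (isT : (0 <= 3)%N); rewrite expr0 /c0; lra.
have h5 : i <= c0 ^+ 2.
  apply: (le_trans i16); have -> : 16 = 4 ^+ 2 :> R by rewrite expr2; lra.
  by rewrite lerXn2r ?nnegrE.
have q3 : 3 * c ^+ 2 * q <= c0 * q by rewrite ler_wpM2r.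
have -> : c0 ^+ 16 * q = c0 ^+ 2 * c0 ^+ 9 * (c0 * q) * c0 ^+ 4 by ring.
have q30 : 0 <= 3 * c ^+ 2 * q by rewrite mulr_ge0// mulr_ge0// exprn_ge0.
apply: (@le_trans _ _ (c0 ^+ 2 * c0 ^+ 9 * (c0 * q))).
  apply: (@le_trans _ _ (c0 ^+ 2 * c0 ^+ 9 * (3 * c ^+ 2 * q))).
    by rewrite ler_wpM2r// ler_wpM2r.
  by rewrite ler_wpM2l// mulr_ge0// exprn_ge0.
by rewrite ler_peMr ?exprn_ege1// !mulr_ge0// exprn_ge0.
Qed.

Let powK' j i (q : R) : (j <= 9)%N -> 0 <= i -> i <= 16 -> 0 <= q ->
  i * c0 ^+ j * (3 * c ^+ 2 * q) <= K * q.
Proof.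
move=> j9 i0 i16 q0; apply: le_trans (powK i16 q0).
have q30 : 0 <= 3 * c ^+ 2 * q by rewrite mulr_ge0// mulr_ge0// exprn_ge0.
by rewrite ler_wpM2r// ler_wpM2l// ler_weXn2l.
Qed.

Let in0T u : 0 <= u -> u <= T -> `[0, T]%classic u.
Proof. by move=> u0 uT; rewrite /= in_itv/= u0. Qed.

Let N3 N : 0 <= N -> N + N <= 3 * c ^+ 2 * N /\ N <= 3 * c ^+ 2 * N.
Proof.
move=> N0; have h : 1 <= c ^+ 2 by rewrite exprn_ege1.
have : 1 * N <= c ^+ 2 * N by rewrite ler_wpM2r.
by rewrite mul1r => ?; split; lra.
Qed.

Let djoint u N : 0 <= u -> u <= T -> E <= N -> `|Y u - Y1 u| <= N ->
  `|joint alpha Y u - joint alpha1 Y1 u| <= 3 * c ^+ 2 * N.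
Proof.
move=> u0 uT EN YN; rewrite /joint opp_row_mx add_row_mx.
apply: (le_trans (row_mx_norm _ _)).
have := Hda0 u0 uT; have [] := N3 (le_trans E0 EN); lra.
Qed.

Let djoint' u N : 0 <= u -> u <= T -> E <= N -> `|Y' u - Y1' u| <= N ->
  `|joint' alpha' Y' u - joint' alpha1' Y1' u| <= 3 * c ^+ 2 * N.
Proof.
move=> u0 uT EN YN; rewrite /joint' opp_row_mx add_row_mx -!unlinB.
apply: (le_trans (row_mx_norm _ _)).
have [Ha _ _ _] := Hda (in0T u0 uT) (in0T u0 uT) (lexx u).
have := unlin_norm (alpha' u - alpha1' u); have := unlin_norm (Y' u - Y1' u).
have [] := N3 (le_trans E0 EN); lra.
Qed.

Let djoint_incr u v N : 0 <= u -> u <= v -> v <= T -> E <= N ->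
  `|(Y v - Y1 v) - (Y u - Y1 u)| <= N * hw p W u v ->
  `|joint alpha Y v - joint alpha Y u - (joint alpha1 Y1 v - joint alpha1 Y1 u)|
     <= 3 * c ^+ 2 * N * hw p W u v.
Proof.
move=> u0 uv vT EN YN.
have [A1 _ _ A4] := Hda (in0T u0 (le_trans uv vT)) (in0T (le_trans u0 uv) vT) uv.
have N1 := incr_norm c1 dc HX u0 uv vT E0 A1 A4.
rewrite /joint !(opp_row_mx, add_row_mx).
apply: (le_trans (row_mx_norm _ _)).
have -> : alpha v - alpha u - (alpha1 v - alpha1 u) =
  alpha v - alpha1 v - (alpha u - alpha1 u) by mxring.
have -> : Y v - Y u - (Y1 v - Y1 u) = Y v - Y1 v - (Y u - Y1 u) by mxring.
have hh := hc u0 uv vT; have h0 := hw_ge0 p W u v; set h := hw p W u v in YN N1 hh h0 *.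
apply: (le_trans (lerD N1 YN)); rewrite -mulrDl; apply: ler_wpM2r => //.
have C1 := c1; have HE0 := E0; have N0 := le_trans E0 EN.
have i1 : c ^+ 2 * E <= c ^+ 2 * N by rewrite ler_wpM2l// exprn_ge0// C0.
have i2 : E * h <= c ^+ 2 * N.
  apply: (@le_trans _ _ (N * c)); first exact: ler_pM.
  by rewrite mulrC ler_wpM2r// -[leLHS]expr1 ler_weXn2l.
have i3 : 1 * N <= c ^+ 2 * N by rewrite ler_wpM2r// exprn_ege1.
lra.
Qed.

(** This and the next lemmas are separated by what they require of [Y - Y1]: values, increments,
    derivatives, remainder. The contraction applies them with different sizes. *)
Lemma path_diff_val u q : 0 <= u -> u <= T -> E <= q -> `|Y u - Y1 u| <= q ->
  `|V u - V1 u| <= K * q.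
Proof.
move=> u0 uT Eq Yq.
have Q := djoint u0 uT Eq Yq; have q0 := le_trans E0 Eq.
have EQ : E <= 3 * c ^+ 2 * q by apply: (le_trans Eq); case: (N3 q0).
have h0 := hw_ge0 p W u u.
apply: (le_trans (comp_diff0 g1 gn gd gf gE h0 EQ Q)).
by apply: powK'; rewrite ?ler_nat.
Qed.

Lemma path_diff_incr u v N : 0 <= u -> u <= v -> v <= T -> E <= N ->
  `|Y u - Y1 u| <= N -> `|Y v - Y1 v| <= N ->
  `|(Y v - Y1 v) - (Y u - Y1 u)| <= N * hw p W u v ->
  `|(V v - V1 v) - (V u - V1 u)| <= K * N * hw p W u v.
Proof.
move=> u0 uv vT EN Yu Yv Yuv.
have [uT v0] := (le_trans uv vT, le_trans u0 uv); have n0 := le_trans E0 EN.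
have EQ : E <= 3 * c ^+ 2 * N by apply: (le_trans EN); case: (N3 n0).
have h0 := hw_ge0 p W u v.
have [_ _ _ wz _] := joint_bounds Hal HY u0 uv vT.
have [_ _ _ wz1 _] := joint_bounds Hal1 HY1 u0 uv vT.
have := comp_diff1 g1 gn gd gf gE h0 EQ (djoint u0 uT EN Yu) (djoint v0 vT EN Yv)
  (djoint_incr u0 uv vT EN Yuv) wz wz1.
have -> : V v - V1 v - (V u - V1 u) = V v - V u - (V1 v - V1 u) by mxring.
move/le_trans; apply; apply: ler_wpM2r => //.
by apply: powK'; rewrite ?ler_nat.
Qed.

Lemma path_diff_deriv u N : 0 <= u -> u <= T -> E <= N ->
  `|Y u - Y1 u| <= N -> `|Y' u - Y1' u| <= N -> `|V' u - V1' u| <= K * N.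
Proof.
move=> u0 uT EN Yu Yu'; have n0 := le_trans E0 EN.
have EQ : E <= 3 * c ^+ 2 * N by apply: (le_trans EN); case: (N3 n0).
have [A _ _ _ _] := joint_bounds Hal HY u0 (lexx u) uT.
have [A1 _ _ _ _] := joint_bounds Hal1 HY1 u0 (lexx u) uT.
have h0 := hw_ge0 p W u u.
apply: (le_trans (comp_diff_deriv g1 gn gd gf gE h0 EQ (djoint u0 uT EN Yu) A A1 (djoint' u0 uT EN Yu'))).
by apply: powK'; rewrite ?ler_nat.
Qed.

Lemma path_diff_rem u v L : 0 <= u -> u <= v -> v <= T -> E <= L ->
  `|Y u - Y1 u| <= L -> `|Y v - Y1 v| <= L -> `|Y' u - Y1' u| <= L -> `|Y' v - Y1' v| <= L ->
  `|(Y v - Y1 v) - (Y u - Y1 u)| <= L * hw p W u v ->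
  `|(Y' v - Y1' v) - (Y' u - Y1' u)| <= L * hw p W u v ->
  `|remainder X dY dY' u v| <= L * hw p W u v ^+ 2 ->
  `|(V' v - V1' v) - (V' u - V1' u)| <= K * L * hw p W u v /\
  `|(V v - V1 v) - (V u - V1 u) - lapp (V' u - V1' u) (incr X u v)| <= K * L * hw p W u v ^+ 2.
Proof.
move=> u0 uv vT EN Yu Yv Yu' Yv' Yuv Yuv' Ruv.
have [uT v0] := (le_trans uv vT, le_trans u0 uv); have n0 := le_trans E0 EN.
have EQ : E <= 3 * c ^+ 2 * L by apply: (le_trans EN); case: (N3 n0).
have h0 := hw_ge0 p W u v.
have [A B BA wz rz] := joint_bounds Hal HY u0 uv vT.
have [A1 B1 BA1 wz1 rz1] := joint_bounds Hal1 HY1 u0 uv vT.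
have [_ _ D3 D4] := Hda (in0T u0 (le_trans uv vT)) (in0T (le_trans u0 uv) vT) uv.
have hh := le_trans (hc u0 uv vT) cc0.
have xh : `|incr X u v| <= c0 * hw p W u v.
  by apply: (le_trans (hr_X HX u0 uv vT)); rewrite ler_wpM2r.
have h20 : 0 <= hw p W u v ^+ 2 by exact: exprn_ge0.
have LL : (L + L) <= 3 * c ^+ 2 * L by case: (N3 n0).
have dBA : `|joint' alpha' Y' v - joint' alpha' Y' u - (joint' alpha1' Y1' v - joint' alpha1' Y1' u)|
    <= 3 * c ^+ 2 * L * hw p W u v.
  rewrite /joint' !(opp_row_mx, add_row_mx) -!unlinB.
  apply: (le_trans (row_mx_norm _ _)).
  have -> : alpha' v - alpha' u - (alpha1' v - alpha1' u) =
    alpha' v - alpha1' v - (alpha' u - alpha1' u) by mxring.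
  have -> : Y' v - Y' u - (Y1' v - Y1' u) = Y' v - Y1' v - (Y' u - Y1' u) by mxring.
  apply: (le_trans (lerD (unlin_norm _) (unlin_norm _))).
  apply: (le_trans (lerD D3 Yuv')); rewrite -mulrDl; apply: ler_wpM2r => //; lra.
have drz : `|joint alpha Y v - joint alpha Y u - incr X u v *m joint' alpha' Y' u -
   (joint alpha1 Y1 v - joint alpha1 Y1 u - incr X u v *m joint' alpha1' Y1' u)|
    <= 3 * c ^+ 2 * L * hw p W u v ^+ 2.
  rewrite !remainder_joint opp_row_mx add_row_mx -!remainderB.
  apply: (le_trans (row_mx_norm _ _)).
  apply: (le_trans (lerD D4 Ruv)); rewrite -mulrDl; apply: ler_wpM2r => //; lra.
split.
- have := comp_diff_deriv1 g1 gn gd gf gE h0 EQ (djoint u0 uT EN Yu) (djoint v0 vT EN Yv)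
   (djoint_incr u0 uv vT EN Yuv) wz wz1 A A1 B BA BA1 (djoint' u0 uT EN Yu')
   (djoint' v0 vT EN Yv') dBA.
  have -> : V' v - V1' v - (V' u - V1' u) = V' v - V' u - (V1' v - V1' u) by mxring.
  move/le_trans; apply; apply: ler_wpM2r => //.
  by apply: powK'; rewrite ?ler_nat.
- have := comp_diff_rem g1 gn gd gf gE h0 hh xh EQ (djoint u0 uT EN Yu) (djoint v0 vT EN Yv)
   (djoint_incr u0 uv vT EN Yuv) wz wz1 A A1 B rz rz1 drz.
  have -> : V v - V1 v - (V u - V1 u) - lapp (V' u - V1' u) (incr X u v) =
     V v - V u - lapp (Df (joint alpha Y u)) (incr X u v *m joint' alpha' Y' u) -
     (V1 v - V1 u - lapp (Df1 (joint alpha1 Y1 u)) (incr X u v *m joint' alpha1' Y1' u)).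
    rewrite (lappBl (V' u)) /lapp !mulmxA; move: (vec_mx _) (vec_mx _) => L1 L2; mxring.
  move/le_trans; apply; apply: ler_wpM2r => //.
  by apply: powK'; rewrite ?ler_nat.
Qed.

End IntegrandDifference.

(** * Iterating bounds and assembling them over pieces *)

Section ControlledBounds.
Context {R : realType}.
Variables (d m : nat) (p : R) (W : R -> R) (X : R -> 'rV[R]_d).
Variables (Y : R -> 'rV[R]_m) (Y' : R -> linmx R d 1 m).

Lemma ctl_bd_le D a b r a1 b1 r1 : a <= a1 -> b <= b1 -> r <= r1 ->
  ctl_bd p W X D a b r Y Y' -> ctl_bd p W X D a1 b1 r1 Y Y'.
Proof.
move=> aa bb rr H u v Du Dv uv; have [H1 H2 H3 H4] := H u v Du Dv uv; split.
- exact: le_trans aa.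
- exact: le_trans aa.
- by apply: (le_trans H3); apply: ler_wpM2r => //; exact: hw_ge0.
- by apply: (le_trans H4); apply: ler_wpM2r => //; apply: exprn_ge0; exact: hw_ge0.
Qed.

Lemma ctl_bd_sub (D D1 : set R) a b r : D1 `<=` D ->
  ctl_bd p W X D a b r Y Y' -> ctl_bd p W X D1 a b r Y Y'.
Proof. by move=> DD H u v Du Dv; apply: H; exact: DD. Qed.

(** Removes the [eta] that [halving] leaves. *)
Lemma ctl_bd_lim D a b r : (forall eta, 0 < eta ->
  ctl_bd p W X D (a + eta) (b + eta) (r + eta) Y Y') -> ctl_bd p W X D a b r Y Y'.
Proof.
move=> H u v Du Dv uv.
have lim (x y z : R) : 0 <= y -> (forall eta, 0 < eta -> x <= (z + eta) * y) -> x <= z * y.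
  move=> y0 Hx; apply/ler_addgt0Pr => eps eps0.
  have e0 : 0 < eps / (y + 1) by rewrite divr_gt0//; lra.
  apply: (le_trans (Hx _ e0)); rewrite mulrDl lerD2l -mulrA ler_piMr//; first exact: ltW.
  by rewrite mulrC ler_pdivrMr; lra.
split.
- by rewrite -[a]mulr1; apply: lim => // eta e0; rewrite mulr1; case: (H eta e0 u v Du Dv uv).
- by rewrite -[a]mulr1; apply: lim => // eta e0; rewrite mulr1; case: (H eta e0 u v Du Dv uv).
- by apply: lim => [|eta e0]; [exact: hw_ge0|case: (H eta e0 u v Du Dv uv)].
- by apply: lim => [|eta e0]; [apply: exprn_ge0; exact: hw_ge0|case: (H eta e0 u v Du Dv uv)].
Qed.

End ControlledBounds.

(** Iterating [N / 2 + B] leads to [2 * B] from any start. A bound [N0] that is merely finite is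
    thus replaced by one that does not depend on it. *)
Lemma halving (R : realType) (P : R -> Prop) (B N0 : R) : 0 <= B -> 0 <= N0 ->
  (forall N N1, N <= N1 -> P N -> P N1) ->
  (forall N, 0 <= N -> P N -> P (N / 2 + B)) -> P N0 ->
  forall eta, 0 < eta -> P (2 * B + eta).
Proof.
move=> B0 N00 mP HP PN0 eta eta0.
have Pn n : P (2 * B + N0 * 2^-1 ^+ n).
  elim: n => [|n IH]; first by rewrite expr0 mulr1; apply: mP PN0; lra.
  have h : 0 <= N0 * 2^-1 ^+ n by rewrite mulr_ge0// exprn_ge0//; lra.
  apply: mP (HP _ _ IH); last lra.
  rewrite exprS; lra.
have [n Hn] : exists n, N0 * 2^-1 ^+ n <= eta.
  exists (Num.bound (N0 / eta)).
  have h := archi_boundP (divr_ge0 N00 (ltW eta0)).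
  set n := Num.bound _ in h *.
  have h2 : n%:R <= 2 ^+ n :> R by rewrite -natrX ler_nat ltnW// ltn_expl.
  rewrite exprVn ler_pdivrMr ?exprn_gt0//.
  rewrite mulrC -ler_pdivrMr//; exact: ltW (lt_le_trans h h2).
by apply: mP (Pn n); lra.
Qed.

Section Pieces.
Context {R : realType}.
Variables (d m : nat) (c p T : R) (W : R -> R) (X : R -> 'rV[R]_d) (XX : R -> R -> 'M[R]_d).
Hypotheses (c1 : 1 <= c) (dc : d%:R <= c) (HX : holder_rough c p T W X XX).

(** One application of [ctl_bd_patch] per step, [c ^+ 2] being its cross term. *)
Fixpoint patch_const (B : R) (n : nat) : R :=
  if n is n'.+1 then (2 + c ^+ 2) * patch_const B n' + B else B.

Lemma patch_const_ge0 B n : 0 <= B -> 0 <= patch_const B n.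
Proof.
move=> B0; elim: n => //= n IH; rewrite addr_ge0// mulr_ge0// addr_ge0// exprn_ge0//.
exact: le_trans ler01 c1.
Qed.

Lemma ctl_bd_pieces (a B : R) (tau : nat -> R) N (Y : R -> 'rV[R]_m) Y' :
  0 <= B -> tau 0%N = 0 -> (forall i, tau i <= tau i.+1) -> (forall i, 0 <= tau i <= T) ->
  (forall i, (i < N.+1)%N -> ctl_bd p W X `[tau i, tau i.+1] a B B Y Y') ->
  ctl_bd p W X `[0, tau N.+1] a (patch_const B N) (patch_const B N) Y Y'.
Proof.
move=> B0 t0 tm tT; elim: N => [|N IH] H; first by rewrite -t0; exact: H.
have P0 := patch_const_ge0 N B0.
have c20 : 0 <= c ^+ 2 by rewrite exprn_ge0// (le_trans ler01 c1).
have cP := mulr_ge0 c20 P0.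
have /andP[h1 h2] := tT N.+1; have /andP[h3 h4] := tT N.+2.
have := ctl_bd_patch c1 dc HX (lexx 0) h1 (tm N.+1) h4 P0 P0 B0 B0
  (IH (fun i iN => H i (leq_trans iN (leqnSn _)))) (H N.+1 (leqnn _)).
apply: ctl_bd_le => //=; lra.
Qed.

End Pieces.

(** * The a priori bound *)

Section BaseStep.
Context {R : realType}.
Variables (d e k : nat) (c p T : R) (W : R -> R) (X : R -> 'rV[R]_d) (XX : R -> R -> 'M[R]_d).
Hypotheses (c1 : 1 <= c) (dc : d%:R <= c) (nc : (e + k)%:R <= c).
Hypothesis HX : holder_rough c p T W X XX.
Hypothesis hc : forall u v, 0 <= u -> u <= v -> v <= T -> hw p W u v <= c.
Hypothesis sc : sew_const (3 / p) <= c.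
Variables (f : 'rV[R]_(e + k) -> linmx R d 1 k) (Df : 'rV[R]_(e + k) -> linmx R (e + k) d (1 * k))
  (D2f : 'rV[R]_(e + k) -> linmx R (e + k) (e + k) (d * (1 * k))).
Hypothesis fc : C2bd c f Df D2f.
Variables (alpha : R -> 'rV[R]_e) (alpha' : R -> linmx R d 1 e)
  (y : R -> 'rV[R]_k) (y' : R -> linmx R d 1 k).
Hypothesis Hal : ctl_bd p W X `[0, T] c c c alpha alpha'.
Hypothesis Hy : ctl_bd p W X `[0, T] c c c y y'.

Definition sol_map (Y : R -> 'rV[R]_k) (Y' : R -> linmx R d 1 k) :=
  picard_image X XX T (fun u => f (joint alpha Y u))
    (fun u => joint' alpha' Y' u *m Df (joint alpha Y u)) y y'.

Definition base_const : R := (3 * c) ^+ 20.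
Local Notation K1 := base_const.

Lemma base_const_ge1 : 1 <= K1.
Proof. by rewrite exprn_ege1//; have := c1; lra. Qed.

Lemma itv_co_sub s t : 0 <= s -> t <= T -> `[s, t[%classic `<=` `[0, T]%classic.
Proof.
move=> s0 tT u; rewrite /= !in_itv/= => /andP[su ut].
by rewrite (le_trans s0 su) (le_trans (ltW ut) tT).
Qed.

Lemma itv_cc_sub s t : 0 <= s -> t <= T -> `[s, t]%classic `<=` `[0, T]%classic.
Proof.
move=> s0 tT u; rewrite /= !in_itv/= => /andP[su ut].
by rewrite (le_trans s0 su) (le_trans ut tT).
Qed.

Section OneStep.
Variables (Y U : R -> 'rV[R]_k) (Y' U' : R -> linmx R d 1 k).
Hypothesis HU : sol_map Y Y' U U'.
Variables (s t : R).
Hypotheses (s0 : 0 <= s) (tT : t <= T).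

(** For [hw <= eps] the condition [8 * K1 * eps <= 1] brings [K1 * (1 + (1 + 2 * M) * hw)] below
    [2 * K1 + M / 2]. *)
Lemma base_open M eps : 0 <= M -> 0 <= eps -> 8 * K1 * eps <= 1 ->
  (forall u v, s <= u -> u <= v -> v < t -> hw p W u v <= eps) ->
  ctl_bd p W X `[s, t[ (2 * c) M M Y Y' ->
  ctl_bd p W X `[s, t[ (2 * c) (2 * K1 + M / 2) (2 * K1 + M / 2) U U'.
Proof.
move=> M0 e0 Ke He HYM u v Du Dv uv.
have DT x : `[s, t[%classic x -> 0 <= x <= T by move/(itv_co_sub s0 tT); rewrite /= in_itv.
have /andP[u0 uT] := DT u Du; have /andP[v0 vT] := DT v Dv.
have K1g := base_const_ge1.
have := Du; have := Dv; rewrite /= !in_itv/= => /andP[sv vt] /andP[su ut].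
have hh := He u v su uv vt; have h0 := hw_ge0 p W u v.
have Keh : K1 * hw p W u v <= K1 * eps by apply: ler_wpM2l => //; lra.
have MKeh : M * (K1 * hw p W u v) <= M * (1 / 8) by apply: ler_wpM2l => //; lra.
split.
- exact: (step_sup fc Hy HU).
- exact: (step_sup fc Hy HU).
- apply: (le_trans (step_deriv c1 dc nc HX hc fc Hal Hy HU M0 M0 DT HYM Du Dv uv)).
  by apply: ler_wpM2r => //; rewrite -/K1; lra.
- apply: (le_trans (step_rem c1 dc nc HX hc sc fc Hal Hy HU M0 M0 s0 tT HYM su uv (ltW vt) ut)).
  by apply: ler_wpM2r; rewrite ?exprn_ge0// -/K1; lra.
Qed.

Lemma base_closed_rem M u v : 0 <= M -> ctl_bd p W X `[s, t[ (2 * c) M M Y Y' ->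
  s <= u -> u <= v -> v <= t ->
  `|remainder X U U' u v| <= K1 * (1 + (1 + M + M) * c) * hw p W u v ^+ 2.
Proof.
move=> M0 HYM su uv vt.
have C0 : 0 <= c by exact: le_trans ler01 c1.
have K1g := base_const_ge1.
have [ut|tu] := ltP u t.
  apply: (le_trans (step_rem c1 dc nc HX hc sc fc Hal Hy HU M0 M0 s0 tT HYM su uv vt ut)).
  apply: ler_wpM2r; rewrite ?exprn_ge0// ?hw_ge0// -/K1; apply: ler_wpM2l; first lra.
  rewrite lerD2l; apply: ler_wpM2l; first lra.
  by apply: hc => //; [exact: le_trans su|exact: le_trans tT].
have -> : v = u by lra.
rewrite /remainder /incr !subrr lapp0r subr0 normr0 mulr_ge0 ?exprn_ge0 ?hw_ge0//.
by rewrite mulr_ge0 ?addr_ge0 ?mulr_ge0//; lra.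
Qed.

Lemma base_closed_deriv b r u v : 0 <= b -> 0 <= r -> ctl_bd p W X `[s, t] (2 * c) b r Y Y' ->
  s <= u -> u <= v -> v <= t -> `|U' v - U' u| <= K1 * (1 + r * c) * hw p W u v.
Proof.
move=> b0 r0 HYM su uv vt.
have DT x : `[s, t]%classic x -> 0 <= x <= T by move/(itv_cc_sub s0 tT); rewrite /= in_itv.
have Du : `[s, t]%classic u by rewrite /= in_itv/= su (le_trans uv).
have Dv : `[s, t]%classic v by rewrite /= in_itv/= vt (le_trans su).
have K1g := base_const_ge1.
have /andP[u0 uT] := DT u Du; have /andP[v0 vT] := DT v Dv.
apply: (le_trans (step_deriv c1 dc nc HX hc fc Hal Hy HU b0 r0 DT HYM Du Dv uv)).
apply: ler_wpM2r; rewrite ?hw_ge0// -/K1; apply: ler_wpM2l; first lra.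
by rewrite lerD2l; apply: ler_wpM2l => //; apply: hc.
Qed.

End OneStep.

(** [4 * K1] is the value that [base_open] preserves, and the limit of its iteration; [hw] is
    replaced by [c] because the closed piece may end with a jump. *)
Definition closed_rem_const : R := K1 * (1 + (1 + 4 * K1 + 4 * K1) * c).
Definition closed_const : R := closed_rem_const + K1 * (1 + closed_rem_const * c).

Lemma closed_rem_const_ge1 : 1 <= closed_rem_const.
Proof.
have := base_const_ge1; have := c1; rewrite /closed_rem_const => C1 K1g.
have : 1 * 1 <= K1 * (1 + (1 + 4 * K1 + 4 * K1) * c).
  apply: ler_pM => //; rewrite lerDl mulr_ge0//; lra.
lra.
Qed.

Lemma closed_const_ge : closed_rem_const <= closed_const /\
  K1 * (1 + closed_rem_const * c) <= closed_const.
Proof.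
have := base_const_ge1; have := c1; have h1 := closed_rem_const_ge1 => C1 K1g.
have : 0 <= K1 * (1 + closed_rem_const * c).
  apply: mulr_ge0; first lra.
  by apply: addr_ge0 => //; apply: mulr_ge0; lra.
by rewrite /closed_const; split; lra.
Qed.

Lemma closed_const_ge0 : 0 <= closed_const.
Proof. by have := closed_rem_const_ge1; have [] := closed_const_ge; lra. Qed.

(* Bounds on half-open pieces with small oscillation pass to their closures, since the
   rough integral over [u, t] only involves the integrand before time t. *)
Lemma base_closed Y0 Y0' Y Y' Z Z' s t : 0 <= s -> t <= T ->
  sol_map Y0 Y0' Y Y' -> sol_map Y Y' Z Z' ->
  (exists b r, [/\ 0 <= b, 0 <= r & ctl_bd p W X `[s, t] (2 * c) b r Y Y']) ->
  ctl_bd p W X `[s, t[ (2 * c) (4 * K1) (4 * K1) Y0 Y0' ->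
  ctl_bd p W X `[s, t[ (2 * c) (4 * K1) (4 * K1) Y Y' ->
  ctl_bd p W X `[s, t] (2 * c) closed_const closed_const Z Z'.
Proof.
move=> s0 tT HY HZ [b [r [b0 r0 HYb]]] H0 H1 u v.
have K1g := base_const_ge1; have K40 : 0 <= 4 * K1 by lra.
have [g1 g2] := closed_const_ge; have c1g := closed_rem_const_ge1.
(* The bound [b] is only known to be finite; it may stay, since the conclusion of
   [base_closed_deriv] does not contain it. *)
have HYr : ctl_bd p W X `[s, t] (2 * c) b closed_rem_const Y Y'.
  move=> x z Dx Dz xz; have [A1 A2 A3 _] := HYb x z Dx Dz xz; split => //.
  have := Dx; have := Dz; rewrite /= !in_itv/= => /andP[sz zt] /andP[sx xt].
  exact: (base_closed_rem HY s0 tT K40 H0).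
rewrite /= !in_itv/= => /andP[su ut] /andP[sv vt] uv.
have [u0 uT] : 0 <= u /\ u <= T by split; [exact: le_trans su|exact: le_trans tT].
have [v0 vT] : 0 <= v /\ v <= T by split; [exact: le_trans sv|exact: le_trans tT].
split.
- exact: (step_sup fc Hy HZ).
- exact: (step_sup fc Hy HZ).
- apply: (le_trans (base_closed_deriv HZ s0 tT b0 _ HYr su uv vt)); first lra.
  by apply: ler_wpM2r => //; exact: hw_ge0.
- apply: (le_trans (base_closed_rem HZ s0 tT K40 H1 su uv vt)).
  by apply: ler_wpM2r => //; rewrite exprn_ge0// hw_ge0.
Qed.

Variables (tau : nat -> R) (N : nat) (eps : R).
Hypotheses (t0 : tau 0%N = 0) (tN : tau N.+1 = T) (tm : forall i, tau i <= tau i.+1)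
  (tT : forall i, 0 <= tau i <= T) (eps0 : 0 <= eps) (eK : 8 * K1 * eps <= 1)
  (teps : forall i u v, tau i <= u -> u <= v -> v < tau i.+1 -> hw p W u v <= eps).

Definition global_const : R := patch_const c closed_const N.

(** A solution is its own image, so [base_open] can be iterated on it; [M] starts the iteration and
    disappears in the limit. *)
Lemma apriori_bound Y Y' M : 0 <= M -> sol_map Y Y' Y Y' ->
  ctl_bd p W X `[0, T] (2 * c) M M Y Y' ->
  ctl_bd p W X `[0, T] (2 * c) global_const global_const Y Y'.
Proof.
move=> M0 HY HM; have K1g := base_const_ge1.
have Hop i : ctl_bd p W X `[tau i, tau i.+1[ (2 * c) (4 * K1) (4 * K1) Y Y'.
  have /andP[a0 aT] := tT i; have /andP[b0 bT] := tT i.+1.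
  have Hlim eta : 0 < eta -> ctl_bd p W X `[tau i, tau i.+1[ (2 * c) (2 * (2 * K1) + eta) (2 * (2 * K1) + eta) Y Y'.
    apply: (halving (P := fun z => ctl_bd p W X `[tau i, tau i.+1[ (2 * c) z z Y Y')
       (B := 2 * K1) (N0 := M)) => //; first lra.
    - by move=> z1 z2 z12; apply: ctl_bd_le.
    - move=> z z0 Hz; have := base_open HY a0 bT z0 eps0 eK (teps (i := i)) Hz.
      by apply: ctl_bd_le; lra.
    - by apply: ctl_bd_sub HM; apply: itv_co_sub.
  apply: ctl_bd_lim => eta e0; apply: ctl_bd_le (Hlim eta e0); lra.
rewrite -tN; apply: (ctl_bd_pieces c1 dc HX closed_const_ge0 t0 tm tT).
move=> i _; have /andP[a0 aT] := tT i; have /andP[b0 bT] := tT i.+1.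
apply: (base_closed a0 bT HY HY) => //.
by exists M, M; split => //; apply: ctl_bd_sub HM; apply: itv_cc_sub.
Qed.

End BaseStep.

(** * Stability *)

Section DifferenceStep.
Context {R : realType}.
Variables (d e k : nat) (c p T : R) (W : R -> R) (X : R -> 'rV[R]_d) (XX : R -> R -> 'M[R]_d).
Hypotheses (c1 : 1 <= c) (dc : d%:R <= c) (nc : (e + k)%:R <= c).
Hypothesis HX : holder_rough c p T W X XX.
Hypothesis hc : forall u v, 0 <= u -> u <= v -> v <= T -> hw p W u v <= c.
Hypothesis sc : sew_const (3 / p) <= c.
Variables (E : R) (f f1 : 'rV[R]_(e + k) -> linmx R d 1 k)
  (Df Df1 : 'rV[R]_(e + k) -> linmx R (e + k) d (1 * k))
  (D2f D2f1 : 'rV[R]_(e + k) -> linmx R (e + k) (e + k) (d * (1 * k)))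
  (D3f : 'rV[R]_(e + k) -> linmx R (e + k) (e + k) ((e + k) * (d * (1 * k)))).
Hypothesis fc : C3bd c f Df D2f D3f.
Hypothesis gE : C2bd E (fun z => f z - f1 z) (fun z => Df z - Df1 z) (fun z => D2f z - D2f1 z).
Variables (alpha alpha1 : R -> 'rV[R]_e) (alpha' alpha1' : R -> linmx R d 1 e)
  (y y1 : R -> 'rV[R]_k) (y' y1' : R -> linmx R d 1 k).
Hypothesis Hal : ctl_bd p W X `[0, T] c c c alpha alpha'.
Hypothesis Hal1 : ctl_bd p W X `[0, T] c c c alpha1 alpha1'.
Hypothesis Hda : ctl_bd p W X `[0, T] E E E (fun t => alpha t - alpha1 t) (fun t => alpha' t - alpha1' t).
Hypothesis Hda0 : forall u, 0 <= u -> u <= T -> `|alpha u - alpha1 u| <= E.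
Hypothesis Hdy : ctl_bd p W X `[0, T] E E E (fun t => y t - y1 t) (fun t => y' t - y1' t).

Section OneStep.
Variables (Y Y1 U U1 : R -> 'rV[R]_k) (Y' Y1' U' U1' : R -> linmx R d 1 k).
Hypothesis HY : ctl_bd p W X `[0, T] c c c Y Y'.
Hypothesis HY1 : ctl_bd p W X `[0, T] c c c Y1 Y1'.
Local Notation V := (fun u => f (joint alpha Y u)).
Local Notation V' := (fun u => joint' alpha' Y' u *m Df (joint alpha Y u)).
Local Notation V1 := (fun u => f1 (joint alpha1 Y1 u)).
Local Notation V1' := (fun u => joint' alpha1' Y1' u *m Df1 (joint alpha1 Y1 u)).
Hypothesis HU : picard_image X XX T V V' y y' U U'.
Hypothesis HU1 : picard_image X XX T V1 V1' y1 y1' U1 U1'.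
Local Notation dY := (fun t => Y t - Y1 t).
Local Notation dY' := (fun t => Y' t - Y1' t).
Local Notation dU := (fun t => U t - U1 t).
Local Notation dU' := (fun t => U' t - U1' t).

(** The last power bounds the difference of the integrands, [2 * c ^+ 6] is the cost of integrating
    it, sewing constant included. *)
Definition diff_const : R := 2 * c ^+ 6 * (4 * c ^+ 3) ^+ 16.
Local Notation G := diff_const.
Let K := (4 * c ^+ 3) ^+ 16.

Let E0 : 0 <= E. Proof. exact: C1bd_ge0 gE.1. Qed.
Let C0 : 0 <= c. Proof. exact: le_trans ler01 c1. Qed.
Let K1 : 1 <= K.
Proof.
have h : 1 <= c ^+ 3 by rewrite exprn_ege1.
by rewrite exprn_ege1//; lra.
Qed.

Let GE : 2 * c ^+ 6 * K = G. Proof. by []. Qed.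

Let KG q : 0 <= q -> q + K * q <= G * q.
Proof.
move=> q0; have k1 := K1; have h : 1 <= c ^+ 6 by rewrite exprn_ege1.
have kq : 1 * q <= K * q by apply: ler_wpM2r.
have : 1 * (K * q) <= c ^+ 6 * (K * q) by apply: ler_wpM2r => //; lra.
rewrite -GE; lra.
Qed.

Let in0T u : 0 <= u -> u <= T -> `[0, T]%classic u.
Proof. by move=> u0 uT; rewrite /= in_itv/= u0. Qed.

Lemma diff_const_ge1 : 1 <= G.
Proof.
have k1 := K1; have h : 1 <= c ^+ 6 by rewrite exprn_ege1.
have : 1 * 1 <= c ^+ 6 * K by apply: ler_pM.
rewrite -GE; lra.
Qed.

Lemma diff_step_val u q : 0 <= u -> u <= T -> E <= q -> `|Y u - Y1 u| <= q ->
  `|U' u - U1' u| <= G * q.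
Proof.
move=> u0 uT Eq Yq; have q0 := le_trans E0 Eq.
have [-> _] := HU u0 uT; have [-> _] := HU1 u0 uT.
have H := path_diff_val p W c1 dc nc fc gE Hda0 u0 uT Eq Yq.
have [Hy _ _ _] := Hdy (in0T u0 uT) (in0T u0 uT) (lexx u).
have -> : y' u + V u - (y1' u + V1 u) = (y' u - y1' u) + (V u - V1 u) by mxring.
apply: (le_trans (ler_normD _ _)); apply: le_trans (KG q0).
by apply: lerD => //; exact: le_trans Eq.
Qed.

Lemma diff_step_incr u v N : 0 <= u -> u <= v -> v <= T -> E <= N ->
  `|Y u - Y1 u| <= N -> `|Y v - Y1 v| <= N ->
  `|(Y v - Y1 v) - (Y u - Y1 u)| <= N * hw p W u v ->
  `|(U' v - U1' v) - (U' u - U1' u)| <= G * N * hw p W u v.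
Proof.
move=> u0 uv vT EN Yu Yv Yuv; have n0 := le_trans E0 EN.
have [uT v0] := (le_trans uv vT, le_trans u0 uv).
have [-> _] := HU u0 uT; have [-> _] := HU1 u0 uT.
have [-> _] := HU v0 vT; have [-> _] := HU1 v0 vT.
have H := path_diff_incr c1 dc nc HX hc fc gE Hal Hal1 HY HY1 Hda Hda0 u0 uv vT EN Yu Yv Yuv.
have [_ _ Hy _] := Hdy (in0T u0 uT) (in0T v0 vT) uv.
have -> : y' v + V v - (y1' v + V1 v) - (y' u + V u - (y1' u + V1 u)) =
   (y' v - y1' v - (y' u - y1' u)) + (V v - V1 v - (V u - V1 u)) by mxring.
apply: (le_trans (ler_normD _ _)); have h0 := hw_ge0 p W u v.
apply: (@le_trans _ _ ((N + K * N) * hw p W u v)).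
  rewrite mulrDl; apply: lerD; last exact: H.
  by apply: (le_trans Hy); exact: ler_wpM2r.
by apply: ler_wpM2r => //; exact: KG.
Qed.

(** Values are measured by [N], increments and remainders by the larger [L], which gains a factor
    [hw]. *)
Lemma diff_step_rem s t N L : 0 <= s -> t <= T -> E <= N -> N <= L ->
  (forall u, s <= u -> u < t -> `|Y u - Y1 u| <= N /\ `|Y' u - Y1' u| <= N) ->
  (forall u v, s <= u -> u <= v -> v < t ->
     [/\ `|(Y v - Y1 v) - (Y u - Y1 u)| <= L * hw p W u v,
         `|(Y' v - Y1' v) - (Y' u - Y1' u)| <= L * hw p W u v &
         `|remainder X dY dY' u v| <= L * hw p W u v ^+ 2]) ->
  forall u v, s <= u -> u <= v -> v <= t -> u < t ->
  `|remainder X dU dU' u v| <= G * (N + L * hw p W u v) * hw p W u v ^+ 2.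
Proof.
move=> s0 tT EN NL HN HL u v su uv vt ut.
have [u0 vT] := (le_trans s0 su, le_trans vt tT).
have [uT v0] := (le_trans uv vT, le_trans u0 uv).
have EL := le_trans EN NL; have n0 := le_trans E0 EN; have l0 := le_trans n0 NL.
rewrite remainderB (picard_image_rem HU u0 uv vT) (picard_image_rem HU1 u0 uv vT).
have [_ _ _ Hry] := Hdy (in0T u0 uT) (in0T v0 vT) uv.
rewrite remainderB in Hry.
have k1 := K1; have K0 : 0 <= K by lra.
have Hint : integrand_bd p W X (K * L) s t (fun u => V u - V1 u) (fun u => V' u - V1' u).
  move=> x z sx xz zt; have xt := le_lt_trans xz zt.
  have [Nx Nx'] := HN x sx xt; have [Nz Nz'] := HN z (le_trans sx xz) zt.
  have [h1 h2 h3] := HL x z sx xz zt.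
  exact: (path_diff_rem c1 dc nc HX hc fc gE Hal Hal1 HY HY1 Hda Hda0
    (le_trans s0 sx) xz (le_trans (ltW zt) tT) EL (le_trans Nx NL) (le_trans Nz NL)
    (le_trans Nx' NL) (le_trans Nz' NL) h1 h2 h3).
have [Nu Nu'] := HN u su ut.
have Vu := path_diff_deriv c1 dc nc HX hc fc gE Hal Hal1 HY HY1 Hda Hda0 u0 uT EN Nu Nu'.
have HI : forall z, 0 <= z -> z <= t ->
    is_rough_integral X XX (fun u => V u - V1 u) (fun u => V' u - V1' u) 0 z
      ((U z - y z) - (U1 z - y1 z)).
  move=> z z0 zt; have zT := le_trans zt tT.
  by apply: is_rough_integralB; [case: (HU z0 zT)|case: (HU1 z0 zT)].
have H := rough_integral_rem c1 dc HX (mulr_ge0 K0 l0) (mulr_ge0 K0 n0) s0 tT HI Hint su uv vt Vu.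
move: H; rewrite (lappBl (V u)) => H.
set A := remainder X y y' u v in Hry *; set A1 := remainder X y1 y1' u v in Hry *.
set B := lapp (V u) _ in H *; set B1 := lapp (V1 u) _ in H *.
have -> : A + (U v - y v - (U u - y u) - B) - (A1 + (U1 v - y1 v - (U1 u - y1 u) - B1)) =
  (A - A1) + (U v - y v - (U1 v - y1 v) - (U u - y u - (U1 u - y1 u)) - (B - B1)) by mxring.
apply: (le_trans (ler_normD _ _)); apply: (le_trans (lerD Hry H)).
have h0 := hw_ge0 p W u v; set h := hw p W u v in h0 *.
have -> : E * h ^+ 2 + (c ^+ 5 * (K * N) * h ^+ 2 +
    2 * sew_const (3 / p) * c ^+ 5 * (K * L) * h ^+ 3) =
   (E + c ^+ 5 * (K * N) + 2 * sew_const (3 / p) * (c ^+ 5 * (K * L * h))) * h ^+ 2 by ring.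
apply: ler_wpM2r; first exact: exprn_ge0.
have X0 : 0 <= c ^+ 5 * (K * L * h).
  by rewrite mulr_ge0 ?exprn_ge0 ?C0// mulr_ge0// mulr_ge0.
have S1 := ler_wpM2r X0 sc.
have c56 : c ^+ 5 * (K * N) <= c ^+ 6 * (K * N).
  by apply: ler_wpM2r; [exact: mulr_ge0|rewrite ler_weXn2l].
have NK : 1 * N <= c ^+ 6 * K * N.
  by apply: ler_wpM2r => //; rewrite -[leLHS]mulr1 ler_pM// exprn_ege1.
rewrite -GE; lra.
Qed.

(** [diff_kap] compares increments of [Y - Y1] on a short piece with the size [N] of the derivative.
    [diff_lam] is a weight: the new remainder is not small compared with [N], so it is allowed to be
    [diff_lam] times larger, and the factor 1/2 is obtained in the weighted norm. [diff_gam] is the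
    remainder constant on closed pieces, where [hw] is bounded by [c] only. *)
Definition diff_kap : R := 2 * c ^+ 2.
Definition diff_lam : R := 4 * G * diff_kap.
Definition diff_gam : R := G * (diff_kap + diff_lam * c).
Local Notation kap := diff_kap.
Local Notation lam := diff_lam.

Lemma diff_kap_ge1 : 1 <= kap.
Proof. by have : 1 <= c ^+ 2 by [rewrite exprn_ege1]; rewrite /kap; lra. Qed.

Lemma diff_lam_ge : 4 * G <= lam /\ kap <= lam /\ 1 <= lam.
Proof.
have g1 := diff_const_ge1; have k1 := diff_kap_ge1.
have : G * 1 <= G * kap by apply: ler_wpM2l => //; lra.
have : 1 * kap <= G * kap by apply: ler_wpM2r => //; lra.
rewrite /lam; split; [|split]; lra.
Qed.

Section Piece.
Variables (s t N del eps : R).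
Hypotheses (s0 : 0 <= s) (tT : t <= T) (N0 : 0 <= N) (del0 : 0 <= del) (eps0 : 0 <= eps).
Hypothesis le1 : lam * eps <= 1.
Hypothesis teps : forall u v, s <= u -> u <= v -> v < t -> hw p W u v <= eps.
Hypothesis Ys : `|Y s - Y1 s| <= del.
Hypothesis HN : ctl_bd p W X `[s, t[ N (lam * N) (lam * N) dY dY'.

Let Dco u : s <= u -> u < t -> `[s, t[%classic u.
Proof. by move=> ? ?; rewrite /= in_itv/=; apply/andP. Qed.

Let dY_incr u v : s <= u -> u <= v -> v < t ->
  `|(Y v - Y1 v) - (Y u - Y1 u)| <= kap * N * hw p W u v.
Proof.
move=> su uv vt; have ut := le_lt_trans uv vt.
have [A1 _ _ A4] := HN (Dco su ut) (Dco (le_trans su uv) vt) uv.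
have [l4 [lk l1]] := diff_lam_ge.
have lN : 0 <= lam * N by apply: mulr_ge0 => //; lra.
apply: (le_trans (incr_norm c1 dc HX (le_trans s0 su) uv (le_trans (ltW vt) tT) lN A1 A4)).
have h0 := hw_ge0 p W u v; apply: ler_wpM2r => //.
have e1 : lam * hw p W u v <= 1.
  by apply: le_trans le1; apply: ler_wpM2l; [lra|exact: teps].
have e2 : N * (lam * hw p W u v) <= N * 1 by apply: ler_wpM2l.
have e3 : 1 * N <= c ^+ 2 * N by apply: ler_wpM2r => //; rewrite exprn_ege1.
rewrite /kap; lra.
Qed.

(** A bound for the values of [Y - Y1] on the piece: the discrepancy [del] at the left endpoint plus
    a small increment. The factor [eps] next to [N] is what makes the derivative of the image
    improve; the cruder [S] serves for the other components. *)
Let q := del + E + kap * N * eps.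
Let S := N + del + E.

Let dY_sup u : s <= u -> u < t -> `|Y u - Y1 u| <= q.
Proof.
move=> su ut; have := dY_incr (lexx s) su ut.
have hh := teps (lexx s) su ut; have k1 := diff_kap_ge1; have n0 := N0.
have kn : 0 <= kap * N by apply: mulr_ge0 => //; lra.
have := ler_wpM2l kn hh; move=> h1 h2.
have -> : Y u - Y1 u = (Y s - Y1 s) + ((Y u - Y1 u) - (Y s - Y1 s)) by mxring.
apply: (le_trans (ler_normD _ _)); have := E0; have := Ys; rewrite /q; lra.
Qed.

Let eps1 : eps <= 1.
Proof.
have [l4 [lk l1]] := diff_lam_ge; have e0 := eps0; have := le1.
have : 1 * eps <= lam * eps by apply: ler_wpM2r.
lra.
Qed.

Let qS : q <= kap * S.
Proof.
have k1 := diff_kap_ge1; have [e0 e1] := (eps0, eps1); have n0 := N0; have D0 := del0; have e00 := E0.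
have kn : 0 <= kap * N by apply: mulr_ge0 => //; lra.
have h1 := ler_wpM2l kn e1.
have : 1 * (del + E) <= kap * (del + E) by apply: ler_wpM2r => //; lra.
rewrite /q /S; lra.
Qed.

Let S0 : 0 <= S. Proof. by have [n0 [D0 e0]] := (N0, (del0, E0)); rewrite /S; lra. Qed.

Let rem_le u v : s <= u -> u <= v -> v <= t -> u < t ->
  `|remainder X dU dU' u v| <= G * (kap * S + lam * S * hw p W u v) * hw p W u v ^+ 2.
Proof.
have [n0 [D0 [e0 s00]]] := (N0, (del0, (E0, S0))).
have k1 := diff_kap_ge1; have [l4 [lk l1]] := diff_lam_ge.
have kS : 1 * S <= kap * S by apply: ler_wpM2r.
apply: (diff_step_rem s0 tT); rewrite -?/S.
- move: kS; rewrite /S; lra.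
- exact: ler_wpM2r.
- move=> x sx xt; split; first exact: le_trans (dY_sup sx xt) qS.
  have [A1 _ _ _] := HN (Dco sx xt) (Dco sx xt) (lexx x).
  by apply: (le_trans A1); move: kS; rewrite /S; lra.
- move=> x z sx xz zt; have h0 := hw_ge0 p W x z.
  have [_ _ A3 A4] := HN (Dco sx (le_lt_trans xz zt)) (Dco (le_trans sx xz) zt) xz.
  have lNS : lam * N <= lam * S by apply: ler_wpM2l; [lra|rewrite /S; lra].
  split.
  + apply: (le_trans (dY_incr sx xz zt)); apply: ler_wpM2r => //.
    by apply: ler_pM => //; [lra|rewrite /S; lra].
  + by apply: (le_trans A3); apply: ler_wpM2r.
  + by apply: (le_trans A4); apply: ler_wpM2r => //; exact: exprn_ge0.
Qed.

(** The derivative improves because [G * kap * eps <= 1 / 4]; the other components because their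
    bound [2 * G * kap * S] is half of [lam * S], by the choice of the weight. *)
Lemma diff_open :
  let N1 := N / 2 + G * (del + E) in
  ctl_bd p W X `[s, t[ N1 (lam * N1) (lam * N1) dU dU'.
Proof.
move=> N1 u v; rewrite /= !in_itv/= => /andP[su ut] /andP[sv vt] uv.
have [n0 [D0 [e0 s00]]] := (N0, (del0, (E0, S0))).
have k1 := diff_kap_ge1; have [l4 [lk l1]] := diff_lam_ge; have g1 := diff_const_ge1.
have h0 := hw_ge0 p W u v.
have [u0 v0] : 0 <= u /\ 0 <= v by split; [exact: le_trans su|exact: le_trans sv].
have [uT vT] : u <= T /\ v <= T by split; [exact: le_trans (ltW ut) tT|exact: le_trans (ltW vt) tT].
have Eq : E <= q.
  have : 0 <= kap * N * eps by rewrite mulr_ge0// mulr_ge0//; lra.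
  by rewrite /q; lra.
have le4 : G * kap * eps <= 1 / 4 by have := le1; rewrite /lam; lra.
have qN : G * q <= N1.
  have := ler_wpM2l n0 le4; rewrite /q /N1; lra.
have L1 : 2 * G * kap * S <= lam * N1.
  have -> : lam * N1 = 2 * G * kap * N + (2 * G * kap * (del + E)) * (2 * G).
    by rewrite /N1 /lam; field.
  have X1 : 0 <= 2 * G * kap * (del + E).
    by apply: mulr_ge0; [apply: mulr_ge0; [lra|lra]|lra].
  have := ler_wpM2l X1 (_ : 1 <= 2 * G); rewrite /S => H; have {}H := H ltac:(lra).
  lra.
split.
- exact: le_trans (diff_step_val u0 uT Eq (dY_sup su ut)) qN.
- exact: le_trans (diff_step_val v0 vT Eq (dY_sup sv vt)) qN.
- have ES : E <= kap * S by exact: le_trans qS.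
  have H := diff_step_incr u0 uv vT ES (le_trans (dY_sup su ut) qS) (le_trans (dY_sup sv vt) qS) _.
  apply: (le_trans (H _)).
    apply: (le_trans (dY_incr su uv vt)); apply: ler_wpM2r => //.
    by apply: ler_wpM2l; [lra|rewrite /S; lra].
  apply: ler_wpM2r => //; apply: le_trans L1.
  have : 0 <= G * (kap * S) by apply: mulr_ge0; [lra|apply: mulr_ge0; lra].
  lra.
- apply: (le_trans (rem_le su uv (ltW vt) ut)); apply: ler_wpM2r; first exact: exprn_ge0.
  apply: le_trans L1.
  have e1 : lam * hw p W u v <= kap.
    apply: (@le_trans _ _ 1) => //.
    by apply: le_trans le1; apply: ler_wpM2l; [lra|exact: teps].
  have e2 := ler_wpM2l s00 e1.
  have : G * (kap * S + lam * S * hw p W u v) <= G * (kap * S + kap * S).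
    by apply: ler_wpM2l; [lra|lra].
  lra.
Qed.

Lemma diff_closed_rem u v : s <= u -> u <= v -> v <= t ->
  `|remainder X dU dU' u v| <= diff_gam * (N + del + E) * hw p W u v ^+ 2.
Proof.
move=> su uv vt.
have [n0 [D0 [e0 s00]]] := (N0, (del0, (E0, S0))).
have k1 := diff_kap_ge1; have [l4 [lk l1]] := diff_lam_ge; have g1 := diff_const_ge1.
have lc : 0 <= lam * c by rewrite mulr_ge0 ?C0//; lra.
have h0 := hw_ge0 p W u v; have h20 : 0 <= hw p W u v ^+ 2 by exact: exprn_ge0.
have [ut|tu] := ltP u t; last first.
  have -> : v = u by lra.
  rewrite /remainder /incr !subrr lapp0r subr0 normr0 mulr_ge0 ?exprn_ge0 ?hw_ge0//.
  by rewrite mulr_ge0// /diff_gam mulr_ge0//; lra.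
apply: (le_trans (rem_le su uv vt ut)); apply: ler_wpM2r => //.
rewrite /diff_gam -[leRHS]mulrA; apply: ler_wpM2l; first lra.
rewrite mulrDl; apply: lerD => //.
rewrite -/S [lam * S * _]mulrAC; apply: ler_wpM2r => //; apply: ler_wpM2l; first lra.
by apply: hc => //; [exact: le_trans su|exact: le_trans tT].
Qed.

(** The derivative [U'] at the right endpoint involves [Y] there, so the remainder of [Y - Y1] must
    be bounded up to [t]. The bound [rho] comes from [diff_closed_rem], applied to the previous
    iterate or to the solution itself. *)
Lemma diff_closed rho : 0 <= rho ->
  (forall u v, s <= u -> u <= v -> v <= t ->
     `|remainder X dY dY' u v| <= rho * hw p W u v ^+ 2) ->
  let Nc := del + E + c ^+ 3 * N + c ^+ 2 * rho in
  ctl_bd p W X `[s, t] (G * Nc) (G * Nc) (diff_gam * (N + del + E)) dU dU'.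
Proof.
move=> r0 Hr Nc u v; rewrite /= !in_itv/= => /andP[su ut] /andP[sv vt] uv.
have [n0 [D0 [e0 s00]]] := (N0, (del0, (E0, S0))); have [C1 c00] := (c1, C0).
have P3 : 0 <= c ^+ 3 * N by rewrite mulr_ge0// exprn_ge0.
have P2 : 0 <= c ^+ 2 * rho by rewrite mulr_ge0// exprn_ge0.
have incr_c x z : s <= x -> x <= z -> z <= t ->
    `|(Y z - Y1 z) - (Y x - Y1 x)| <= (c ^+ 2 * N + c * rho) * hw p W x z.
  move=> sx xz zt; have h0 := hw_ge0 p W x z.
  have [x0 zT] := (le_trans s0 sx, le_trans zt tT).
  have [xt|tx] := ltP x t; last first.
    have -> : z = x by lra.
    by rewrite subrr normr0 mulr_ge0 ?hw_ge0// addr_ge0 ?mulr_ge0 ?exprn_ge0.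
  have [A1 _ _ _] := HN (Dco sx xt) (Dco sx xt) (lexx x).
  apply: (le_trans (incr_norm c1 dc HX x0 xz zT r0 A1 (Hr x z sx xz zt))).
  apply: ler_wpM2r => //; rewrite lerD2l mulrC; apply: ler_wpM2r => //; exact: hc.
have Nc1 : c ^+ 2 * N + c * rho <= Nc.
  have : c ^+ 2 * N <= c ^+ 3 * N by rewrite ler_wpM2r// ler_weXn2l.
  have : c * rho <= c ^+ 2 * rho by rewrite ler_wpM2r// -[leLHS]expr1 ler_weXn2l.
  by rewrite /Nc; lra.
have sup_c x : s <= x -> x <= t -> `|Y x - Y1 x| <= Nc.
  move=> sx xt; have h1 := incr_c s x (lexx s) sx xt.
  have -> : Y x - Y1 x = (Y s - Y1 s) + ((Y x - Y1 x) - (Y s - Y1 s)) by mxring.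
  apply: (le_trans (ler_normD _ _)); apply: (le_trans (lerD Ys h1)).
  have hh := hc s0 sx (le_trans xt tT).
  have : (c ^+ 2 * N + c * rho) * hw p W s x <= (c ^+ 2 * N + c * rho) * c.
    by apply: ler_wpM2l => //; rewrite addr_ge0 ?mulr_ge0 ?exprn_ge0.
  by rewrite /Nc; lra.
have ENc : E <= Nc by rewrite /Nc; lra.
have [u0 uT] : 0 <= u /\ u <= T by split; [exact: le_trans su|exact: le_trans tT].
have [v0 vT] : 0 <= v /\ v <= T by split; [exact: le_trans sv|exact: le_trans tT].
split.
- exact: (diff_step_val u0 uT ENc (sup_c u su ut)).
- exact: (diff_step_val v0 vT ENc (sup_c v sv vt)).
- apply: (diff_step_incr u0 uv vT ENc (sup_c u su ut) (sup_c v sv vt)).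
  by apply: (le_trans (incr_c u v su uv vt)); apply: ler_wpM2r => //; exact: hw_ge0.
- exact: diff_closed_rem.
Qed.

End Piece.
End OneStep.
End DifferenceStep.

Section Stability.
Context {R : realType}.
Variables (d e k : nat) (c p T : R) (W : R -> R) (X : R -> 'rV[R]_d) (XX : R -> R -> 'M[R]_d).
Hypotheses (c1 : 1 <= c) (dc : d%:R <= c) (nc : (e + k)%:R <= c).
Hypothesis HX : holder_rough c p T W X XX.
Hypothesis hc : forall u v, 0 <= u -> u <= v -> v <= T -> hw p W u v <= c.
Hypothesis sc : sew_const (3 / p) <= c.
Variables (E : R) (f f1 : 'rV[R]_(e + k) -> linmx R d 1 k)
  (Df Df1 : 'rV[R]_(e + k) -> linmx R (e + k) d (1 * k))
  (D2f D2f1 : 'rV[R]_(e + k) -> linmx R (e + k) (e + k) (d * (1 * k)))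
  (D3f : 'rV[R]_(e + k) -> linmx R (e + k) (e + k) ((e + k) * (d * (1 * k)))).
Hypothesis fc : C3bd c f Df D2f D3f.
Hypothesis gE : C2bd E (fun z => f z - f1 z) (fun z => Df z - Df1 z) (fun z => D2f z - D2f1 z).
Variables (alpha alpha1 : R -> 'rV[R]_e) (alpha' alpha1' : R -> linmx R d 1 e)
  (y y1 : R -> 'rV[R]_k) (y' y1' : R -> linmx R d 1 k).
Hypothesis Hal : ctl_bd p W X `[0, T] c c c alpha alpha'.
Hypothesis Hal1 : ctl_bd p W X `[0, T] c c c alpha1 alpha1'.
Hypothesis Hda : ctl_bd p W X `[0, T] E E E (fun t => alpha t - alpha1 t) (fun t => alpha' t - alpha1' t).
Hypothesis Hda0 : forall u, 0 <= u -> u <= T -> `|alpha u - alpha1 u| <= E.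
Hypothesis Hdy : ctl_bd p W X `[0, T] E E E (fun t => y t - y1 t) (fun t => y' t - y1' t).
Hypothesis Hdy0 : `|y 0 - y1 0| <= E.
Variables (Y Y1 : R -> 'rV[R]_k) (Y' Y1' : R -> linmx R d 1 k).
Hypothesis HY : ctl_bd p W X `[0, T] c c c Y Y'.
Hypothesis HY1 : ctl_bd p W X `[0, T] c c c Y1 Y1'.
Hypothesis HU : sol_map T X XX f Df alpha alpha' y y' Y Y' Y Y'.
Hypothesis HU1 : sol_map T X XX f1 Df1 alpha1 alpha1' y1 y1' Y1 Y1' Y1 Y1'.
Variables (tau : nat -> R) (eps : R).
Hypotheses (t0 : tau 0%N = 0) (tm : forall i, tau i <= tau i.+1)
  (tT : forall i, 0 <= tau i <= T) (eps0 : 0 <= eps) (eK : diff_lam c * eps <= 1)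
  (teps : forall i u v, tau i <= u -> u <= v -> v < tau i.+1 -> hw p W u v <= eps).
Local Notation dY := (fun t => Y t - Y1 t).
Local Notation dY' := (fun t => Y' t - Y1' t).
Local Notation G := (diff_const c).
Local Notation gam := (diff_gam c).

(** The factor of [del + E] in [G * Nc + rho] after insertion of the open bound [2 * G * (del + E)],
    with [Nc] the quantity of [diff_closed]. *)
Definition stab_step : R :=
  G * (1 + c ^+ 3 * (2 * G) + c ^+ 2 * (gam * (2 * G + 1))) + gam * (2 * G + 1).

Fixpoint stab_const (n : nat) : R :=
  if n is n'.+1 then (1 + c ^+ 2) * stab_const n' + stab_step * (2 + 2 * c ^+ 3 * stab_const n')
  else G.

Let E0 : 0 <= E. Proof. exact: C1bd_ge0 gE.1. Qed.
Let C0 : 0 <= c. Proof. exact: le_trans ler01 c1. Qed.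
Let G1 : 1 <= G. Proof. exact: diff_const_ge1. Qed.
Let L1 : 1 <= diff_lam c. Proof. by case: (diff_lam_ge c1) => _ []. Qed.
Let gam0 : 0 <= gam.
Proof.
have g1 := G1; have l1 := L1; have k1 := diff_kap_ge1 c1.
apply: mulr_ge0; first lra; apply: addr_ge0; first lra.
by apply: mulr_ge0; [lra|exact: C0].
Qed.

Let gG0 : 0 <= gam * (2 * G + 1).
Proof. by have g1 := G1; apply: mulr_ge0 => //; lra. Qed.

Let stab_step0 : 0 <= stab_step.
Proof.
have g1 := G1; apply: addr_ge0 => //; apply: mulr_ge0; first lra.
by apply: addr_ge0; [apply: addr_ge0 => //|]; apply: mulr_ge0; rewrite ?exprn_ge0 ?C0//; lra.
Qed.

Lemma stab_const_ge0 n : 0 <= stab_const n.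
Proof.
have g1 := G1; elim: n => [|n IH] /=; first lra.
have [c2 c3] : 0 <= c ^+ 2 /\ 0 <= c ^+ 3 by rewrite !exprn_ge0.
by rewrite addr_ge0// mulr_ge0// addr_ge0// mulr_ge0// mulr_ge0.
Qed.

Lemma sup_from_start S i : 0 <= S -> `|Y 0 - Y1 0| <= E ->
  ctl_bd p W X `[0, tau i] S S S dY dY' -> `|Y (tau i) - Y1 (tau i)| <= E + 2 * c ^+ 3 * S.
Proof.
move=> S0 Y0 H; have /andP[h1 h2] := tT i.
have D0 : `[0, tau i]%classic 0 by rewrite /= in_itv/= lexx.
have Di : `[0, tau i]%classic (tau i) by rewrite /= in_itv/= h1 lexx.
have [A1 _ _ A4] := H 0 (tau i) D0 Di h1.
have I := incr_norm c1 dc HX (lexx 0) h1 h2 S0 A1 A4.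
have -> : Y (tau i) - Y1 (tau i) = (Y 0 - Y1 0) + (Y (tau i) - Y1 (tau i) - (Y 0 - Y1 0)) by mxring.
apply: (le_trans (ler_normD _ _)); apply: lerD => //; apply: (le_trans I).
have hh := hc (lexx 0) h1 h2; have h0 := hw_ge0 p W 0 (tau i).
have e1 : c ^+ 2 * S + S * hw p W 0 (tau i) <= 2 * c ^+ 2 * S.
  have : S * hw p W 0 (tau i) <= S * c ^+ 2.
    by apply: ler_wpM2l => //; apply: (le_trans hh); rewrite -[leLHS]expr1 ler_weXn2l.
  lra.
have e2 : 0 <= 2 * c ^+ 2 * S by rewrite !mulr_ge0// exprn_ge0// C0.
have -> : 2 * c ^+ 3 * S = 2 * c ^+ 2 * S * c by ring.
apply: (le_trans (ler_wpM2r h0 e1)); exact: ler_wpM2l.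
Qed.

(** Induction on pieces. The bound on [0, tau i] controls the discrepancy [del] at [tau i], from
    which the next piece starts; every estimate is linear in [del + E], hence in [E]. *)
Lemma stability_pieces i :
  ctl_bd p W X `[0, tau i] (stab_const i * E) (stab_const i * E) (stab_const i * E) dY dY'.
Proof.
have g1 := G1; have l1 := L1; have e0 := E0.
have Y00 : Y 0 - Y1 0 = y 0 - y1 0.
  have [T0 _] := andP (tT 0%N); have T00 := ltW (hr_T HX).
  have [_ /rough_integral0 H1] := HU (lexx 0) T00.
  have [_ /rough_integral0 H2] := HU1 (lexx 0) T00.
  by move/eqP: H1; move/eqP: H2; rewrite !subr_eq0 => /eqP -> /eqP ->.
have Y0E : `|Y 0 - Y1 0| <= E by rewrite Y00.
elim: i => [|i IH].
  move=> u v; rewrite /= !in_itv/= t0 => /andP[u0 u1] /andP[v0 v1] _.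
  have -> : u = 0 by lra. have -> : v = 0 by lra.
  have H : `|Y' 0 - Y1' 0| <= G * E.
    apply: (diff_step_val c1 dc nc fc gE Hda0 Hdy HU HU1) => //; exact: ltW (hr_T HX).
  have GE0 : 0 <= G * E by rewrite mulr_ge0//; lra.
  split => //; first by rewrite subrr normr0 mulr_ge0 ?hw_ge0.
  rewrite /remainder /incr !subrr lapp0r subr0 normr0 mulr_ge0 ?exprn_ge0 ?hw_ge0//.
set S := stab_const i * E in IH.
have S0 : 0 <= S by rewrite mulr_ge0// stab_const_ge0.
have dl := sup_from_start S0 Y0E IH.
set del := E + 2 * c ^+ 3 * S in dl.
have cS : 0 <= 2 * c ^+ 3 * S by apply: mulr_ge0 => //; apply: mulr_ge0 => //; apply: exprn_ge0; exact: C0.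
have del0 : 0 <= del by rewrite /del; lra.
have /andP[s0 sT] := tT i; have /andP[s10 s1T] := tT i.+1.
pose B := G * (del + E).
have B0 : 0 <= B by rewrite mulr_ge0//; lra.
(* Crude start for the halving: each solution is bounded by [c]. It leaves no trace in the limit
   [2 * B]. *)
have Hsub : ctl_bd p W X `[tau i, tau i.+1[ (2 * c) (diff_lam c * (2 * c)) (diff_lam c * (2 * c)) dY dY'.
  have c20 : 0 <= 2 * c by have := C0; lra.
  have lc : 2 * c <= diff_lam c * (2 * c) by rewrite ler_peMl.
  apply: (ctl_bd_le (lexx (2 * c)) lc lc) => u v Du Dv uv.
  have Du' := itv_co_sub s0 s1T Du; have Dv' := itv_co_sub s0 s1T Dv.
  have [A1 A2 A3 A4] := HY Du' Dv' uv; have [B1 B2 B3 B4] := HY1 Du' Dv' uv.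
  split.
  - by apply: (le_trans (ler_normB _ _)); lra.
  - by apply: (le_trans (ler_normB _ _)); lra.
  - have -> : Y' v - Y1' v - (Y' u - Y1' u) = (Y' v - Y' u) - (Y1' v - Y1' u) by mxring.
    by apply: (le_trans (ler_normB _ _)); lra.
  - by rewrite remainderB; apply: (le_trans (ler_normB _ _)); lra.
have Hop : ctl_bd p W X `[tau i, tau i.+1[ (2 * B) (diff_lam c * (2 * B)) (diff_lam c * (2 * B)) dY dY'.
  have c20 : 0 <= 2 * c by have := C0; lra.
  have Hlim := halving (P := fun z => ctl_bd p W X `[tau i, tau i.+1[ z (diff_lam c * z) (diff_lam c * z) dY dY')
    B0 c20 _ _ Hsub.
  apply: ctl_bd_lim => eta eta0.
  have l0 : 0 < diff_lam c by lra.
  (* The division by the weight leaves exactly [eta] in the weighted components. *)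
  apply: (ctl_bd_le _ _ _ (Hlim _ _ (eta / diff_lam c) (divr_gt0 eta0 l0))).
  - by rewrite lerD2l ler_pdivrMr// ler_peMr// ltW.
  - by rewrite mulrDr [_ * (eta / _)]mulrC divfK//; apply/eqP; lra.
  - by rewrite mulrDr [_ * (eta / _)]mulrC divfK//; apply/eqP; lra.
  - move=> z1 z2 z12; apply: ctl_bd_le => //; apply: ler_wpM2l => //; lra.
  - move=> z z0 Hz.
    exact: (diff_open c1 dc nc HX hc sc fc gE Hal Hal1 Hda Hda0 Hdy HY HY1 HU HU1
      s0 s1T z0 del0 eps0 eK (teps (i := i)) dl Hz).
pose rho := gam * (2 * B + del + E).
have rho0 : 0 <= rho by rewrite mulr_ge0//; lra.
have B20 : 0 <= 2 * B by lra.
have Hrho u v : tau i <= u -> u <= v -> v <= tau i.+1 ->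
    `|remainder X dY dY' u v| <= rho * hw p W u v ^+ 2.
  exact: (diff_closed_rem c1 dc nc HX hc sc fc gE Hal Hal1 Hda Hda0 Hdy HY HY1 HU HU1
      s0 s1T B20 del0 eps0 eK (teps (i := i)) dl Hop).
have Hcl := diff_closed c1 dc nc HX hc sc fc gE Hal Hal1 Hda Hda0 Hdy HY HY1 HU HU1
      s0 s1T B20 del0 eps0 eK (teps (i := i)) dl Hop rho0 Hrho.
rewrite -/rho in Hcl.
set Nc := del + E + c ^+ 3 * (2 * B) + c ^+ 2 * rho in Hcl.
have Nc0 : 0 <= Nc.
  have : 0 <= c ^+ 3 * (2 * B) by rewrite mulr_ge0// exprn_ge0// C0.
  have : 0 <= c ^+ 2 * rho by rewrite mulr_ge0// exprn_ge0// C0.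
  by rewrite /Nc; lra.
have GN0 : 0 <= G * Nc by rewrite mulr_ge0//; lra.
pose Bi := G * Nc + rho.
have BiE : Bi = stab_step * (del + E).
  by rewrite /Bi /Nc /rho /B /stab_step; ring.
have Bi0 : 0 <= Bi by rewrite /Bi; lra.
have H1 : ctl_bd p W X `[0, tau i] (S + Bi) S S dY dY'.
  by apply: ctl_bd_le (lexx S) (lexx S) IH; rewrite lerDl.
have H2 : ctl_bd p W X `[tau i, tau i.+1] (S + Bi) Bi Bi dY dY'.
  by apply: ctl_bd_le Hcl; rewrite /Bi; lra.
have c2S : 0 <= c ^+ 2 * S by rewrite mulr_ge0// exprn_ge0// C0.
have := ctl_bd_patch c1 dc HX (lexx 0) s0 (tm i) s1T S0 S0 Bi0 Bi0 H1 H2.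
have -> : stab_const i.+1 * E = (1 + c ^+ 2) * S + Bi.
  by rewrite BiE /= /del /S; ring.
by apply: ctl_bd_le; lra.
Qed.

End Stability.

(** * Convergence of the Picard iterates *)

Section Summable.
Context {R : realType}.
Implicit Types S b : nat -> R.

(** Summability plays the role of a geometric rate for the iterates: on a piece, successive
    differences obey [x / 2 + b n] with [b n] inherited from earlier pieces, and summability passes
    from [b] to the solution of this recursion. *)
Definition nneg_summable (S : nat -> R) : Prop :=
  (forall n, 0 <= S n) /\ exists B, forall n, \sum_(j < n) S j <= B.

Lemma nneg_summableD S b : nneg_summable S -> nneg_summable b ->
  nneg_summable (fun n => S n + b n).
Proof.
move=> [S0 [B HB]] [b0 [B1 HB1]]; split=> [n|]; first by rewrite addr_ge0.
by exists (B + B1) => n; rewrite big_split lerD.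
Qed.

Lemma nneg_summableZ S a : 0 <= a -> nneg_summable S -> nneg_summable (fun n => a * S n).
Proof.
move=> a0 [S0 [B HB]]; split=> [n|]; first by rewrite mulr_ge0.
by exists (a * B) => n; rewrite -mulr_sumr ler_wpM2l.
Qed.

Lemma nneg_summable_cons S a : 0 <= a -> nneg_summable S ->
  nneg_summable (fun n => if n is n'.+1 then S n' else a).
Proof.
move=> a0 [S0 [B HB]]; split=> [[|n]//|].
exists (a + B) => -[|n]; last by rewrite big_ord_recl lerD2l.
by rewrite big_ord0 addr_ge0//; have := HB 0%N; rewrite big_ord0.
Qed.

Lemma nneg_summable0 : nneg_summable (fun=> 0).
Proof. by split=> //; exists 0 => n; rewrite big1. Qed.

Fixpoint halving_seq (a : R) (b : nat -> R) (n : nat) : R :=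
  if n is n'.+1 then halving_seq a b n' / 2 + b n' else a.

Lemma nneg_summable_halving a b : 0 <= a -> nneg_summable b -> nneg_summable (halving_seq a b).
Proof.
move=> a0 [b0 [B HB]].
have H0 n : 0 <= halving_seq a b n by elim: n => //= n IH; rewrite addr_ge0// divr_ge0.
split => //; exists (2 * a + 2 * B) => n.
(* Summing the recursion expresses the partial sum through half of itself. *)
have H : \sum_(j < n) halving_seq a b j = 2 * a + 2 * \sum_(j < n) b j - 2 * halving_seq a b n.
  elim: n => [|n IH]; first by rewrite !big_ord0 /=; lra.
  by rewrite !big_ord_recr /= IH; field.
by have := HB n; have := H0 n; lra.
Qed.

Lemma nneg_summable_tail S : nneg_summable S -> exists r : nat -> R,
  (forall eps, 0 < eps -> exists N, forall n, (N <= n)%N -> r n <= eps) /\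
  (forall n m, \sum_(n <= j < m) S j <= r n).
Proof.
move=> [S0 [B HB]].
pose s n := \sum_(0 <= j < n) S j.
have sB n : s n <= B by rewrite /s big_mkord.
have smono n m : (n <= m)%N -> s n <= s m.
  move=> nm; rewrite /s [leRHS](big_cat_nat (n := n))//= lerDl sumr_ge0//.
have hs : has_sup (range s) by split; [exists (s 0%N), 0%N|exists B => _ [n _ <-]].
exists (fun n => sup (range s) - s n); split=> [eps eps0|n m].
  have [_ [N _ <-] HN] := sup_adherent eps0 hs.
  by exists N => n Nn; have := smono _ _ Nn; lra.
have H k : s k <= sup (range s) by apply: sup_upper_bound => //; exists k.
have [nm|mn] := leqP n m.
  have : s m = s n + \sum_(n <= j < m) S j by rewrite /s [LHS](big_cat_nat (n := n)).
  have := H m; lra.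
rewrite big_geq ?(ltnW mn)//; have := H n; lra.
Qed.

End Summable.

Section ControlledLimits.
Context {R : realType}.
Variables (d m : nat) (p T : R) (W : R -> R) (X : R -> 'rV[R]_d).

Lemma ctl_bdD D a b r a1 b1 r1 (Y Z : R -> 'rV[R]_m) Y' Z' :
  ctl_bd p W X D a b r Y Y' -> ctl_bd p W X D a1 b1 r1 Z Z' ->
  ctl_bd p W X D (a + a1) (b + b1) (r + r1) (fun t => Y t + Z t) (fun t => Y' t + Z' t).
Proof.
move=> HY HZ u v Du Dv uv.
have [A1 A2 A3 A4] := HY u v Du Dv uv; have [B1 B2 B3 B4] := HZ u v Du Dv uv.
split.
- by apply: (le_trans (ler_normD _ _)); exact: lerD.
- by apply: (le_trans (ler_normD _ _)); exact: lerD.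
- have -> : Y' v + Z' v - (Y' u + Z' u) = (Y' v - Y' u) + (Z' v - Z' u) by mxring.
  by apply: (le_trans (ler_normD _ _)); rewrite mulrDl; exact: lerD.
- have -> : remainder X (fun t => Y t + Z t) (fun t => Y' t + Z' t) u v =
      remainder X Y Y' u v + remainder X Z Z' u v.
    by rewrite /remainder /incr lappDl; move: (lapp _ _) (lapp _ _) => P Q; mxring.
  by apply: (le_trans (ler_normD _ _)); rewrite mulrDl; exact: lerD.
Qed.

Lemma ctl_bd_ext D a b r (Y Z : R -> 'rV[R]_m) Y' Z' :
  (forall u, D u -> Y u = Z u /\ Y' u = Z' u) ->
  ctl_bd p W X D a b r Y Y' -> ctl_bd p W X D a b r Z Z'.
Proof.
move=> H HY u v Du Dv uv; have [Eu Eu'] := H u Du; have [Ev Ev'] := H v Dv.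
by have := HY u v Du Dv uv; rewrite /remainder /incr Eu Eu' Ev Ev'.
Qed.

Lemma norm_limit n1 n2 (x : nat -> 'M[R]_(n1, n2)) l (C : R) N :
  (forall eps, 0 < eps -> exists N, forall i, (N <= i)%N -> `|x i - l| < eps) ->
  (forall i, (N <= i)%N -> `|x i| <= C) -> `|l| <= C.
Proof.
move=> xl xC; apply/ler_addgt0Pr => eps eps0; have [M HM] := xl _ eps0.
have h1 := xC (maxn N M) (leq_maxl _ _); have h2 := HM (maxn N M) (leq_maxr _ _).
have -> : l = x (maxn N M) - (x (maxn N M) - l) by mxring.
by apply: (le_trans (ler_normB _ _)); lra.
Qed.

(** The limit is pointwise. Each bound in [ctl_bd] involves the paths at two times only, so it
    passes to the limit with the tail [r] as a common rate. *)
Lemma controlled_limit (C : R) (S : nat -> R) (Y : nat -> R -> 'rV[R]_m)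
    (Y' : nat -> R -> linmx R d 1 m) : 0 <= C -> nneg_summable S ->
  (forall n, ctl_bd p W X `[0, T] (S n) (S n) (S n)
     (fun t => Y n.+1 t - Y n t) (fun t => Y' n.+1 t - Y' n t)) ->
  (forall n u, 0 <= u -> u <= T -> `|Y n.+1 u - Y n u| <= C * S n) ->
  exists (Z : R -> 'rV[R]_m) (Z' : R -> linmx R d 1 m) (r : nat -> R),
  [/\ (forall eps, 0 < eps -> exists N, forall n, (N <= n)%N -> r n <= eps),
      (forall n, ctl_bd p W X `[0, T] (r n) (r n) (r n)
         (fun t => Z t - Y n t) (fun t => Z' t - Y' n t)) &
      (forall n u, 0 <= u -> u <= T -> `|Z u - Y n u| <= C * r n)].
Proof.
move=> C0 HS HY HY0; have [r [r0 rS]] := nneg_summable_tail HS.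
have Hnm n j : ctl_bd p W X `[0, T] (r n) (r n) (r n)
     (fun t => Y (n + j)%N t - Y n t) (fun t => Y' (n + j)%N t - Y' n t).
  have le := rS n (n + j)%N; apply: (ctl_bd_le le le le).
  elim: j {le} => [|j IH].
    rewrite addn0 big_geq// => u v _ _ _.
    by rewrite /remainder /incr !subrr lapp0l subrr !normr0 !mul0r.
  rewrite addnS big_nat_recr /=; last exact: leq_addr.
  apply: ctl_bd_ext (ctl_bdD IH (HY (n + j)%N)) => u Du.
  by split; mxring.
have Hnm0 n j u : 0 <= u -> u <= T -> `|Y (n + j)%N u - Y n u| <= C * r n.
  move=> u0 uT; apply: (@le_trans _ _ (C * \sum_(n <= i < n + j) S i)); last exact: ler_wpM2l.
  elim: j => [|j IH]; first by rewrite addn0 subrr normr0 big_geq// mulr0.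
  rewrite addnS big_nat_recr /=; last exact: leq_addr.
  have -> : Y (n + j).+1 u - Y n u = (Y (n + j)%N u - Y n u) + (Y (n + j).+1 u - Y (n + j)%N u).
    by mxring.
  by apply: (le_trans (ler_normD _ _)); rewrite mulrDr; apply: lerD => //; exact: HY0.
have cauchy (n1 n2 : nat) (x : nat -> 'M[R]_(n1, n2)) (A : R) : 0 <= A ->
    (forall n j, `|x (n + j)%N - x n| <= A * r n) ->
    exists l, forall eps, 0 < eps -> exists N, forall i, (N <= i)%N -> `|x i - l| < eps.
  move=> A0 Hx; apply: mx_cauchy_limit => eps eps0.
  have e0 : 0 < eps / (3 * (A + 1)) by rewrite divr_gt0//; lra.
  have [N HN] := r0 _ e0; exists N => i j Ni Nj.
  have h1 := Hx N (i - N)%N; have h2 := Hx N (j - N)%N; rewrite !subnKC// in h1 h2.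
  have -> : x i - x j = (x i - x N) - (x j - x N) by mxring.
  apply: (le_lt_trans (ler_normB _ _)).
  have h3 : A * r N <= eps / 3.
    apply: (le_trans (ler_wpM2l A0 (HN N (leqnn N)))).
    have -> : A * (eps / (3 * (A + 1))) = (A / (A + 1)) * (eps / 3) by field; apply/eqP; lra.
    apply: ler_piMl; first lra.
    by rewrite ler_pdivrMr; lra.
  lra.
(* The condition on [u] is placed under the existential so that [choice] gives a path on all of
   [R]. *)
have HZ0 (u : R) : exists l : 'rV[R]_m, 0 <= u <= T -> forall eps, 0 < eps ->
    exists N, forall i, (N <= i)%N -> `|Y i u - l| < eps.
  have [/andP[u0 uT]|nu] := boolP (0 <= u <= T); last by exists 0.
  by have [l Hl] := cauchy _ _ (fun n => Y n u) C C0 (fun n j => Hnm0 n j u u0 uT); exists l.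
have HZ0' (u : R) : exists l : linmx R d 1 m, 0 <= u <= T -> forall eps, 0 < eps ->
    exists N, forall i, (N <= i)%N -> `|Y' i u - l| < eps.
  have [u0T|nu] := boolP (0 <= u <= T); last by exists 0.
  have Du : `[0, T]%classic u by rewrite /= in_itv.
  have [|l Hl] := cauchy _ _ (fun n => Y' n u) 1 ler01; last by exists l.
  by move=> n j; rewrite mul1r; case: (Hnm n j u u Du Du (lexx u)).
have [Z HZ] := choice HZ0; have [Z' HZ'] := choice HZ0'.
have limB n1 n2 (x z : nat -> 'M[R]_(n1, n2)) l l1 :
    (forall eps, 0 < eps -> exists N, forall i, (N <= i)%N -> `|x i - l| < eps) ->
    (forall eps, 0 < eps -> exists N, forall i, (N <= i)%N -> `|z i - l1| < eps) ->
    (forall eps, 0 < eps -> exists N, forall i, (N <= i)%N -> `|(x i - z i) - (l - l1)| < eps).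
  move=> Hx Hz eps eps0; have e2 : 0 < eps / 2 by lra.
  have [N1 H1] := Hx _ e2; have [N2 H2] := Hz _ e2.
  exists (maxn N1 N2) => i; rewrite geq_max => /andP[i1 i2].
  have -> : x i - z i - (l - l1) = (x i - l) - (z i - l1) by mxring.
  by apply: (le_lt_trans (ler_normB _ _)); have := H1 i i1; have := H2 i i2; lra.
have limC n1 n2 (l : 'M[R]_(n1, n2)) : forall eps, 0 < eps -> exists N, forall i : nat, (N <= i)%N -> `|l - l| < eps.
  by move=> eps eps0; exists 0%N => i _; rewrite subrr normr0.
have limL (x : nat -> linmx R d 1 m) l (h : 'rV[R]_d) :
    (forall eps, 0 < eps -> exists N, forall i, (N <= i)%N -> `|x i - l| < eps) ->
    (forall eps, 0 < eps -> exists N, forall i, (N <= i)%N -> `|lapp (x i) h - lapp l h| < eps).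
  move=> Hx eps eps0; have K0 : 0 < d%:R * `|h| + 1 by rewrite ltr_wpDl// mulr_ge0.
  have [N HN] := Hx _ (divr_gt0 eps0 K0); exists N => i Ni.
  rewrite -(lappBl (x i)); apply: (le_lt_trans (lapp_norm _ _)).
  have := HN i Ni; rewrite ltr_pdivlMr// => h1.
  apply: le_lt_trans h1; rewrite mulrCA; apply: ler_wpM2l => //; lra.
exists Z, Z', r; split => //.
- move=> n u v Du Dv uv.
  have u0T : 0 <= u <= T by move: Du; rewrite /= in_itv.
  have v0T : 0 <= v <= T by move: Dv; rewrite /= in_itv.
  have [Zu Zv] := (HZ u u0T, HZ v v0T); have [Zu' Zv'] := (HZ' u u0T, HZ' v v0T).
  have B i : (n <= i)%N -> [/\ `|Y' i u - Y' n u| <= r n, `|Y' i v - Y' n v| <= r n,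
      `|Y' i v - Y' n v - (Y' i u - Y' n u)| <= r n * hw p W u v &
      `|remainder X (fun t => Y i t - Y n t) (fun t => Y' i t - Y' n t) u v|
         <= r n * hw p W u v ^+ 2].
    by move=> ni; have := Hnm n (i - n)%N u v Du Dv uv; rewrite subnKC.
  split.
  + apply: (norm_limit (N := n) (limB _ _ _ _ _ _ Zu' (limC _ _ (Y' n u)))).
    by move=> i ni; case: (B i ni).
  + apply: (norm_limit (N := n) (limB _ _ _ _ _ _ Zv' (limC _ _ (Y' n v)))).
    by move=> i ni; case: (B i ni).
  + apply: (norm_limit (N := n) (limB _ _ _ _ _ _ (limB _ _ _ _ _ _ Zv' (limC _ _ (Y' n v)))
      (limB _ _ _ _ _ _ Zu' (limC _ _ (Y' n u))))).
    by move=> i ni; case: (B i ni).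
  + rewrite /remainder /incr.
    apply: (norm_limit (N := n) (limB _ _ _ _ _ _ (limB _ _ _ _ _ _
      (limB _ _ _ _ _ _ Zv (limC _ _ (Y n v))) (limB _ _ _ _ _ _ Zu (limC _ _ (Y n u))))
      (limL _ _ _ (limB _ _ _ _ _ _ Zu' (limC _ _ (Y' n u)))))).
    by move=> i ni; case: (B i ni).
- move=> n u u0 uT; have u0T : 0 <= u <= T by rewrite u0.
  apply: (norm_limit (N := n) (limB _ _ _ _ _ _ (HZ u u0T) (limC _ _ (Y n u)))) => i ni.
  by have := Hnm0 n (i - n)%N u u0 uT; rewrite subnKC.
Qed.

End ControlledLimits.

Section PicardIteration.
Context {R : realType}.
Variables (d e k : nat) (c p T : R) (W : R -> R) (X : R -> 'rV[R]_d) (XX : R -> R -> 'M[R]_d).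
Hypotheses (c1 : 1 <= c) (dc : d%:R <= c) (nc : (e + k)%:R <= c).
Hypothesis HX : holder_rough c p T W X XX.
Hypothesis hc : forall u v, 0 <= u -> u <= v -> v <= T -> hw p W u v <= c.
Hypothesis sc : sew_const (3 / p) <= c.
Variables (f : 'rV[R]_(e + k) -> linmx R d 1 k) (Df : 'rV[R]_(e + k) -> linmx R (e + k) d (1 * k))
  (D2f : 'rV[R]_(e + k) -> linmx R (e + k) (e + k) (d * (1 * k))).
Hypothesis fc : C2bd c f Df D2f.
Variables (alpha : R -> 'rV[R]_e) (alpha' : R -> linmx R d 1 e)
  (y : R -> 'rV[R]_k) (y' : R -> linmx R d 1 k).
Hypothesis Hal : ctl_bd p W X `[0, T] c c c alpha alpha'.
Hypothesis Hy : ctl_bd p W X `[0, T] c c c y y'.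
Local Notation Phi := (sol_map T X XX f Df alpha alpha' y y').
Local Notation K1 := (base_const c).

Let C0 : 0 <= c. Proof. exact: le_trans ler01 c1. Qed.

Lemma integral_of_controlled (Y : R -> 'rV[R]_k) Y' b r : 0 <= b -> 0 <= r ->
  ctl_bd p W X `[0, T] (2 * c) b r Y Y' -> forall t, 0 <= t -> t <= T ->
  exists I, is_rough_integral X XX (fun u => f (joint alpha Y u))
    (fun u => joint' alpha' Y' u *m Df (joint alpha Y u)) 0 t I.
Proof.
move=> b0 r0 HY.
have DT x : `[0, T]%classic x -> 0 <= x <= T by rewrite /= in_itv.
pose K := (3 * c) ^+ 10; have K0 : 0 <= K by rewrite exprn_ge0//; have := C0; lra.
pose D0 := K * (1 + b + c * r).
have cr : 0 <= c * r by rewrite mulr_ge0// C0.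
have D00 : 0 <= D0 by rewrite mulr_ge0//; lra.
apply: (rough_integral_exists c1 dc HX D00) => x z x0 xz zT.
have Dx : `[0, T]%classic x by rewrite /= in_itv/= x0 (le_trans xz (ltW zT)).
have Dz : `[0, T]%classic z by rewrite /= in_itv/= (le_trans x0 xz) (ltW zT).
have [_ _ H3 H4] := integrand_bounds' c1 dc nc HX hc fc DT b0 r0 Hal HY Dx Dz xz.
have hh := hc x0 xz (ltW zT).
split; [apply: (le_trans H3)|apply: (le_trans H4)]; apply: ler_wpM2r; rewrite ?exprn_ge0 ?hw_ge0//.
  by rewrite ler_wpM2l// lerD2l mulrC ler_wpM2r.
rewrite ler_wpM2l//; have : 1 * r <= c * r by rewrite ler_wpM2r.
lra.
Qed.

(** [xget] returns 0 where no integral exists; on [0, T] this does not occur for iterates with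
    finite bounds. *)
Definition next_iterate (P : (R -> 'rV[R]_k) * (R -> linmx R d 1 k)) :
    (R -> 'rV[R]_k) * (R -> linmx R d 1 k) :=
  (fun t => y t + xget 0 [set I | is_rough_integral X XX (fun u => f (joint alpha P.1 u))
     (fun u => joint' alpha' P.2 u *m Df (joint alpha P.1 u)) 0 t I],
   fun t => y' t + f (joint alpha P.1 t)).

Definition ctl_finite (P : (R -> 'rV[R]_k) * (R -> linmx R d 1 k)) : Prop :=
  exists b r, [/\ 0 <= b, 0 <= r & ctl_bd p W X `[0, T] (2 * c) b r P.1 P.2].

Lemma next_iterate_image P : ctl_finite P ->
  Phi P.1 P.2 (next_iterate P).1 (next_iterate P).2.
Proof.
move=> [b [r [b0 r0 HP]]] t t0 tT; split => //=.
rewrite addrC addKr; have [I HI] := integral_of_controlled b0 r0 HP t0 tT.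
exact: (xgetPex 0 (ex_intro _ I HI)).
Qed.

Lemma next_iterate_finite P : ctl_finite P -> ctl_finite (next_iterate P).
Proof.
move=> FP; have HU := next_iterate_image FP; case: FP => b [r [b0 r0 HP]].
have K1g := base_const_ge1 c1.
pose M := b + r.
have M0 : 0 <= M by rewrite addr_ge0.
have HM : ctl_bd p W X `[0, T] (2 * c) M M P.1 P.2 by apply: ctl_bd_le HP; rewrite /M; lra.
have cM : 0 <= (1 + M + M) * c by rewrite mulr_ge0 ?C0//; lra.
have cr : 0 <= M * c by rewrite mulr_ge0 ?C0.
exists (K1 * (1 + M * c)), (K1 * (1 + (1 + M + M) * c)); split.
- by rewrite mulr_ge0//; lra.
- by rewrite mulr_ge0//; lra.
move=> u v Du Dv uv; have := Du; have := Dv; rewrite /= !in_itv/= => /andP[v0 vT] /andP[u0 uT].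
split.
- exact: (step_sup fc Hy HU).
- exact: (step_sup fc Hy HU).
- exact: (base_closed_deriv c1 dc nc HX hc fc Hal Hy HU (lexx 0) (lexx T) M0 M0 HM u0 uv vT).
- apply: (base_closed_rem c1 dc nc HX hc sc fc Hal Hy HU (lexx 0) (lexx T) M0 _ u0 uv vT).
  exact: ctl_bd_sub (itv_co_sub (lexx 0) (lexx T)) HM.
Qed.

Variables (tau : nat -> R) (N : nat) (eps : R).
Hypotheses (t0 : tau 0%N = 0) (tN : tau N.+1 = T) (tm : forall i, tau i <= tau i.+1)
  (tT : forall i, 0 <= tau i <= T) (eps0 : 0 <= eps) (eK : 8 * K1 * eps <= 1)
  (teps : forall i u v, tau i <= u -> u <= v -> v < tau i.+1 -> hw p W u v <= eps).

(* The sequence starts at the second iterate, for which uniform bounds hold on the closed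
   pieces as well. *)
Lemma picard_sequence : exists (Y : nat -> R -> 'rV[R]_k) (Y' : nat -> R -> linmx R d 1 k),
  [/\ (forall n, Y n 0 = y 0), (forall n, Phi (Y n) (Y' n) (Y n.+1) (Y' n.+1)) &
      (forall n, ctl_bd p W X `[0, T] (2 * c) (global_const c N) (global_const c N) (Y n) (Y' n))].
Proof.
(* The datum [(y, y')] is itself a controlled path with constants at most [4 * K1], the bound that
   [base_open] propagates. *)
pose P n := iter n next_iterate (y, y').
have K1g := base_const_ge1 c1; have cc := C0.
have F n : ctl_finite (P n).
  elim: n => [|n IH]; last exact: next_iterate_finite.
  by exists c, c; split => //; apply: ctl_bd_le Hy; lra.
have Im n : Phi (P n).1 (P n).2 (P n.+1).1 (P n.+1).2 by exact: next_iterate_image.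
have cK : c <= 4 * K1.
  have h1 : c <= K1.
    rewrite /base_const; apply: (@le_trans _ _ (3 * c)); first lra.
    by rewrite -[leLHS]expr1; apply: ler_weXn2l => //; have := c1; lra.
  lra.
have Hop i n : ctl_bd p W X `[tau i, tau i.+1[ (2 * c) (4 * K1) (4 * K1) (P n).1 (P n).2.
  have /andP[a0 aT] := tT i; have /andP[b0 bT] := tT i.+1.
  elim: n => [|n IH].
    by apply: ctl_bd_sub (itv_co_sub a0 bT) _; apply: ctl_bd_le Hy; lra.
  have K40 : 0 <= 4 * K1 by lra.
  have := base_open c1 dc nc HX hc sc fc Hal Hy (Im n) a0 bT K40 eps0 eK (teps (i := i)) IH.
  by apply: ctl_bd_le; lra.
exists (fun n => (P n.+2).1), (fun n => (P n.+2).2); split=> [n|n|n].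
- have [_ /rough_integral0 /eqP] := Im n.+1 0 (lexx 0) (ltW (hr_T HX)).
  by rewrite subr_eq0 => /eqP.
- exact: Im.
- rewrite -tN; apply: (ctl_bd_pieces c1 dc HX (closed_const_ge0 c1) t0 tm tT).
  move=> i _; have /andP[a0 aT] := tT i; have /andP[b0 bT] := tT i.+1.
  apply: (base_closed c1 dc nc HX hc sc fc Hal Hy a0 bT (Im n) (Im n.+1)) => //.
  have [b [r [bb rr Hb]]] := F n.+1; exists b, r; split => //.
  exact: ctl_bd_sub (itv_cc_sub a0 bT) Hb.
Qed.

End PicardIteration.

Section PicardLimit.
Context {R : realType}.
Variables (d e k : nat) (c p T : R) (W : R -> R) (X : R -> 'rV[R]_d) (XX : R -> R -> 'M[R]_d).
Hypotheses (c1 : 1 <= c) (dc : d%:R <= c) (nc : (e + k)%:R <= c).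
Hypothesis HX : holder_rough c p T W X XX.
Hypothesis hc : forall u v, 0 <= u -> u <= v -> v <= T -> hw p W u v <= c.
Hypothesis sc : sew_const (3 / p) <= c.
Variables (f : 'rV[R]_(e + k) -> linmx R d 1 k)
  (Df : 'rV[R]_(e + k) -> linmx R (e + k) d (1 * k))
  (D2f : 'rV[R]_(e + k) -> linmx R (e + k) (e + k) (d * (1 * k)))
  (D3f : 'rV[R]_(e + k) -> linmx R (e + k) (e + k) ((e + k) * (d * (1 * k)))).
Hypothesis fc : C3bd c f Df D2f D3f.
Variables (alpha : R -> 'rV[R]_e) (alpha' : R -> linmx R d 1 e)
  (y : R -> 'rV[R]_k) (y' : R -> linmx R d 1 k).
Hypothesis Hal : ctl_bd p W X `[0, T] c c c alpha alpha'.
Hypothesis Hy : ctl_bd p W X `[0, T] c c c y y'.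
Local Notation Phi := (sol_map T X XX f Df alpha alpha' y y').
Variables (Y : nat -> R -> 'rV[R]_k) (Y' : nat -> R -> linmx R d 1 k).
Hypotheses (HY0 : forall n, Y n 0 = y 0)
  (HYn : forall n, Phi (Y n) (Y' n) (Y n.+1) (Y' n.+1))
  (HYc : forall n, ctl_bd p W X `[0, T] c c c (Y n) (Y' n)).
Variables (tau : nat -> R) (N : nat) (eps : R).
Hypotheses (t0 : tau 0%N = 0) (tN : tau N = T) (tm : forall i, tau i <= tau i.+1)
  (tT : forall i, 0 <= tau i <= T) (eps0 : 0 <= eps) (eK : diff_lam c * eps <= 1)
  (teps : forall i u v, tau i <= u -> u <= v -> v < tau i.+1 -> hw p W u v <= eps).
Local Notation G := (diff_const c).
Local Notation gam := (diff_gam c).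
Local Notation dY n := (fun t => Y n.+1 t - Y n t).
Local Notation dY' n := (fun t => Y' n.+1 t - Y' n t).

Let C0 : 0 <= c. Proof. exact: le_trans ler01 c1. Qed.
Let G1 : 1 <= G. Proof. exact: diff_const_ge1. Qed.
Let L1 : 1 <= diff_lam c. Proof. by case: (diff_lam_ge c1) => _ []. Qed.
Let gam0 : 0 <= gam.
Proof.
have g1 := G1; have l1 := L1; have k1 := diff_kap_ge1 c1.
apply: mulr_ge0; first lra; apply: addr_ge0; first lra.
by apply: mulr_ge0; [lra|exact: C0].
Qed.

(** Makes the stability estimates available with [E = 0], for two iterates of the same equation. *)
Lemma C2bd_self_diff n m1 m2 F (g : 'rV[R]_n -> 'M[R]_(m1, m2)) Dg D2g : C2bd F g Dg D2g ->
  C2bd 0 (fun z => g z - g z) (fun z => Dg z - Dg z) (fun z => D2g z - D2g z).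
Proof.
have H (n1 n2 : nat) (h : 'rV[R]_n -> 'M[R]_(n1, n2)) Dh : C1bd F h Dh ->
    C1bd 0 (fun z => h z - h z) (fun z => Dh z - Dh z).
  move=> [H1 H2 H3]; split=> [a b x|x|x]; [|by rewrite subrr normr0..].
  by rewrite lappBl; apply: is_deriveB; exact: H1.
by move=> [H1 H2]; split; exact: H.
Qed.

Let g0 := C2bd_self_diff (conj fc.1 fc.2.1).

Lemma ctl_bd_self_diff m D (Z : R -> 'rV[R]_m) Z' :
  ctl_bd p W X D 0 0 0 (fun t => Z t - Z t) (fun t => Z' t - Z' t).
Proof.
by move=> u v _ _ _; rewrite /remainder /incr !subrr lapp0l subrr !normr0 !mul0r.
Qed.

Let Hda0 u : 0 <= u -> u <= T -> `|alpha u - alpha u| <= 0.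
Proof. by rewrite subrr normr0. Qed.

(** The closed bound of difference [n.+1] uses the open and closed bounds of difference [n]. Hence
    the sequences are shifted by one, with the crude bound [2 * c] at index 0. *)
Lemma picard_summable i : exists2 S, nneg_summable S &
  forall n, ctl_bd p W X `[0, tau i] (S n) (S n) (S n) (dY n) (dY' n).
Proof.
have g1 := G1; have l1 := L1; have cc := C0; have C1 := c1.
have T0 := ltW (hr_T HX).
have c20 : 0 <= 2 * c by lra.
have Hda := ctl_bd_self_diff (D := `[0, T]%classic) alpha alpha'.
have Hdy := ctl_bd_self_diff (D := `[0, T]%classic) y y'.
have Y00 n : `|Y n.+1 0 - Y n 0| <= 0 by rewrite !HY0 subrr normr0.
have Hc s t n : 0 <= s -> t <= T -> ctl_bd p W X `[s, t] (2 * c) (2 * c) (2 * c) (dY n) (dY' n).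
  move=> s0 tT'; apply: ctl_bd_sub (itv_cc_sub s0 tT') _ => u v Du Dv uv.
  have [A1 A2 A3 A4] := HYc n.+1 Du Dv uv; have [B1 B2 B3 B4] := HYc n Du Dv uv.
  split.
  - by apply: (le_trans (ler_normB _ _)); lra.
  - by apply: (le_trans (ler_normB _ _)); lra.
  - have -> : Y' n.+1 v - Y' n v - (Y' n.+1 u - Y' n u) =
      (Y' n.+1 v - Y' n.+1 u) - (Y' n v - Y' n u) by mxring.
    by apply: (le_trans (ler_normB _ _)); lra.
  - by rewrite remainderB; apply: (le_trans (ler_normB _ _)); lra.
elim: i => [|i [S HS IH]].
  (* All iterates agree at 0, so their derivatives there agree from index 1 on; only the difference
     at index 0 may be nonzero. *)
  exists (fun n => if n is n'.+1 then 0 else 2 * c).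
    by apply: nneg_summable_cons => //; exact: nneg_summable0.
  case=> [|n]; first by rewrite t0; exact: Hc.
  move=> u v; rewrite /= !in_itv/= t0 => /andP[u0 u1] /andP[v0 v1] _.
  have -> : u = 0 by lra. have -> : v = 0 by lra.
  have := diff_step_val c1 dc nc fc g0 Hda0 Hdy (HYn n.+1) (HYn n) (lexx 0) T0 (lexx 0) (Y00 n).
  by rewrite mulr0 /remainder /incr !subrr lapp0r subr0 !normr0 !mul0r.
have /andP[s0 sT] := tT i; have /andP[s10 s1T] := tT i.+1.
pose del n := 2 * c ^+ 3 * S n.
have [S0 _] := HS.
have Sdel : nneg_summable del by apply: nneg_summableZ => //; rewrite mulr_ge0// exprn_ge0.
have dl n : `|Y n.+1 (tau i) - Y n (tau i)| <= del n.
  have := sup_from_start c1 dc HX hc tT (S0 n) (Y00 n) (IH n).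
  by rewrite add0r.
pose b n := G * (del n + 0).
have Sb : nneg_summable b.
  apply: nneg_summableZ; first lra.
  by apply: nneg_summableD => //; exact: nneg_summable0.
pose M := halving_seq (2 * c) b.
have SM : nneg_summable M by exact: nneg_summable_halving.
have [M0 _] := SM; have [del0 _] := Sdel.
have Hop n : ctl_bd p W X `[tau i, tau i.+1[ (M n) (diff_lam c * M n) (diff_lam c * M n) (dY n) (dY' n).
  elim: n => [|n IHn].
    have lc : 2 * c <= diff_lam c * (2 * c) by rewrite ler_peMl.
    apply: (ctl_bd_le (lexx (2 * c)) lc lc); apply: ctl_bd_sub (Hc _ _ 0%N s0 s1T).
    by move=> u; rewrite /= !in_itv/= => /andP[-> /ltW ->].
  exact: (diff_open c1 dc nc HX hc sc fc g0 Hal Hal Hda Hda0 Hdy (HYc n.+1) (HYc n)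
    (HYn n.+1) (HYn n) s0 s1T (M0 n) (del0 n) eps0 eK (teps (i := i)) (dl n) IHn).
pose rho n := if n is n'.+1 then gam * (M n' + del n' + 0) else 2 * c.
have Srho : nneg_summable rho.
  apply: nneg_summable_cons => //; apply: nneg_summableZ => //.
  by do ! apply: nneg_summableD => //; exact: nneg_summable0.
have [rho0 _] := Srho.
have Hrho n u v : tau i <= u -> u <= v -> v <= tau i.+1 ->
    `|remainder X (dY n) (dY' n) u v| <= rho n * hw p W u v ^+ 2.
  case: n => [|n] su uv vt.
    have Du : `[tau i, tau i.+1]%classic u by rewrite /= in_itv/= su (le_trans uv).
    have Dv : `[tau i, tau i.+1]%classic v by rewrite /= in_itv/= vt (le_trans su).
    by case: (Hc _ _ 0%N s0 s1T u v Du Dv uv).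
  exact: (diff_closed_rem c1 dc nc HX hc sc fc g0 Hal Hal Hda Hda0 Hdy (HYc n.+1) (HYc n)
    (HYn n.+1) (HYn n) s0 s1T (M0 n) (del0 n) eps0 eK (teps (i := i)) (dl n) (Hop n)).
pose Nc n := del n + 0 + c ^+ 3 * M n + c ^+ 2 * rho n.
have SNc : nneg_summable Nc.
  do ! apply: nneg_summableD => //; [exact: nneg_summable0|..].
    by apply: nneg_summableZ => //; exact: exprn_ge0.
  by apply: nneg_summableZ => //; exact: exprn_ge0.
have [Nc0 _] := SNc.
pose B n := if n is n'.+1 then G * Nc n' + gam * (M n' + del n' + 0) else 2 * c.
have SB : nneg_summable B.
  apply: nneg_summable_cons => //; apply: nneg_summableD.
    by apply: nneg_summableZ => //; lra.
  apply: nneg_summableZ => //.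
  by do ! apply: nneg_summableD => //; exact: nneg_summable0.
have [B0 _] := SB.
have Hcl n : ctl_bd p W X `[tau i, tau i.+1] (B n) (B n) (B n) (dY n) (dY' n).
  case: n => [|n]; first exact: Hc.
  have GN : 0 <= G * Nc n by rewrite mulr_ge0//; lra.
  have gM : 0 <= gam * (M n + del n + 0).
    by rewrite mulr_ge0// !addr_ge0.
  apply: ctl_bd_le (diff_closed c1 dc nc HX hc sc fc g0 Hal Hal Hda Hda0 Hdy (HYc n.+1) (HYc n)
    (HYn n.+1) (HYn n) s0 s1T (M0 n) (del0 n) eps0 eK (teps (i := i)) (dl n) (Hop n)
    (rho0 n) (Hrho n)); rewrite /B -/(Nc n); lra.
exists (fun n => (1 + c ^+ 2) * S n + B n).
  by apply: nneg_summableD => //; apply: nneg_summableZ => //; rewrite addr_ge0// exprn_ge0.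
move=> n; have s_ := S0 n; have b_ := B0 n.
have c2S : 0 <= c ^+ 2 * S n by rewrite mulr_ge0// exprn_ge0.
have H1 : ctl_bd p W X `[0, tau i] (S n + B n) (S n) (S n) (dY n) (dY' n).
  by apply: ctl_bd_le (IH n); lra.
have H2 : ctl_bd p W X `[tau i, tau i.+1] (S n + B n) (B n) (B n) (dY n) (dY' n).
  by apply: ctl_bd_le (Hcl n); lra.
have := ctl_bd_patch c1 dc HX (lexx 0) s0 (tm i) s1T s_ s_ b_ b_ H1 H2.
by apply: ctl_bd_le; lra.
Qed.

Lemma small_eq0 n1 n2 (l : 'M[R]_(n1, n2)) (A : R) : 0 <= A ->
  (forall eps1, 0 < eps1 -> `|l| <= A * eps1) -> l = 0.
Proof.
move=> A0 H; apply/eqP; rewrite -normr_le0; apply/ler_addgt0Pr => e0 e00; rewrite add0r.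
have h : 0 < e0 / (A + 1) by rewrite divr_gt0//; lra.
apply: (le_trans (H _ h)); rewrite mulrCA; apply: ler_piMr; first exact: ltW.
by rewrite ler_pdivrMr; lra.
Qed.

(** No limit is taken inside the integral: the image [U] of the limit [Z] exists, and
    [diff_step_rem] bounds its distance to the image of the iterate [Y M], that is to [Y M.+1],
    which tends to [Z]. *)
Lemma picard_limit : exists (Z : R -> 'rV[R]_k) (Z' : R -> linmx R d 1 k),
  Phi Z Z' Z Z' /\ ctl_bd p W X `[0, T] c c c Z Z'.
Proof.
have g1 := G1; have cc := C0; have C1 := c1; have T0 := ltW (hr_T HX).
have [S HS HSn] := picard_summable N; rewrite tN in HSn.
have [S0 _] := HS.
pose C := 2 * c ^+ 3.
have CC0 : 0 <= C by rewrite mulr_ge0// exprn_ge0.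
have Y00 n : `|Y n.+1 0 - Y n 0| <= 0 by rewrite !HY0 subrr normr0.
have Ysup n u : 0 <= u -> u <= T -> `|Y n.+1 u - Y n u| <= C * S n.
  move=> u0 uT.
  (* The constant sequence [fun=> u] puts an arbitrary time in place of the cutting times in
     [sup_from_start]. *)
  have tT' (i : nat) : 0 <= (fun=> u) i <= T by rewrite u0.
  have H : ctl_bd p W X `[0, u] (S n) (S n) (S n) (dY n) (dY' n).
    exact: ctl_bd_sub (itv_cc_sub (lexx 0) uT) (HSn n).
  by have := sup_from_start c1 dc HX hc (tau := fun=> u) tT' (i := 0%N) (S0 n) (Y00 n) H; rewrite add0r.
have [Z [Z' [r [r0 Hr Hr0]]]] := controlled_limit CC0 HS HSn Ysup.
have in0T u : 0 <= u -> u <= T -> `[0, T]%classic u by move=> u0 uT; rewrite /= in_itv/= u0.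
have rn n : 0 <= r n.
  have [H _ _ _] := Hr n 0 0 (in0T 0 (lexx 0) T0) (in0T 0 (lexx 0) T0) (lexx 0).
  exact: le_trans H.
have HZ : ctl_bd p W X `[0, T] c c c Z Z'.
  apply: ctl_bd_lim => eta eta0; have [M HM] := r0 _ eta0; have le := HM M (leqnn M).
  have := ctl_bdD (HYc M) (Hr M).
  move=> H; apply: (ctl_bd_ext (Y := fun t => Y M t + (Z t - Y M t))
    (Y' := fun t => Y' M t + (Z' t - Y' M t))); first by move=> u _; split; mxring.
  by apply: ctl_bd_le H; rewrite lerD2l.
pose K := (4 * c ^+ 3) ^+ 16.
have K0 : 0 <= K by rewrite exprn_ge0// mulr_ge0// exprn_ge0.
have EZ' u : 0 <= u -> u <= T -> Z' u = y' u + f (joint alpha Z u).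
  move=> u0 uT; apply/eqP; rewrite -subr_eq0; apply/eqP.
  apply: (small_eq0 (A := 1 + K * C)); first by rewrite addr_ge0// mulr_ge0.
  move=> eta eta0; have [M HM] := r0 _ eta0.
  have [_ h1 _ _] := Hr M.+1 u u (in0T u u0 uT) (in0T u u0 uT) (lexx u).
  have Cr : 0 <= C * r M by rewrite mulr_ge0.
  have h2 := path_diff_val p W c1 dc nc fc g0 Hda0 u0 uT Cr (Hr0 M u u0 uT).
  have [EY _] := HYn M u0 uT.
  have -> : Z' u - (y' u + f (joint alpha Z u)) =
     (Z' u - Y' M.+1 u) - (f (joint alpha Z u) - f (joint alpha (Y M) u)).
    by rewrite EY; mxring.
  apply: (le_trans (ler_normB _ _)); apply: (le_trans (lerD h1 h2)).
  have l1 := HM M.+1 (leqnSn M); have l2 := HM M (leqnn M).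
  have : K * (C * r M) <= K * (C * eta) by apply: ler_wpM2l => //; apply: ler_wpM2l.
  rewrite -/K; lra.
have HZ2 : ctl_bd p W X `[0, T] (2 * c) c c Z Z' by apply: ctl_bd_le HZ; lra.
have HI0 (t : R) : exists I, 0 <= t -> t <= T -> is_rough_integral X XX
    (fun u => f (joint alpha Z u)) (fun u => joint' alpha' Z' u *m Df (joint alpha Z u)) 0 t I.
  have [t00|nt] := boolP (0 <= t <= T); last first.
    by exists 0 => t00 tT'; rewrite t00 tT' in nt.
  have /andP[t1 t2] := t00.
  by have [I HI] := integral_of_controlled c1 dc nc HX hc (conj fc.1 fc.2.1) Hal cc cc HZ2 t1 t2; exists I.
have [I HI] := choice HI0.
pose U t := y t + I t.
have HU : Phi Z Z' U Z'.
  by move=> t t1 t2; split; [exact: EZ'|rewrite /U addrC addKr; exact: HI].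
have UZ t : 0 <= t -> t <= T -> U t = Z t.
  move=> t1 t2; apply/eqP; rewrite -subr_eq0; apply/eqP.
  (* [L0 * r M] dominates all differences between [Z] and [Y M]: [C] stands for the values,
     [2 * c ^+ 2] for the increments, 1 for the derivative and the remainder. *)
  pose L0 := C + 2 * c ^+ 2 + 1.
  have c2 : 0 <= c ^+ 2 by exact: exprn_ge0.
  have L00 : 0 <= L0 by rewrite !addr_ge0// mulr_ge0.
  pose A := G * (L0 + L0 * c) * c ^+ 2.
  have A0 : 0 <= A by rewrite /A !mulr_ge0// ?addr_ge0// ?mulr_ge0//; lra.
  apply: (small_eq0 (A := A + c ^+ 3 + C)).
    by rewrite !addr_ge0// exprn_ge0.
  move=> eta eta0; have [M HM] := r0 _ eta0.
  have l1 := HM M.+1 (leqnSn M); have l2 := HM M (leqnn M).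
  have rM := rn M; pose L := L0 * r M.
  have Cr : 0 <= C * r M by rewrite mulr_ge0.
  have c2r : 0 <= c ^+ 2 * r M by rewrite mulr_ge0.
  have LE : L = C * r M + 2 * c ^+ 2 * r M + r M by rewrite /L /L0; ring.
  have LL : 0 <= L by rewrite mulr_ge0.
  have H : `|remainder X (fun t => U t - Y M.+1 t) (fun t => Z' t - Y' M.+1 t) 0 t| <=
      G * (L + L * hw p W 0 t) * hw p W 0 t ^+ 2.
    have T00 := hr_T HX.
    have Hda := ctl_bd_self_diff (D := `[0, T]%classic) alpha alpha'.
    have Hdy := ctl_bd_self_diff (D := `[0, T]%classic) y y'.
    apply: (diff_step_rem c1 dc nc HX hc sc fc g0 Hal Hal Hda Hda0 Hdy HZ (HYc M) HU (HYn M)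
      (lexx 0) (lexx T) LL (lexx L)) => //.
      move=> u u0 uT; have uT' := ltW uT; split.
        by apply: (le_trans (Hr0 M u u0 uT')); rewrite LE; lra.
      have [h1 _ _ _] := Hr M u u (in0T u u0 uT') (in0T u u0 uT') (lexx u).
      by apply: (le_trans h1); rewrite LE; lra.
    move=> u v u0 uv vT; have uT' := ltW (le_lt_trans uv vT); have vT' := ltW vT.
    have [h1 _ h3 h4] := Hr M u v (in0T u u0 uT') (in0T v (le_trans u0 uv) vT') uv.
    have h0 := hw_ge0 p W u v; have hh := hc u0 uv vT'.
    have rL : r M <= L by rewrite LE; lra.
    split.
    - apply: (le_trans (incr_norm c1 dc HX u0 uv vT' rM h1 h4)).
      apply: ler_wpM2r => //; rewrite LE.
      have : r M * hw p W u v <= r M * c ^+ 2.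
        by apply: ler_wpM2l => //; apply: (le_trans hh); rewrite -[leLHS]expr1 ler_weXn2l.
      lra.
    - by apply: (le_trans h3); apply: ler_wpM2r.
    - by apply: (le_trans h4); apply: ler_wpM2r => //; exact: exprn_ge0.
  have hh := hc (lexx 0) t1 t2; have h0 := hw_ge0 p W 0 t.
  have H' : G * (L + L * hw p W 0 t) * hw p W 0 t ^+ 2 <= A * eta.
    have -> : A * eta = G * (L0 * eta + L0 * eta * c) * c ^+ 2 by rewrite /A; ring.
    have Le : L <= L0 * eta by apply: ler_wpM2l.
    apply: ler_pM; [|exact: exprn_ge0| |exact: lerXn2r].
      by rewrite mulr_ge0 ?addr_ge0 ?mulr_ge0//; lra.
    by apply: ler_wpM2l; [lra|apply: lerD => //; apply: ler_pM].
  have [h1 _ _ _] := Hr M.+1 0 0 (in0T 0 (lexx 0) T0) (in0T 0 (lexx 0) T0) (lexx 0).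
  have U0 : U 0 = y 0.
    by rewrite /U (rough_integral0 (HI 0 (lexx 0) T0)) addr0.
  have HX0 := hr_X HX (lexx 0) t1 t2.
  have h5 : `|lapp (Z' 0 - Y' M.+1 0) (incr X 0 t)| <= c ^+ 3 * eta.
    apply: (le_trans (lapp_norm _ _)).
    have -> : c ^+ 3 * eta = c * (eta * (c * c)) by ring.
    have Hd := dc.
    have e1 : `|Z' 0 - Y' M.+1 0| <= eta by exact: le_trans l1.
    have e2 : `|incr X 0 t| <= c * c by apply: (le_trans HX0); apply: ler_wpM2l.
    by prod_le.
  have h6 : `|Z t - Y M.+1 t| <= C * eta.
    by apply: (le_trans (Hr0 M.+1 t t1 t2)); apply: ler_wpM2l.
  have -> : U t - Z t = remainder X (fun t => U t - Y M.+1 t) (fun t => Z' t - Y' M.+1 t) 0 t +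
     lapp (Z' 0 - Y' M.+1 0) (incr X 0 t) - (Z t - Y M.+1 t).
    rewrite /remainder {1}/incr U0 HY0; move: (lapp _ _) => P; mxring.
  apply: (le_trans (ler_normB _ _)).
  apply: (le_trans (lerD (ler_normD _ _) (lexx _))).
  lra.
exists Z, Z'; split => //.
move=> t t1 t2; split; first exact: EZ'.
by rewrite -(UZ t t1 t2) /U addrC addKr; exact: HI.
Qed.

End PicardLimit.

(** * Controls from variation norms *)

Section VariationControl.
Context {R : realType}.
Variables (V : normedModType R) (T q : R) (G : R -> R -> V).
Hypotheses (T0 : 0 < T) (q0 : 0 < q).

Let g (u v : R) : R := `|G u v| `^ q.

Let g_ge0 s pi : 0 <= psum g s pi.
Proof. by elim: pi s => //= x pi IH s; rewrite addr_ge0 ?powR_ge0. Qed.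

Lemma var2_ge0 : (0 <= var2 T q G)%E.
Proof. exact: poweR_ge0. Qed.

(** Removes the extended-real supremum and its root: from here on, variation bounds are bounds on
    partition sums. *)
Lemma var2_leP (M : R) : 0 <= M -> (var2 T q G <= M%:E)%E <->
  (forall pi, itv_partition 0 T pi -> psum g 0 pi <= M `^ q).
Proof.
move=> M0; have qq : q^-1 * q = 1 by rewrite mulVf// gt_eqF.
have q1 : 0 <= q^-1 by rewrite invr_ge0 ltW.
rewrite /var2; set S := [set _ | _ in _].
split=> [H pi Hpi|H].
  have h1 : ((psum g 0 pi)%:E <= ereal_sup S)%E.
    by apply: ereal_sup_ubound; exists pi => //; rewrite part_sumE.
  have h2 : (poweR (psum g 0 pi)%:E q^-1 <= M%:E)%E.
    apply: le_trans H; apply: (gt0_ler_poweR q1) => //; rewrite !in_itv/= ?leey ?andbT ?lee_fin//.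
    by apply: le_trans h1; rewrite lee_fin.
  rewrite poweR_EFin lee_fin in h2.
  have := @ge0_ler_powR R q (ltW q0) _ _ _ _ h2; rewrite -powRrM qq powRr1//; apply;
    by rewrite nnegrE ?powR_ge0.
have h1 : (ereal_sup S <= (M `^ q)%:E)%E.
  by apply: ge_ereal_sup => _ [pi Hpi <-]; rewrite lee_fin part_sumE; exact: H.
apply: (@le_trans _ _ (poweR (M `^ q)%:E q^-1)).
  apply: (gt0_ler_poweR q1) => //; rewrite !in_itv/= ?leey ?andbT ?lee_fin ?powR_ge0 ?poweR_ge0//.
  have P0 : itv_partition 0 T [:: T] by exact: itv_partition1.
  apply: (@le_trans _ _ (psum g 0 [:: T])%:E); first by rewrite lee_fin.
  by apply: ereal_sup_ubound; exists [:: T] => //; rewrite part_sumE.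
by rewrite poweR_EFin lee_fin -powRrM mulrC qq powRr1.
Qed.

Lemma var2_le_control (M : R) (W : R -> R) : 0 <= M -> is_control T W ->
  (forall u v, 0 <= u -> u <= v -> v <= T -> `|G u v| <= M * (W v - W u) `^ q^-1) ->
  (var2 T q G <= (M * W T `^ q^-1)%:E)%E.
Proof.
move=> M0 [W0 mW _] H.
have qq : q^-1 * q = 1 by rewrite mulVf// gt_eqF.
have WT0 : 0 <= W T by rewrite -W0; apply: mW => //; exact: ltW.
apply/var2_leP => [|pi Hpi]; first by rewrite mulr_ge0 ?powR_ge0.
rewrite powRM ?powR_ge0// -powRrM qq powRr1// -[X in _ * X]subr0 -[X in _ - X]W0.
rewrite -(psum_telescope W Hpi) -psumZ; apply: ler_psum Hpi _ => u v u0 uv vT.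
have Wuv : 0 <= W v - W u by rewrite subr_ge0; apply: mW.
have := @ge0_ler_powR R q (ltW q0) _ _ _ _ (H u v u0 uv vT).
rewrite powRM ?powR_ge0// -powRrM qq powRr1//; apply; rewrite nnegrE//.
by rewrite mulr_ge0 ?powR_ge0.
Qed.

(* The control is [W t = (V 0 - V t) / M ^ q], where [V s] is the q-variation of
   [G] over [s, T] to the power q: its right-continuity only needs that of
   [r |-> G r x]. *)
Lemma variation_control (M : R) : 0 < M -> (forall u, 0 <= u -> u <= T -> G u u = 0) ->
  (var2 T q G <= M%:E)%E ->
  (forall s x, 0 <= s -> s < x -> x <= T -> G r x @[r --> s^'+] --> G s x) ->
  exists W, [/\ is_control T W, W T <= 1 &
    forall u v, 0 <= u -> u <= v -> v <= T -> `|G u v| <= M * (W v - W u) `^ q^-1].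
Proof.
move=> M0 G0 /(var2_leP (ltW M0)) HM cG.
have qq : q^-1 * q = 1 by rewrite mulVf// gt_eqF.
have Mq : 0 < M `^ q by apply: powR_gt0.
pose S s := [set psum g s pi | pi in itv_partition s T].
have SM s x : 0 <= s -> s <= T -> S s x -> x <= M `^ q.
  move=> s0 sT [pi Hpi <-]; have [s00|/eqP s00] := eqVneq s 0.
    by rewrite s00 in Hpi *; exact: HM.
  have sp : 0 < s by rewrite lt_neqAle s0 eq_sym; apply/andP; split => //; apply/eqP.
  apply: (le_trans _ (HM (s :: pi) _)); first by rewrite /= lerDr powR_ge0.
  by case: Hpi => h1 h2; split => //=; rewrite sp.
have hS s : 0 <= s -> s <= T -> has_sup (S s).
  move=> s0 sT; split; last by exists (M `^ q) => x; exact: SM.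
  have [-> |ne] := eqVneq s T; first by exists 0, [::].
  by exists (psum g s [:: T]), [:: T] => //; apply: itv_partition1; rewrite lt_neqAle ne.
pose U s := sup (S s).
have Ule s pi : 0 <= s -> s <= T -> itv_partition s T pi -> psum g s pi <= U s.
  by move=> s0 sT Hpi; apply: sup_upper_bound; [exact: hS|exists pi].
have UM s : 0 <= s -> s <= T -> U s <= M `^ q.
  by move=> s0 sT; apply: ge_sup; [case: (hS s s0 sT)|move=> x; exact: SM].
have UD s t : 0 <= s -> s <= t -> t <= T -> g s t + U t <= U s.
  move=> s0 st tT; have [-> |ne] := eqVneq s t.
    by rewrite /g G0 ?normr0 ?powR0 ?add0r//; [rewrite gt_eqF|lra].
  have lst : s < t by rewrite lt_neqAle ne.
  rewrite -lerBrDl; apply: ge_sup; first by case: (hS t ltac:(lra) tT).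
  move=> _ [pi Hpi <-]; rewrite lerBrDl; apply: (Ule s (t :: pi) s0 ltac:(lra)).
  by case: Hpi => h1 h2; split => //=; rewrite lst.
have UT : U T = 0.
  apply/eqP; rewrite eq_le; apply/andP; split.
    apply: ge_sup; first by case: (hS T (ltW T0) (lexx T)).
    by move=> _ [pi Hpi <-]; rewrite (itv_partitionxx Hpi).
  by apply: (Ule T [::]) => //; rewrite ?ltW.
exists (fun t => (U 0 - U t) / M `^ q); split.
- split; first by rewrite subrr mul0r.
    move=> s t s0 st tT; rewrite ler_pM2r ?invr_gt0// lerB//.
    by apply: le_trans (UD s t s0 st tT); rewrite lerDr powR_ge0.
  move=> s eta s0 sT eta0; pose h := eta * M `^ q / 2.
  have h0 : 0 < h by rewrite divr_gt0// mulr_gt0.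
  (* In a nearly optimal partition of [s, T], moving the left end to [r] before the first point [x]
     changes the first term only. The choice of [h] leaves one half of the tolerance to
     near-optimality and the other to this change. *)
  have [_ [pi Hpi <-]] := sup_adherent h0 (hS s s0 (ltW sT)).
  rewrite -/(U s); case: pi Hpi => [/itv_partition_nil E|x pi Hpi]; first by rewrite E ltxx in sT.
  have [sx xT] := itv_partition_itv Hpi => /= Hx.
  have [r sr [rx Hr]] : exists2 r, s < r & r < x /\ g s x - h <= g r x.
    (* If the first term is at most [h], it can be lost altogether and any [r] will do; otherwise
       convergence of [G r x] is used. *)
    have [gh|hg] := leP (g s x - h) 0.
      exists ((s + x) / 2); first lra.
      by split; [lra|apply: (le_trans gh); exact: powR_ge0].
    have bG : (g s x - h) `^ q^-1 < `|G s x|.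
      rewrite ltNge; apply/negP => H.
      have := @ge0_ler_powR R q (ltW q0) _ _ _ _ H; rewrite -powRrM qq powRr1 ?(ltW hg)//.
      rewrite !nnegrE powR_ge0 normr_ge0 => /(_ isT isT); rewrite -/(g s x); lra.
    have cs := cG s x s0 sx xT.
    have d0 : 0 < `|G s x| - (g s x - h) `^ q^-1 by lra.
    have N1 : \forall r \near s^'+, `|G s x - G r x| < `|G s x| - (g s x - h) `^ q^-1.
      by move/cvgrPdist_lt: cs; apply.
    have N2 : \forall r \near s^'+, r < x by exact: nbhs_right_lt.
    have N3 : \forall r \near s^'+, s < r by exact: nbhs_right_gt.
    have [r [Hr1 [Hr2 Hr3]]] := @filter_ex _ s^'+ _ _ (filterI N1 (filterI N2 N3)).
    exists r => //; split=> //.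
    have h1 : (g s x - h) `^ q^-1 <= `|G r x|.
      have := ler_normD (G s x - G r x) (G r x); rewrite subrK; rewrite /= in Hr1; lra.
    have := @ge0_ler_powR R q (ltW q0) _ _ _ _ h1; rewrite -powRrM qq powRr1 ?(ltW hg)//.
    by apply; rewrite nnegrE ?powR_ge0.
  exists r => //; split; first lra.
  have Hr' : itv_partition r T (x :: pi).
    by case: Hpi => /= /andP[_ h1] h2; split => //=; rewrite rx.
  have := Ule r _ ltac:(lra) ltac:(lra) Hr' => /= Hr2.
  rewrite -mulrBl ler_pdivrMr//; move: Hx; rewrite /h in Hr *; lra.
- by rewrite UT subr0 ler_pdivrMr// mul1r UM// ltW.
- move=> u v u0 uv vT.
  have -> : (U 0 - U v) / M `^ q - (U 0 - U u) / M `^ q = (U u - U v) / M `^ q.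
    by rewrite -mulrBl; congr (_ / _); ring.
  have h1 := UD u v u0 uv vT.
  have gu : 0 <= g u v by exact: powR_ge0.
  have h2 : M * ((U u - U v) / M `^ q) `^ q^-1 = (U u - U v) `^ q^-1.
    rewrite powRM; [|lra|by rewrite invr_ge0 ltW].
    have -> : (M `^ q)^-1 `^ q^-1 = M^-1.
      rewrite -powR_inv1 ?(ltW Mq)// -!powRrM.
      have -> : q * (-1 * q^-1) = -1 by rewrite mulN1r mulrN mulrC qq.
      by rewrite powR_inv1// ltW.
    by rewrite mulrCA mulfV ?mulr1// gt_eqF.
  rewrite h2.
  have -> : `|G u v| = g u v `^ q^-1 by rewrite /g -powRrM mulrC qq powRr1.
  by apply: ge0_ler_powR; rewrite ?nnegrE ?invr_ge0 ?(ltW q0)//; lra.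
Qed.

End VariationControl.

Section ControlBounds.
Context {R : realType}.
Implicit Types (p T : R) (W : R -> R).

Definition sub_control T W W1 : Prop :=
  forall u v, 0 <= u -> u <= v -> v <= T -> W v - W u <= W1 v - W1 u.

Lemma is_controlD T W W1 : is_control T W -> is_control T W1 ->
  is_control T (fun t => W t + W1 t).
Proof.
move=> [W0 mW rW] [W10 mW1 rW1]; split; first by rewrite W0 W10 addr0.
  by move=> s t s0 st tT; apply: lerD; [exact: mW|exact: mW1].
move=> s eta s0 sT eta0.
have [r sr [rT Hr]] := rW s (eta / 2) s0 sT ltac:(lra).
have [r1 sr1 [r1T Hr1]] := rW1 s (eta / 2) s0 sT ltac:(lra).
have [rr|rr] := leP r r1.
  exists r => //; split=> //; have := mW1 r r1 ltac:(lra) rr r1T; lra.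
exists r1 => //; split=> //; have := mW r1 r ltac:(lra) (ltW rr) rT; lra.
Qed.

Lemma sub_controlDl T W W1 : is_control T W1 -> sub_control T W (fun t => W t + W1 t).
Proof. by move=> [_ mW1 _] u v u0 uv vT; have := mW1 u v u0 uv vT; lra. Qed.

Lemma sub_controlDr T W W1 W2 : is_control T W1 -> sub_control T W W2 ->
  sub_control T W (fun t => W1 t + W2 t).
Proof.
move=> [_ mW1 _] sW u v u0 uv vT; have := mW1 u v u0 uv vT; have := sW u v u0 uv vT; lra.
Qed.

(** Couples a control of bounded mass with stability under enlarging the control, so that several
    paths can share the sum of their controls. *)
Definition control_property T (B : R) (P : (R -> R) -> Prop) : Prop :=
  (forall W W1, is_control T W -> is_control T W1 -> sub_control T W W1 -> P W -> P W1) /\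
  exists W, [/\ is_control T W, W T <= B & P W].

Lemma control_propertyI T B B1 (P Q : (R -> R) -> Prop) :
  control_property T B P -> control_property T B1 Q ->
  control_property T (B + B1) (fun W => P W /\ Q W).
Proof.
move=> [HP [W [cW WB PW]]] [HQ [W1 [cW1 W1B QW]]]; split.
  by move=> V V1 cV cV1 sV [PV QV]; split; [exact: HP PV|exact: HQ QV].
have cD := is_controlD cW cW1.
exists (fun t => W t + W1 t); split=> //; first exact: lerD.
split; first exact: HP cW cD (sub_controlDl W cW1) PW.
by apply: HQ cW1 cD _ QW; apply: sub_controlDr.
Qed.

Lemma hw_sub p T W W1 u v : 2 < p -> is_control T W -> sub_control T W W1 ->
  0 <= u -> u <= v -> v <= T -> hw p W u v <= hw p W1 u v.
Proof.
move=> p2 [_ mW _] sW u0 uv vT; have := mW u v u0 uv vT; have := sW u v u0 uv vT => h1 h2.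
by apply: ge0_ler_powR; rewrite ?nnegrE ?invr_ge0; lra.
Qed.

Lemma hw_sqrE p W u v : 2 < p -> W u <= W v -> hw p W u v ^+ 2 = (W v - W u) `^ (p / 2)^-1.
Proof. by move=> p2 Wuv; rewrite hw_exp// invf_div. Qed.

Lemma hw_mass p T W B u v : 2 < p -> is_control T W -> W T <= B -> 1 <= B ->
  0 <= u -> u <= v -> v <= T -> hw p W u v <= B.
Proof.
move=> p2 cW WB B1 u0 uv vT; case: (cW) => W0 mW _.
have h1 := mW 0 u (lexx 0) u0 ltac:(lra); have h2 := mW v T ltac:(lra) vT (lexx T).
have h3 := mW u v u0 uv vT.
apply: (@le_trans _ _ (B `^ p^-1)).
  by apply: ge0_ler_powR; rewrite ?nnegrE ?invr_ge0; lra.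
by apply: ler1_powR => //; rewrite invf_le1; lra.
Qed.

Lemma ctl_bd_control p T d m (X : R -> 'rV[R]_d) W W1 a b r (Y : R -> 'rV[R]_m) Y' :
  2 < p -> 0 <= b -> 0 <= r -> is_control T W -> sub_control T W W1 ->
  ctl_bd p W X `[0, T] a b r Y Y' -> ctl_bd p W1 X `[0, T] a b r Y Y'.
Proof.
move=> p2 b0 r0 cW sW HY u v Du Dv uv; have [A1 A2 A3 A4] := HY u v Du Dv uv.
have h0 : hw p W u v <= hw p W1 u v.
  by move: Du Dv; rewrite /= !in_itv /= => /andP[u0 _] /andP[_ vT]; apply: (hw_sub p2 cW sW).
split => //; first by apply: (le_trans A3); exact: ler_wpM2l.
by apply: (le_trans A4); apply: ler_wpM2l => //; rewrite lerXn2r// nnegrE hw_ge0.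
Qed.

Lemma holder_rough_control c p T d (X : R -> 'rV[R]_d) XX W W1 :
  0 <= c -> is_control T W1 -> sub_control T W W1 ->
  holder_rough c p T W X XX -> holder_rough c p T W1 X XX.
Proof.
move=> c0 cW1 sW [hp hT cW hX hXX hC]; split => // u v u0 uv vT.
  by apply: (le_trans (hX u v u0 uv vT)); apply: ler_wpM2l => //; apply: hw_sub cW _ _ _ _ => //; case: hp.
apply: (le_trans (hXX u v u0 uv vT)); apply: ler_wpM2l => //.
by rewrite lerXn2r// ?nnegrE ?hw_ge0//; apply: hw_sub cW _ _ _ _ => //; case: hp.
Qed.

Lemma holder_rough_le c c1 p T d (X : R -> 'rV[R]_d) XX W : c <= c1 ->
  holder_rough c p T W X XX -> holder_rough c1 p T W X XX.
Proof.
move=> cc [hp hT cW hX hXX hC]; split => // u v u0 uv vT.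
  by apply: (le_trans (hX u v u0 uv vT)); rewrite ler_wpM2r ?hw_ge0.
by apply: (le_trans (hXX u v u0 uv vT)); rewrite ler_wpM2r ?exprn_ge0 ?hw_ge0.
Qed.

End ControlBounds.

Section VariationPairs.
Context {R : realType}.
Variables (p T : R).
Hypotheses (p2 : 2 < p) (T0 : 0 < T).

Lemma variation_pair (V1 V2 : normedModType R) (G1 : R -> R -> V1) (G2 : R -> R -> V2) (M : R) :
  0 < M -> (forall u, 0 <= u -> u <= T -> G1 u u = 0) -> (forall u, 0 <= u -> u <= T -> G2 u u = 0) ->
  (forall s x, 0 <= s -> s < x -> x <= T -> G1 r x @[r --> s^'+] --> G1 s x) ->
  (forall s x, 0 <= s -> s < x -> x <= T -> G2 r x @[r --> s^'+] --> G2 s x) ->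
  (var2 T p G1 <= M%:E)%E -> (var2 T (p / 2) G2 <= M%:E)%E ->
  exists W, [/\ is_control T W, W T <= 2 & forall u v, 0 <= u -> u <= v -> v <= T ->
    `|G1 u v| <= M * hw p W u v /\ `|G2 u v| <= M * hw p W u v ^+ 2].
Proof.
move=> M0 G10 G20 c1 c2 H1 H2.
have [|W1 [cW1 W1T HW1]] := variation_control T0 _ M0 G10 H1 c1; first by have := p2; lra.
have [|W2 [cW2 W2T HW2]] := variation_control T0 _ M0 G20 H2 c2; first by have := p2; lra.
have cD := is_controlD cW1 cW2.
exists (fun t => W1 t + W2 t); split => //; first lra.
move=> u v u0 uv vT; split.
  apply: (le_trans (HW1 u v u0 uv vT)); apply: ler_wpM2l; first exact: ltW.
  by apply: (hw_sub p2 cW1) => //; exact: sub_controlDl.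
apply: (le_trans (HW2 u v u0 uv vT)); apply: ler_wpM2l; first exact: ltW.
rewrite -hw_sqrE//; last by case: cW2 => _ mW _; apply: mW.
rewrite lerXn2r// ?nnegrE ?hw_ge0//.
by apply: (hw_sub p2 cW2) => //; apply: sub_controlDr => // a b; lra.
Qed.

Lemma lee_sum_parts (x y : \bar R) (M : R) : (0 <= x)%E -> (0 <= y)%E -> (x + y <= M%:E)%E ->
  (x <= M%:E)%E /\ (y <= M%:E)%E.
Proof.
move=> x0 y0 H; split; apply: le_trans H; first exact: leeDl.
exact: leeDr.
Qed.

Lemma rough_path_holder d (X : R -> 'rV[R]_d) XX (M : R) : p < 3 -> 0 < M ->
  rough_path T p X XX -> (rough_norm T p X XX <= M%:E)%E ->
  exists W, [/\ is_control T W, W T <= 2 & holder_rough M p T W X XX].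
Proof.
move=> p3 M0 [[cX _] [_ cXX _] chen] H.
have [H1 H2] := lee_sum_parts (var2_ge0 _ _ _) (var2_ge0 _ _ _) H.
have XX0 u : 0 <= u -> u <= T -> XX u u = 0.
  move=> u0 uT; have := chen u u u u0 (lexx u) (lexx u) uT.
  have -> : tensor (incr X u u) (incr X u u) = 0 by rewrite /incr subrr /tensor mulmx0.
  rewrite addr0 => E; have : XX u u - XX u u = XX u u + XX u u - XX u u by rewrite -E.
  by rewrite subrr addrK.
have [|||W [cW WT HW]] := variation_pair M0 _ XX0 _ _ H1 H2.
- by move=> u _ _; rewrite /incr subrr.
- move=> s x s0 sx xT; apply: cvgB; first exact: cvg_cst.
  by case: cX => cX _; apply: cX; rewrite s0/=; lra.
- move=> s x s0 sx xT; have [|H3 _] := cXX x; first by apply/andP; split; lra.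
  by apply: H3; rewrite s0.
exists W; split => //; split => // u v u0 uv vT; by case: (HW u v u0 uv vT).
Qed.

Section OnePath.
Variables (d m : nat) (X : R -> 'rV[R]_d) (Y : R -> 'rV[R]_m) (Y' : R -> linmx R d 1 m).

Lemma ctrl_norm_ctl_bd (M : R) : 0 < M ->
  (forall s, 0 <= s -> s < T -> Y' r @[r --> s^'+] --> Y' s) ->
  (forall s x, 0 <= s -> s < x -> x <= T ->
     remainder X Y Y' r x @[r --> s^'+] --> remainder X Y Y' s x) ->
  (ctrl_norm T p X Y Y' <= M%:E)%E ->
  exists W, [/\ is_control T W, W T <= 2 & ctl_bd p W X `[0, T] (3 * M) M M Y Y'].
Proof.
move=> M0 cY' cR H.
have N0 : (0 <= `|Y' 0|%:E)%E by rewrite lee_fin.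
have [H12 H3] := lee_sum_parts (adde_ge0 N0 (var2_ge0 _ _ _)) (var2_ge0 _ _ _) H.
have [H1 H2] := lee_sum_parts N0 (var2_ge0 _ _ _) H12.
have [|||W [cW WT HW]] := variation_pair M0 _ _ _ cR H2 H3.
- by move=> u _ _; rewrite /incr subrr.
- by move=> u _ _; rewrite /remainder /incr !subrr lapp0r subr0.
- move=> s x s0 sx xT; apply: cvgB; first exact: cvg_cst.
  by apply: cY' => //; lra.
exists W; split => //.
(* At most [M] for [Y' 0], plus an increment of at most [M * hw], where [hw] is bounded by the mass
   2. *)
have Y'M u : 0 <= u -> u <= T -> `|Y' u| <= 3 * M.
  move=> u0 uT; have [h1 _] := HW 0 u (lexx 0) u0 uT.
  have h2 : M * hw p W 0 u <= M * 2.
    by apply: ler_wpM2l; [exact: ltW|apply: (hw_mass p2 cW WT) => //; lra].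
  have -> : Y' u = Y' 0 + incr Y' 0 u by rewrite /incr; mxring.
  by apply: (le_trans (ler_normD _ _)); rewrite lee_fin in H1; lra.
move=> u v; rewrite /= !in_itv /= => /andP[u0 uT] /andP[v0 vT] uv.
by have [h1 h2] := HW u v u0 uv vT; split => //; exact: Y'M.
Qed.

Lemma ctl_bd_ctrl_norm (W : R -> R) (a b r B : R) : 0 <= b -> 0 <= r -> is_control T W ->
  W T <= B -> 1 <= B -> ctl_bd p W X `[0, T] a b r Y Y' ->
  (ctrl_norm T p X Y Y' <= (a + b * B + r * B)%:E)%E.
Proof.
move=> b0 r0 cW WB B1 HY; case: (cW) => W0 mW _.
have D u : 0 <= u -> u <= T -> `[0, T]%classic u by move=> u0 uT; rewrite /= in_itv /= u0.
have WT0 : 0 <= W T by rewrite -W0; apply: mW => //; exact: ltW.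
have mass q : 1 <= q -> W T `^ q^-1 <= B.
  move=> q1; apply: (@le_trans _ _ (B `^ q^-1)).
    by apply: ge0_ler_powR; rewrite ?nnegrE ?invr_ge0; lra.
  by apply: ler1_powR => //; rewrite invf_le1; lra.
have q1 : 1 <= p by have := p2; lra.
have q2 : 1 <= p / 2 by have := p2; lra.
rewrite !EFinD; apply: leeD; first apply: leeD.
- by rewrite lee_fin; case: (HY 0 0 (D 0 (lexx 0) (ltW T0)) (D 0 (lexx 0) (ltW T0)) (lexx 0)).
- apply: (@le_trans _ _ (b * W T `^ p^-1)%:E); last by rewrite lee_fin ler_wpM2l// mass.
  apply: var2_le_control => //; first lra.
  move=> u v u0 uv vT.
  by have [||//|_ _ h _] := HY u v; [apply: D => //; lra|apply: D => //; lra|exact: h].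
- apply: (@le_trans _ _ (r * W T `^ (p / 2)^-1)%:E); last by rewrite lee_fin ler_wpM2l// mass.
  apply: var2_le_control => //; first lra.
  move=> u v u0 uv vT; rewrite -hw_sqrE//; last exact: mW.
  by have [||//|_ _ _ h] := HY u v; [apply: D => //; lra|apply: D => //; lra|exact: h].
Qed.

End OnePath.

End VariationPairs.

(** * Recovering cadlag controlled paths from a control *)

Section CadlagControl.
Context {R : realType}.
Variables (p T : R) (W : R -> R).
Hypotheses (p2 : 2 < p) (T0 : 0 < T) (cW : is_control T W).

Lemma hw_small (K eps : R) : 0 <= K -> 0 < eps -> exists2 eta, 0 < eta &
  forall u v, W u <= W v -> W v - W u <= eta -> K * hw p W u v < eps.
Proof.
move=> K0 e0; have p0 : 0 < p by have := p2; lra.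
have k0 : 0 < eps / (K + 1) by rewrite divr_gt0//; lra.
exists ((eps / (K + 1)) `^ p) => [|u v uv H]; first exact: powR_gt0.
have h1 : hw p W u v <= eps / (K + 1).
  apply: (@le_trans _ _ (((eps / (K + 1)) `^ p) `^ p^-1)).
    by apply: ge0_ler_powR => //; rewrite ?nnegrE ?invr_ge0 ?powR_ge0; lra.
  by rewrite -powRrM mulfV ?gt_eqF// powRr1// ltW.
apply: (le_lt_trans (ler_wpM2l K0 h1)).
by rewrite mulrCA gtr_pMr// ltr_pdivrMr; lra.
Qed.

(** Right-continuity is inherited from [W]. For left limits monotonicity of [W] suffices: close to
    [u] from the left [W] is close to its supremum before [u], so the values of [f] are Cauchy. *)
Lemma cadlag_of_control (a b : nat) (f : R -> 'M[R]_(a, b)) (K s t : R) : 0 <= K ->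
  0 <= s -> t <= T ->
  (forall u v, s <= u -> u <= v -> v <= t -> `|f v - f u| <= K * hw p W u v) ->
  cadlag s t f.
Proof.
move=> K0 s0 tT Hf; have [W0 mW rW] := cW; split=> u /andP[su ut].
  apply/cvgrPdist_lt => eps e0; have [eta eta0 Heta] := hw_small K0 e0.
  have [r ur [rT Hr]] := rW u eta ltac:(lra) ltac:(lra) eta0.
  near=> z.
  have uz : u < z by near: z; exact: nbhs_right_gt.
  have zr : z < r by near: z; exact: nbhs_right_lt.
  have zt : z < t by near: z; exact: nbhs_right_lt.
  rewrite distrC; apply: (le_lt_trans (Hf u z su (ltW uz) (ltW zt))).
  apply: Heta; first by apply: mW; lra.
  by have := mW z r ltac:(lra) (ltW zr) rT; lra.
suff c : cauchy (f r @[r --> u^'-]) by have /cauchy_cvg/cvg_ex[l fl] := c; exists l.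
apply: cauchy_exP => eps e0; have [eta eta0 Heta] := hw_small K0 e0.
pose S := [set W r | r in [set r | s <= r < u]].
have hS : has_sup S.
  split; first by exists (W s), s => //=; rewrite lexx.
  exists (W T) => _ [r /= /andP[sr ru] <-]; apply: mW; lra.
have [_ [r0 /= /andP[sr0 r0u] <-] Hr0] := sup_adherent eta0 hS.
exists (f r0).
near=> z.
have zu : z < u by near: z; exact: nbhs_left_lt.
have rz : r0 < z by near: z; exact: nbhs_left_gt.
rewrite -ball_normE /= distrC; apply: (le_lt_trans (Hf r0 z sr0 (ltW rz) ltac:(lra))).
apply: Heta; first by apply: mW; lra.
have : W z <= sup S by apply: sup_upper_bound => //; exists z => //=; lra.
lra.
Unshelve. all: by end_near. Qed.

Variables (d m : nat) (c : R) (X : R -> 'rV[R]_d) (XX : R -> R -> 'M[R]_d).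
Hypotheses (c1 : 1 <= c) (dc : d%:R <= c) (HX : holder_rough c p T W X XX).
Hypothesis hc : forall u v, 0 <= u -> u <= v -> v <= T -> hw p W u v <= c.

Lemma ctl_bd_controlled (a b r : R) (Y : R -> 'rV[R]_m) (Y' : R -> linmx R d 1 m) :
  0 <= b -> 0 <= r -> ctl_bd p W X `[0, T] a b r Y Y' -> controlled T p X Y Y'.
Proof.
move=> b0 r0 HY; have [W0 mW _] := cW; have [C1 Hd] := (c1, dc).
have D u : 0 <= u -> u <= T -> `[0, T]%classic u by move=> u0 uT; rewrite /= in_itv /= u0.
have a0 : 0 <= a.
  have [h _ _ _] := HY 0 0 (D 0 (lexx 0) (ltW T0)) (D 0 (lexx 0) (ltW T0)) (lexx 0).
  exact: le_trans h.
pose K := c ^+ 2 * a + r * c.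
have K0 : 0 <= K by rewrite /K addr_ge0// mulr_ge0// ?sqr_ge0//; lra.
have YK u v : 0 <= u -> u <= v -> v <= T -> `|Y v - Y u| <= K * hw p W u v.
  move=> u0 uv vT; have [||//|A1 _ _ A4] := HY u v; [apply: D; lra|apply: D; lra|].
  apply: (le_trans (incr_norm c1 dc HX u0 uv vT r0 A1 A4)).
  apply: ler_wpM2r; first exact: hw_ge0.
  by rewrite lerD2l ler_wpM2l// hc.
have Y'b u v : 0 <= u -> u <= v -> v <= T -> `|Y' v - Y' u| <= b * hw p W u v.
  by move=> u0 uv vT; have [||//|] := HY u v; [apply: D; lra|apply: D; lra|].
have Rr u v : 0 <= u -> u <= v -> v <= T -> `|remainder X Y Y' u v| <= r * hw p W u v ^+ 2.
  by move=> u0 uv vT; have [||//|] := HY u v; [apply: D; lra|apply: D; lra|].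
have Y'a u : 0 <= u -> u <= T -> `|Y' u| <= a.
  by move=> u0 uT; have [||//|] := HY u u; [apply: D; lra|apply: D; lra|].
have fin q n1 n2 (G : R -> R -> 'M[R]_(n1, n2)) B : 1 <= q -> 0 <= B ->
    (forall u v, 0 <= u -> u <= v -> v <= T -> `|G u v| <= B * (W v - W u) `^ q^-1) ->
    (var2 T q G < +oo)%E.
  move=> q1 B0 HG; have := var2_le_control T0 _ B0 cW HG => /(_ ltac:(lra)) h.
  by apply: le_lt_trans h _; rewrite ltry.
have q1 : 1 <= p by have := p2; lra.
have q2 : 1 <= p / 2 by have := p2; lra.
split.
- split; last exact: (fin _ _ _ _ _ q1 K0 YK).
  exact: (cadlag_of_control K0 (lexx 0) (lexx T) YK).
- split; last exact: (fin _ _ _ _ _ q1 b0 Y'b).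
  exact: (cadlag_of_control b0 (lexx 0) (lexx T) Y'b).
- split.
  + apply: (fin _ _ _ _ _ q2 r0) => u v u0 uv vT.
    by rewrite -hw_sqrE//; [exact: Rr|exact: mW].
  (* With one time fixed, the increments of the remainder are only of order [hw] and not of its
     square, which is enough for the cadlag property. *)
  + move=> t /andP[t0 tT]; pose L := K + c ^+ 3 * b + c ^+ 2 * a.
    have L0 : 0 <= L by rewrite /L !addr_ge0// mulr_ge0// ?exprn_ge0//; lra.
    apply: (cadlag_of_control L0 (lexx 0) tT) => u v u0 uv vt.
    have vT : v <= T by lra.
    have -> : remainder X Y Y' v t - remainder X Y Y' u t =
        lapp (Y' u) (incr X u v) - (Y v - Y u) - lapp (Y' v - Y' u) (incr X v t).
      rewrite /remainder lappBl.
      have -> : incr X u t = incr X u v + incr X v t by rewrite /incr; mxring.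
      rewrite (lappDr (Y' u)).
      move: (lapp (Y' v) _) (lapp (Y' u) (incr X u v)) (lapp (Y' u) (incr X v t)) => A1 A2 A3.
      rewrite /incr; mxring.
    have h0 := hw_ge0 p W u v; set h := hw p W u v in h0 *.
    apply: (le_trans (ler_normB _ _)).
    have h1 := le_trans (ler_normB (lapp (Y' u) (incr X u v)) (Y v - Y u))
      (lerD (lapp_norm (Y' u) (incr X u v)) (YK u v u0 uv vT)).
    apply: (le_trans (lerD h1 (lapp_norm (Y' v - Y' u) (incr X v t)))).
    have h2 := Y'b u v u0 uv vT; have h3 := hr_X HX u0 uv vT; have h4 := Y'a u u0 ltac:(lra).
    have h5 : `|incr X v t| <= c * c.
      apply: (le_trans (hr_X HX (le_trans u0 uv) vt tT)); apply: ler_wpM2l; first lra.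
      by apply: hc => //; lra.
    rewrite -/h in h2 h3 *; have C0 : 0 <= c by lra.
    have e1 : d%:R * (`|Y' u| * `|incr X u v|) <= c * (a * (c * h)) by prod_le.
    have e2 : d%:R * (`|Y' v - Y' u| * `|incr X v t|) <= c * ((b * h) * (c * c)) by prod_le.
    rewrite /L; lra.
  + move=> s /andP[s0 sT]; pose L := K + c ^+ 2 * a.
    have L0 : 0 <= L by rewrite /L addr_ge0// mulr_ge0// ?exprn_ge0//; lra.
    apply: (cadlag_of_control L0 s0 (lexx T)) => u v su uv vT.
    have u0 : 0 <= u by lra.
    have -> : remainder X Y Y' s v - remainder X Y Y' s u =
        (Y v - Y u) - lapp (Y' s) (incr X u v).
      rewrite /remainder.
      have -> : incr X s v = incr X s u + incr X u v by rewrite /incr; mxring.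
      rewrite (lappDr (Y' s)).
      move: (lapp (Y' s) (incr X s u)) (lapp (Y' s) (incr X u v)) => A1 A2.
      rewrite /incr; mxring.
    apply: (le_trans (ler_normB _ _)).
    apply: (le_trans (lerD (YK u v u0 uv vT) (lapp_norm (Y' s) (incr X u v)))).
    have h0 := hw_ge0 p W u v; set h := hw p W u v in h0 *.
    have h3 := hr_X HX u0 uv vT; have h4 := Y'a s s0 sT.
    rewrite -/h in h3 *; have C0 : 0 <= c by lra.
    have e1 : d%:R * (`|Y' s| * `|incr X u v|) <= c * (a * (c * h)) by prod_le.
    rewrite /L; lra.
Qed.

End CadlagControl.

Section ControlledPaths.
Context {R : realType}.
Variables (d m : nat) (T p : R) (X : R -> 'rV[R]_d).
Hypotheses (p2 : 2 < p) (T0 : 0 < T).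

Lemma controlled_cvg_deriv (Y : R -> 'rV[R]_m) Y' s : controlled T p X Y Y' ->
  0 <= s -> s < T -> Y' r @[r --> s^'+] --> Y' s.
Proof. by move=> [_ [[c _] _] _] s0 sT; apply: c; rewrite s0. Qed.

Lemma controlled_cvg_rem (Y : R -> 'rV[R]_m) Y' s x : controlled T p X Y Y' ->
  0 <= s -> s < x -> x <= T -> remainder X Y Y' r x @[r --> s^'+] --> remainder X Y Y' s x.
Proof.
move=> [_ _ [_ c _]] s0 sx xT; have [|c1 _] := c x; first by apply/andP; split; lra.
by apply: c1; rewrite s0.
Qed.

Lemma ctrl_norm_ge0 (Y : R -> 'rV[R]_m) Y' : (0 <= ctrl_norm T p X Y Y')%E.
Proof. by rewrite /ctrl_norm !adde_ge0// ?lee_fin// var2_ge0. Qed.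

Lemma ctrl_norm_fin (Y : R -> 'rV[R]_m) Y' : controlled T p X Y Y' ->
  ctrl_norm T p X Y Y' \is a fin_num.
Proof.
move=> [_ [_ h1] [h2 _ _]]; rewrite ge0_fin_numE ?ctrl_norm_ge0//.
by rewrite /ctrl_norm !lte_add_pinfty// ltry.
Qed.

Lemma ctrl_dist_norm (Y Z : R -> 'rV[R]_m) Y' Z' :
  ctrl_dist T p X Y Y' Z Z' = ctrl_norm T p X (fun t => Y t - Z t) (fun t => Y' t - Z' t).
Proof.
rewrite /ctrl_dist; have -> : (fun s t => remainder X Y Y' s t - remainder X Z Z' s t) =
    remainder X (fun t => Y t - Z t) (fun t => Y' t - Z' t).
  by apply/funext => s; apply/funext => t; rewrite remainderB.
by [].
Qed.

Lemma controlled_bd (M : R) (Y : R -> 'rV[R]_m) Y' : 0 < M -> controlled T p X Y Y' ->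
  (ctrl_norm T p X Y Y' <= M%:E)%E ->
  exists W, [/\ is_control T W, W T <= 2 & ctl_bd p W X `[0, T] (3 * M) M M Y Y'].
Proof.
move=> M0 cY; apply: ctrl_norm_ctl_bd => //.
  by move=> s s0 sT; exact: (controlled_cvg_deriv cY s0 sT).
by move=> s x s0 sx xT; exact: (controlled_cvg_rem cY s0 sx xT).
Qed.

Lemma controlled_diff_bd (M : R) (Y Z : R -> 'rV[R]_m) Y' Z' : 0 < M ->
  controlled T p X Y Y' -> controlled T p X Z Z' ->
  (ctrl_dist T p X Y Y' Z Z' <= M%:E)%E ->
  exists W, [/\ is_control T W, W T <= 2 &
    ctl_bd p W X `[0, T] (3 * M) M M (fun t => Y t - Z t) (fun t => Y' t - Z' t)].
Proof.
move=> M0 cY cZ; rewrite ctrl_dist_norm; apply: ctrl_norm_ctl_bd => //.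
  by move=> s s0 sT; apply: cvgB; [exact: controlled_cvg_deriv cY _ _|exact: controlled_cvg_deriv cZ _ _].
move=> s x s0 sx xT; rewrite remainderB.
under eq_fun do rewrite remainderB.
by apply: cvgB; [exact: controlled_cvg_rem cY _ _ _|exact: controlled_cvg_rem cZ _ _ _].
Qed.

End ControlledPaths.

Section SmoothBounds.
Context {R : realType}.
Variable n : nat.

Lemma supnorm_ge0 a b (f : 'rV[R]_n -> 'M[R]_(a, b)) : (0 <= supnorm f)%E.
Proof.
apply: (@le_trans _ _ (`|f 0|)%:E); first by rewrite lee_fin.
by apply: ereal_sup_ubound; exists 0.
Qed.

Lemma supnorm_le a b (f : 'rV[R]_n -> 'M[R]_(a, b)) F x : (supnorm f <= F%:E)%E -> `|f x| <= F.
Proof.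
move=> H; rewrite -lee_fin; apply: le_trans H.
by apply: ereal_sup_ubound; exists x.
Qed.

Lemma Cbnorm_ge0 j a b (f : 'rV[R]_n -> 'M[R]_(a, b)) : (0 <= Cbnorm j f)%E.
Proof.
by elim: j a b f => [|j IH] a b f /=; rewrite ?adde_ge0// supnorm_ge0.
Qed.

Lemma Cbnorm_fin j a b (f : 'rV[R]_n -> 'M[R]_(a, b)) : Cb j f -> Cbnorm j f \is a fin_num.
Proof.
move=> H; rewrite ge0_fin_numE ?Cbnorm_ge0//.
elim: j a b f H => [|j IH] a b f /=; first by case.
by case=> _ h [_ /IH h2]; rewrite lte_add_pinfty.
Qed.

Lemma CbW j a b (f : 'rV[R]_n -> 'M[R]_(a, b)) : Cb j.+1 f -> Cb j f.
Proof.
elim: j a b f => [|j IH] a b f; first by case=> ? ? _; split.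
by case=> c h [df Df]; split => //; split => //; apply: IH.
Qed.

Lemma C1bd_supnorm a b (f : 'rV[R]_n -> 'M[R]_(a, b)) F : (forall x, differentiable f x) ->
  (supnorm f <= F%:E)%E -> (supnorm (frechet f) <= F%:E)%E -> C1bd F f (frechet f).
Proof.
move=> df h1 h2; split => [x h t|x|x]; [exact: is_derive_line|exact: supnorm_le|exact: supnorm_le].
Qed.

Lemma C2bd_Cb a b (f : 'rV[R]_n -> 'M[R]_(a, b)) F : Cb 2 f -> (Cbnorm 2 f <= F%:E)%E ->
  C2bd F f (frechet f) (frechet (frechet f)).
Proof.
move=> [_ _ [df [_ _ [d2f _]]]] /= H.
have [H0 H12] := lee_sum_parts (supnorm_ge0 _) (adde_ge0 (supnorm_ge0 _) (supnorm_ge0 _)) H.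
have [H1 H2] := lee_sum_parts (supnorm_ge0 _) (supnorm_ge0 _) H12.
by split; apply: C1bd_supnorm.
Qed.

Lemma C3bd_Cb a b (f : 'rV[R]_n -> 'M[R]_(a, b)) F : Cb 3 f -> (Cbnorm 3 f <= F%:E)%E ->
  C3bd F f (frechet f) (frechet (frechet f)) (frechet (frechet (frechet f))).
Proof.
move=> [_ _ [df Df]] H.
have [H0 H1] := lee_sum_parts (supnorm_ge0 _) (Cbnorm_ge0 2 (frechet f)) H.
have D2 := C2bd_Cb Df H1.
split => //; apply: C1bd_supnorm => //.
by move: H1 => /lee_sum_parts; case => //; rewrite ?adde_ge0 ?supnorm_ge0.
Qed.

Lemma mklinB a b (g g1 g2 : 'rV[R]_n -> 'M[R]_(a, b)) : (forall h, g h = g1 h - g2 h) ->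
  mklin g = mklin g1 - mklin g2.
Proof.
move=> H; rewrite /mklin; apply/matrixP => i j; rewrite !mxE H.
by rewrite raddfB !mxE.
Qed.

Lemma frechetB a b (f g : 'rV[R]_n -> 'M[R]_(a, b)) : (forall x, differentiable f x) ->
  (forall x, differentiable g x) ->
  frechet (fun x => f x - g x) = (fun x => frechet f x - frechet g x).
Proof.
move=> df dg; apply/funext => x; rewrite /frechet.
apply: (mklinB (g := 'd (fun x => f x - g x) x) (g1 := 'd f x) (g2 := 'd g x)) => h.
have H : 'd (fun x => f x - g x) x = ('d f x \- 'd g x) :> (_ -> _).
  exact: (diffB (df x) (dg x)).
exact: (congr1 (fun F : 'rV[R]_n -> 'M[R]_(a, b) => F h) H).
Qed.

Lemma C1bdB_supnorm a b (f g : 'rV[R]_n -> 'M[R]_(a, b)) F : (forall x, differentiable f x) ->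
  (forall x, differentiable g x) -> (supnorm (fun x => (f x - g x)%R) <= F%:E)%E ->
  (supnorm (fun x => (frechet f x - frechet g x)%R) <= F%:E)%E ->
  C1bd F (fun x => f x - g x) (fun x => frechet f x - frechet g x).
Proof.
move=> df dg h1 h2; split => [x h t|x|x].
- rewrite lappBl; exact: is_deriveB (is_derive_line _ _ _ df) (is_derive_line _ _ _ dg).
- exact: supnorm_le x h1.
- exact: supnorm_le x h2.
Qed.

Lemma C2bd_CbB a b (f g : 'rV[R]_n -> 'M[R]_(a, b)) F : Cb 2 f -> Cb 2 g ->
  (Cbnorm 2 (fun x => (f x - g x)%R) <= F%:E)%E ->
  C2bd F (fun x => f x - g x) (fun x => frechet f x - frechet g x)
    (fun x => frechet (frechet f) x - frechet (frechet g) x).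
Proof.
move=> [_ _ [df [_ _ [d2f _]]]] [_ _ [dg [_ _ [d2g _]]]] /= H.
have [H0 H12] := lee_sum_parts (supnorm_ge0 _) (adde_ge0 (supnorm_ge0 _) (supnorm_ge0 _)) H.
have [H1 H2] := lee_sum_parts (supnorm_ge0 _) (supnorm_ge0 _) H12.
move: H1 H2; rewrite (frechetB df dg) (frechetB d2f d2g) => H1 H2.
by split; apply: C1bdB_supnorm.
Qed.

End SmoothBounds.

(** * Constants uniform in the data *)

Section UniformPieces.
Context {R : realType}.

(** [N] and [eps] are chosen before [p], [T] and [W]. Oscillation of [W] at most [eps ^+ 3] gives
    [hw <= eps] for every [p < 3], because [eps <= 1]. *)
Lemma uniform_pieces (B L : R) : 1 <= L -> 0 <= B -> exists (N : nat) (eps : R),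
  [/\ 0 <= eps, L * eps <= 1 & forall p T W, 2 < p -> p < 3 -> 0 < T -> is_control T W ->
    W T <= B -> exists tau : nat -> R, [/\ tau 0%N = 0, tau N.+1 = T,
      (forall i, tau i <= tau i.+1), (forall i, 0 <= tau i <= T) &
      (forall i u v, tau i <= u -> u <= v -> v < tau i.+1 -> hw p W u v <= eps)]].
Proof.
move=> L1 B0; pose eps := L^-1.
have e0 : 0 < eps by rewrite invr_gt0; lra.
have e1 : eps <= 1 by rewrite invf_le1; lra.
have eta0 : 0 < eps ^+ 3 by rewrite exprn_gt0.
exists (Num.truncn (B / eps ^+ 3)), eps; split; first exact: ltW.
  by rewrite mulfV// gt_eqF//; lra.
move=> p T W p2 p3 T0 cW WB; have [_ mW _] := cW.
have [|tau [t0 tN tm tT Ht]] := @control_pieces R T W T0 cW _ (Num.truncn (B / eps ^+ 3)).+1 eta0.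
  by apply: (le_lt_trans WB); rewrite -ltr_pdivrMr// truncnS_gt.
exists tau; split => // i u v tu uv vt.
have h1 := Ht i v ltac:(lra) vt.
have /andP[ti0 tiT] := tT i; have /andP[_ tjT] := tT i.+1.
have h2 := mW (tau i) u ti0 tu ltac:(lra); have h3 := mW u v ltac:(lra) uv ltac:(lra).
apply: (@le_trans _ _ ((eps ^+ 3) `^ p^-1)).
  by apply: ge0_ler_powR; rewrite ?nnegrE ?invr_ge0; lra.
rewrite -powR_mulrn ?(ltW e0)// -powRrM.
apply: ge1r_powR; first by rewrite e0.
by rewrite ler_pdivlMr; lra.
Qed.

(** Bounds the sewing constant on a whole neighbourhood of an exponent by its value at a larger one
    still below 3. *)
Lemma sew_const_le (p q : R) : 2 < p -> p <= q -> q < 3 -> sew_const (3 / p) <= sew_const (3 / q).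
Proof.
move=> p2 pq q3.
have k1 : 1 < 3 / q by rewrite ltr_pdivlMr; lra.
have h1 := half_powR_lt k1.
have h2 : 2^-1 `^ (3 / p) <= (2^-1 : R) `^ (3 / q).
  apply: ger_powR; first by rewrite invr_gt0 invf_le1; lra.
  by rewrite ler_wpM2l// lef_pV2 ?posrE; lra.
rewrite /sew_const ler_wpM2l// lef_pV2 ?posrE; lra.
Qed.

End UniformPieces.

Section UniformBounds.
Context {R : realType}.
Variables (d e k : nat).

Lemma rough_path_property (p T M : R) (X : R -> 'rV[R]_d) XX : 2 < p -> p < 3 -> 0 < T -> 0 < M ->
  rough_path T p X XX -> (rough_norm T p X XX <= M%:E)%E ->
  control_property T 2 (fun W => holder_rough M p T W X XX).
Proof.
move=> p2 p3 T0 M0 rX nX; split; last exact: rough_path_holder.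
by move=> W W1 cW cW1 sW; apply: holder_rough_control => //; exact: ltW.
Qed.

Lemma controlled_property m (p T M : R) (X : R -> 'rV[R]_d) (Y : R -> 'rV[R]_m) Y' : 2 < p -> 0 < T -> 0 < M ->
  controlled T p X Y Y' -> (ctrl_norm T p X Y Y' <= M%:E)%E ->
  control_property T 2 (fun W => ctl_bd p W X `[0, T] (3 * M) M M Y Y').
Proof.
move=> p2 T0 M0 cY nY; split; last exact: controlled_bd.
by move=> W W1 cW cW1 sW; apply: ctl_bd_control => //; exact: ltW.
Qed.

Lemma controlled_diff_property m (p T M : R) (X : R -> 'rV[R]_d) (Y Z : R -> 'rV[R]_m) Y' Z' :
  2 < p -> 0 < T -> 0 < M ->
  controlled T p X Y Y' -> controlled T p X Z Z' -> (ctrl_dist T p X Y Y' Z Z' <= M%:E)%E ->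
  control_property T 2 (fun W =>
    ctl_bd p W X `[0, T] (3 * M) M M (fun t => Y t - Z t) (fun t => Y' t - Z' t)).
Proof.
move=> p2 T0 M0 cY cZ nY; split; last exact: controlled_diff_bd.
by move=> W W1 cW cW1 sW; apply: ctl_bd_control => //; exact: ltW.
Qed.

Lemma rde_solution_sol_map (p T : R) (X : R -> 'rV[R]_d) XX (f : 'rV[R]_(e + k) -> linmx R d 1 k)
    y y' alpha alpha' Y Y' :
  rde_solution T p X XX f y y' alpha alpha' Y Y' <->
  controlled T p X Y Y' /\ sol_map T X XX f (frechet f) alpha alpha' y y' Y Y' Y Y'.
Proof.
have E : fpath' f alpha alpha' Y Y' = (fun u => joint' alpha' Y' u *m frechet f (joint alpha Y u)).
  by apply/funext => u; rewrite fpath'E.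
split=> [[cY H1 H2]|[cY H]].
  split => // t t0 tT; have t0T : 0 <= t <= T by rewrite t0.
  by split; [exact: H1|rewrite -E; exact: H2].
by split => // t /andP[t0 tT]; have [h1 h2] := H t t0 tT; rewrite ?E.
Qed.

Lemma sol_map_start (T : R) (X : R -> 'rV[R]_d) XX (f : 'rV[R]_(e + k) -> linmx R d 1 k) Df
    y y' alpha alpha' Y Y' U U' : 0 < T ->
  sol_map T X XX f Df alpha alpha' y y' Y Y' U U' -> U 0 = y 0.
Proof.
move=> T0 H; have [_ /rough_integral0 h] := H 0 (lexx 0) (ltW T0).
by apply/eqP; rewrite -subr_eq0 h.
Qed.

Lemma apriori_uniform (c : R) : 1 <= c -> d%:R <= c -> (e + k)%:R <= c ->
  exists2 M : R, 0 <= M & forall (p T : R) (X : R -> 'rV[R]_d) XX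
    (f : 'rV[R]_(e + k) -> linmx R d 1 k) y y' alpha alpha' Y Y',
  2 < p -> p < 3 -> sew_const (3 / p) <= c -> 0 < T -> rough_path T p X XX ->
  (rough_norm T p X XX <= c%:E)%E ->
  controlled T p X y y' -> (ctrl_norm T p X y y' <= c%:E)%E ->
  controlled T p X alpha alpha' -> (ctrl_norm T p X alpha alpha' <= c%:E)%E ->
  Cb 2 f -> (Cbnorm 2 f <= c%:E)%E ->
  rde_solution T p X XX f y y' alpha alpha' Y Y' -> (ctrl_norm T p X Y Y' <= M%:E)%E.
Proof.
(* Four controls of mass at most 2 are added below. *)
move=> c1 dc nc; pose C := 8 * c.
have C1 : 1 <= C by rewrite /C; lra.
have L1 : 1 <= 8 * base_const C by have := base_const_ge1 C1; lra.
have [N [eps [eps0 Heps Hpieces]]] := uniform_pieces L1 (le_trans ler01 C1).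
pose G := global_const C N.
exists (`|2 * C + G * C + G * C|); first exact: normr_ge0.
move=> p T X XX f y y' alpha alpha' Y Y' p2 p3 sc T0 rX nX cy ny ca na Cf nf.
move=> /rde_solution_sol_map[cY sY].
(* Finite, but not bounded by the data: the control of [Y] is normalised by [m] and keeps mass at
   most 2, so neither the pieces nor the final constant depend on [m]. *)
pose m := fine (ctrl_norm T p X Y Y') + 1.
have m0 : 0 < m by rewrite ltr_wpDl// fine_ge0// ctrl_norm_ge0.
have nY : (ctrl_norm T p X Y Y' <= m%:E)%E.
  by rewrite -[leLHS](fineK (ctrl_norm_fin cY)) lee_fin lerDl.
have c0 : 0 < c by lra.
have [_ [W [cW WT [[HX Ha] [Hy HY]]]]] := control_propertyI
  (control_propertyI (rough_path_property p2 p3 T0 c0 rX nX)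
     (controlled_property p2 T0 c0 ca na))
  (control_propertyI (controlled_property p2 T0 c0 cy ny)
     (controlled_property p2 T0 m0 cY nY)).
have WC : W T <= C by rewrite /C; lra.
have cC : c <= C by rewrite /C; lra.
have c3C : 3 * c <= C by rewrite /C; lra.
have HXC := holder_rough_le cC HX.
have hc u v : 0 <= u -> u <= v -> v <= T -> hw p W u v <= C by exact: (hw_mass p2 cW WC C1).
have fC : C2bd C f (frechet f) (frechet (frechet f)).
  by apply: C2bd_Cb => //; apply: (le_trans nf); rewrite lee_fin.
have HaC := ctl_bd_le c3C cC cC Ha; have HyC := ctl_bd_le c3C cC cC Hy.
have [tau [t0 tN tm tT Ht]] := Hpieces p T W p2 p3 T0 cW WC.
have Y'C u : 0 <= u -> u <= T -> `|Y' u| <= 2 * C.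
  move=> u0 uT; have Du : `[0, T]%classic u by rewrite /= in_itv /= u0.
  have [-> _] := sY u u0 uT; have [h1 _ _ _] := Hy u u Du Du (lexx u).
  have [[_ h2 _] _] := C2bd_Cb Cf nf.
  apply: (le_trans (ler_normD _ _)); have := h2 (joint alpha Y u); rewrite /C; lra.
have HYC : ctl_bd p W X `[0, T] (2 * C) m m Y Y'.
  move=> u v Du Dv uv; have [_ _ h3 h4] := HY u v Du Dv uv.
  by move: Du Dv; rewrite /= !in_itv /= => /andP[u0 uT] /andP[v0 vT]; split => //; exact: Y'C.
have H := apriori_bound C1 (le_trans dc cC) (le_trans nc cC) HXC hc (le_trans sc cC) fC HaC HyC
  t0 tN tm tT eps0 Heps Ht (ltW m0) sY HYC.
have G0 : 0 <= G by apply: patch_const_ge0 (closed_const_ge0 C1); lra.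
apply: (le_trans (ctl_bd_ctrl_norm p2 T0 G0 G0 cW WC C1 H)).
by rewrite lee_fin ler_norm.
Qed.

Lemma stability_uniform_control (c : R) : 1 <= c -> d%:R <= c -> (e + k)%:R <= c ->
  exists2 M : R, 0 <= M & forall (p T E : R) W (X : R -> 'rV[R]_d) XX
    (f f1 : 'rV[R]_(e + k) -> linmx R d 1 k) Df Df1 D2f D2f1 D3f
    y y' y1 y1' alpha alpha' alpha1 alpha1' Y Y' Y1 Y1',
  sew_const (3 / p) <= c -> holder_rough c p T W X XX -> W T <= c -> 0 <= E ->
  C3bd c f Df D2f D3f ->
  C2bd E (fun z => f z - f1 z) (fun z => Df z - Df1 z) (fun z => D2f z - D2f1 z) ->
  ctl_bd p W X `[0, T] c c c alpha alpha' -> ctl_bd p W X `[0, T] c c c alpha1 alpha1' ->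
  ctl_bd p W X `[0, T] (3 * E) E E (fun t => alpha t - alpha1 t) (fun t => alpha' t - alpha1' t) ->
  `|alpha 0 - alpha1 0| <= E ->
  ctl_bd p W X `[0, T] (3 * E) E E (fun t => y t - y1 t) (fun t => y' t - y1' t) ->
  `|y 0 - y1 0| <= E ->
  ctl_bd p W X `[0, T] c c c Y Y' -> ctl_bd p W X `[0, T] c c c Y1 Y1' ->
  sol_map T X XX f Df alpha alpha' y y' Y Y' Y Y' ->
  sol_map T X XX f1 Df1 alpha1 alpha1' y1 y1' Y1 Y1' Y1 Y1' ->
  ctl_bd p W X `[0, T] (M * E) (M * E) (M * E) (fun t => Y t - Y1 t) (fun t => Y' t - Y1' t).
Proof.
move=> c1 dc nc; have C0 := le_trans ler01 c1.
have [_ [_ L1]] := diff_lam_ge c1.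
have [N [eps [eps0 Heps Hpieces]]] := uniform_pieces L1 C0.
(* [L * E] bounds [alpha - alpha1] on [0, T]: its value at 0 plus an increment of at most
   [(c ^+ 2 * (3 * E) + E * c) * c]. *)
pose L := 1 + 3 * c ^+ 3 + c ^+ 2.
have q0 : 0 <= c ^+ 3 by rewrite exprn_ge0.
have q1 : 1 <= c ^+ 3 by rewrite exprn_ege1.
have q2 : 0 <= c ^+ 2 by rewrite exprn_ge0.
exists (stab_const c N.+1 * L).
  by rewrite mulr_ge0// ?stab_const_ge0// /L; lra.
move=> p T E W X XX f f1 Df Df1 D2f D2f1 D3f y y' y1 y1' al al' al1 al1' Y Y' Y1 Y1'.
move=> sc HX WT E0 fc gE Ha Ha1 Hda da0 Hdy dy0 HY HY1 sY sY1.
have [[[p2 p3] T0] cW] := (hr_p HX, hr_T HX, hr_W HX).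
have hc u v : 0 <= u -> u <= v -> v <= T -> hw p W u v <= c by exact: (hw_mass p2 cW WT c1).
have EL : E <= L * E by rewrite ler_peMl// /L; lra.
have E3L : 3 * E <= L * E by apply: ler_wpM2r => //; rewrite /L; lra.
have da u : 0 <= u -> u <= T -> `|al u - al1 u| <= L * E.
  move=> u0 uT.
  have D0 : `[0, T]%classic 0 by rewrite /= in_itv /= lexx ltW.
  have Du : `[0, T]%classic u by rewrite /= in_itv /= u0.
  have [h1 _ _ h4] := Hda 0 u D0 Du u0.
  have h5 := incr_norm c1 dc HX (lexx 0) u0 uT E0 h1 h4.
  have -> : al u - al1 u = (al 0 - al1 0) + (al u - al1 u - (al 0 - al1 0)) by mxring.
  apply: (le_trans (ler_normD _ _)); apply: (le_trans (lerD da0 h5)).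
  have h6 := hc 0 u (lexx 0) u0 uT; have h7 := hw_ge0 p W 0 u; set h := hw p W 0 u in h6 h7 *.
  have : (c ^+ 2 * (3 * E) + E * h) * h <= (c ^+ 2 * (3 * E) + E * c) * c.
    apply: ler_pM => //; first by rewrite addr_ge0// !mulr_ge0.
    by rewrite lerD2l ler_wpM2l.
  rewrite /L; lra.
have gE' : C2bd (L * E) (fun z => f z - f1 z) (fun z => Df z - Df1 z) (fun z => D2f z - D2f1 z).
  have H m m' (g : 'rV[R]_(e + k) -> 'M[R]_(m, m')) Dg : C1bd E g Dg -> C1bd (L * E) g Dg.
    by move=> [? h1 h2]; split => // x; exact: le_trans EL.
  by case: gE => h1 h2; split; exact: H.
have [tau [t0 tN tm tT Ht]] := Hpieces p T W p2 p3 T0 cW WT.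
have := stability_pieces c1 dc nc HX hc sc fc gE' Ha Ha1 (ctl_bd_le E3L EL EL Hda) da
  (ctl_bd_le E3L EL EL Hdy) (le_trans dy0 EL) HY HY1 sY sY1 t0 tm tT eps0 Heps Ht (i := N.+1).
by rewrite tN !mulrA.
Qed.

End UniformBounds.

Lemma max_bounds {R : realType} (x y z : R) : exists b, [/\ x <= b, y <= b & z <= b].
Proof. by exists (Num.max x (Num.max y z)); rewrite !le_max !lexx !orbT. Qed.

Lemma sum_bounds {R : realType} (x1 x2 x3 x4 x5 x6 x7 : R) :
  0 <= x1 -> 0 <= x2 -> 0 <= x3 -> 0 <= x4 -> 0 <= x5 -> 0 <= x6 -> 0 <= x7 ->
  let s := x1 + x2 + x3 + x4 + x5 + x6 + x7 + 1 in
  [/\ 1 <= s, x6 <= s, x7 <= s & x5 <= s] /\ [/\ x1 <= s, x2 <= s, x3 <= s & x4 <= s].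
Proof. by move=> h1 h2 h3 h4 h5 h6 h7 s; rewrite /s; split; split; lra. Qed.

(** * Existence, uniqueness and constants as functions of the data *)

Section Wellposedness.
Context {R : realType}.
Variables (d e k : nat) (p T : R) (X : R -> 'rV[R]_d) (XX : R -> R -> 'M[R]_d).
Variables (f : 'rV[R]_(e + k) -> linmx R d 1 k).
Variables (y : R -> 'rV[R]_k) (y' : R -> linmx R d 1 k).
Variables (alpha : R -> 'rV[R]_e) (alpha' : R -> linmx R d 1 e).
Hypotheses (p2 : 2 < p) (p3 : p < 3) (T0 : 0 < T) (rX : rough_path T p X XX).
Hypotheses (cy : controlled T p X y y') (ca : controlled T p X alpha alpha') (Cf : Cb 3 f).

Lemma rough_norm_ge0 : (0 <= rough_norm T p X XX)%E.
Proof. by rewrite adde_ge0// var2_ge0. Qed.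

Lemma rough_norm_fin : rough_norm T p X XX \is a fin_num.
Proof.
have [[_ h1] [h2 _ _] _] := rX.
by rewrite ge0_fin_numE ?rough_norm_ge0// /rough_norm lte_add_pinfty.
Qed.

Lemma le_fine_bound (x : \bar R) (B : R) : x \is a fin_num -> fine x <= B -> (x <= B%:E)%E.
Proof. by move=> fx; rewrite -[in X in _ -> X](fineK fx) lee_fin. Qed.

Let c0 : R := fine (rough_norm T p X XX) + fine (ctrl_norm T p X y y') +
  fine (ctrl_norm T p X alpha alpha') + fine (Cbnorm 3 f) + sew_const (3 / p) + d%:R + (e + k)%:R + 1.

Let c0_ge : [/\ 1 <= c0, d%:R <= c0, (e + k)%:R <= c0 & sew_const (3 / p) <= c0] /\
  [/\ (rough_norm T p X XX <= c0%:E)%E, (ctrl_norm T p X y y' <= c0%:E)%E,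
      (ctrl_norm T p X alpha alpha' <= c0%:E)%E & (Cbnorm 3 f <= c0%:E)%E].
Proof.
have h1 := fine_ge0 rough_norm_ge0; have h2 := fine_ge0 (ctrl_norm_ge0 T p X y y').
have h3 := fine_ge0 (ctrl_norm_ge0 T p X alpha alpha'); have h4 := fine_ge0 (Cbnorm_ge0 3 f).
have h5 : 0 <= sew_const (3 / p).
  by apply: sew_const_ge0; rewrite ltr_pdivlMr ?mul1r ?p3//; apply: lt_trans p2.
have [? [k1 k2 k3 k4]] := sum_bounds h1 h2 h3 h4 h5 (ler0n R d) (ler0n R (e + k)).
split; first by [].
split.
- exact: le_fine_bound rough_norm_fin k1.
- exact: le_fine_bound (ctrl_norm_fin cy) k2.
- exact: le_fine_bound (ctrl_norm_fin ca) k3.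
- exact: le_fine_bound (Cbnorm_fin Cf) k4.
Qed.

Lemma rde_existence : exists Y Y', rde_solution T p X XX f y y' alpha alpha' Y Y'.
Proof.
have [[c1 dc nc sc] [nX ny na nf]] := c0_ge; move: c0 c1 dc nc sc nX ny na nf => c c1 dc nc sc nX ny na nf.
have cp : 0 < c by lra.
have [_ [W [cW WT [HX [Ha Hy]]]]] := control_propertyI (rough_path_property p2 p3 T0 cp rX nX)
  (control_propertyI (controlled_property p2 T0 cp ca na) (controlled_property p2 T0 cp cy ny)).
(* Three controls of mass at most 2. *)
pose C := 6 * c.
have C1 : 1 <= C by rewrite /C; lra.
have WC : W T <= C by rewrite /C; lra.
have cC : c <= C by rewrite /C; lra.
have c3C : 3 * c <= C by rewrite /C; lra.
have hc B u v : C <= B -> 0 <= u -> u <= v -> v <= T -> hw p W u v <= B.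
  by move=> CB; apply: (hw_mass p2 cW (le_trans WC CB) (le_trans C1 CB)).
have fc B : C <= B -> C3bd B f (frechet f) (frechet (frechet f)) (frechet (frechet (frechet f))).
  move=> CB; apply: C3bd_Cb => //; apply: (le_trans nf); rewrite lee_fin.
  exact: le_trans CB.
have HaB B : C <= B -> ctl_bd p W X `[0, T] B B B alpha alpha'.
  by move=> CB; apply: ctl_bd_le Ha; [exact: le_trans CB|exact: le_trans CB|exact: le_trans CB].
have HyC := ctl_bd_le c3C cC cC Hy.
have L1 : 1 <= 8 * base_const C by have := base_const_ge1 C1; lra.
have [N [eps [eps0 Heps Hpieces]]] := uniform_pieces L1 (le_trans ler01 C1).
have [tau [t0 tN tm tT Ht]] := Hpieces p T W p2 p3 T0 cW WC.
have HXC := holder_rough_le cC HX.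
have fC2 : C2bd C f (frechet f) (frechet (frechet f)).
  by case: (fc C (lexx C)) => h1 [h2 _]; split.
have [Y [Y' [HY0 HYn HYc]]] := picard_sequence C1 (le_trans dc cC) (le_trans nc cC) HXC
  (fun u v => hc C u v (lexx C)) (le_trans sc cC) fC2 (HaB C (lexx C)) HyC
  t0 tN tm tT eps0 Heps Ht.
pose G := global_const C N.
have G0 : 0 <= G by apply: patch_const_ge0 (closed_const_ge0 C1); lra.
pose B := 2 * C + G.
have CB : C <= B by rewrite /B; lra.
have GB : G <= B by rewrite /B; lra.
have B1 : 1 <= B by lra.
(* The contraction needs pieces that are short with respect to the bound [B] of the
   iterates, itself obtained on longer pieces. *)
have [_ [_ L2]] := diff_lam_ge B1.
have [N2 [eps2 [eps20 Heps2 Hpieces2]]] := uniform_pieces L2 (le_trans ler01 B1).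
have [tau2 [s0 sN sm sT Hs]] := Hpieces2 p T W p2 p3 T0 cW (le_trans WC CB).
have HYB n : ctl_bd p W X `[0, T] B B B (Y n) (Y' n).
  by apply: ctl_bd_le (HYc n); [rewrite /B; lra|exact: GB|exact: GB].
have dB : d%:R <= B by apply: le_trans dc _; lra.
have nB : (e + k)%:R <= B by apply: le_trans nc _; lra.
have sB : sew_const (3 / p) <= B by apply: le_trans sc _; lra.
have HXB := holder_rough_le CB HXC.
have [Z [Z' [sZ HZ]]] := picard_limit B1 dB nB HXB
  (fun u v => hc B u v CB) sB (fc B CB) (HaB B CB) HY0 HYn HYB
  s0 sN sm sT eps20 Heps2 Hs.
exists Z, Z'; apply/rde_solution_sol_map; split => //.
have B0 : 0 <= B by lra.
exact: (ctl_bd_controlled p2 T0 cW B1 dB HXB (fun u v => hc B u v CB) B0 B0 HZ).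
Qed.

Lemma rde_uniqueness (Y Z : R -> 'rV[R]_k) (Y' Z' : R -> linmx R d 1 k) :
  rde_solution T p X XX f y y' alpha alpha' Y Y' ->
  rde_solution T p X XX f y y' alpha alpha' Z Z' ->
  forall t, 0 <= t <= T -> Y t = Z t /\ Y' t = Z' t.
Proof.
move=> /rde_solution_sol_map[cY sY] /rde_solution_sol_map[cZ sZ] t /andP[t0 tT].
have [[c1 dc nc sc] [nX ny na nf]] := c0_ge; move: c0 c1 dc nc sc nX ny na nf => c c1 dc nc sc nX ny na nf.
have [b [cb nY nZ]] : exists b, [/\ c <= b, (ctrl_norm T p X Y Y' <= b%:E)%E &
    (ctrl_norm T p X Z Z' <= b%:E)%E].
  have [b [cb b1 b2]] := max_bounds c (fine (ctrl_norm T p X Y Y')) (fine (ctrl_norm T p X Z Z')).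
  by exists b; split; [exact: cb|exact: le_fine_bound (ctrl_norm_fin cY) b1|
    exact: le_fine_bound (ctrl_norm_fin cZ) b2].
have cp : 0 < c by lra.
have bp : 0 < b by lra.
have [_ [W [cW WT [[HX Ha] [HY HZ]]]]] := control_propertyI
  (control_propertyI (rough_path_property p2 p3 T0 cp rX nX) (controlled_property p2 T0 cp ca na))
  (control_propertyI (controlled_property p2 T0 bp cY nY) (controlled_property p2 T0 bp cZ nZ)).
(* Four controls of mass at most 2; the constant depends on the two solutions, which is harmless
   because the stability bound is multiplied by [E = 0]. *)
pose C := 8 * b.
have cC : c <= C by rewrite /C; lra.
have c3C : 3 * c <= C by rewrite /C; lra.
have bC : b <= C by rewrite /C; lra.
have b3C : 3 * b <= C by rewrite /C; lra.
have C1 : 1 <= C by lra.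
have WC : W T <= C by rewrite /C; lra.
have fC : C3bd C f (frechet f) (frechet (frechet f)) (frechet (frechet (frechet f))).
  by apply: C3bd_Cb => //; apply: (le_trans nf); rewrite lee_fin.
have g0 := C2bd_self_diff (conj fC.1 fC.2.1).
have selfB m (V : R -> 'rV[R]_m) V' : ctl_bd p W X `[0, T] (3 * 0) 0 0
    (fun t => V t - V t) (fun t => V' t - V' t).
  by rewrite mulr0; exact: ctl_bd_self_diff.
have self0 m (V : R -> 'rV[R]_m) : `|V 0 - V 0| <= 0 by rewrite subrr normr0.
have [M M0 H] := @stability_uniform_control R d e k C C1 (le_trans dc cC) (le_trans nc cC).
have := H p T 0 W X XX f f (frechet f) (frechet f) _ _ _ y y' y y' alpha alpha' alpha alpha'
  Y Y' Z Z' (le_trans sc cC) (holder_rough_le cC HX) WC (lexx 0) fC g0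
  (ctl_bd_le c3C cC cC Ha) (ctl_bd_le c3C cC cC Ha) (selfB _ alpha alpha') (self0 _ alpha)
  (selfB _ y y') (self0 _ y) (ctl_bd_le b3C bC bC HY) (ctl_bd_le b3C bC bC HZ) sY sZ.
rewrite mulr0 => HD.
have D0 : `[0, T]%classic 0 by rewrite /= in_itv /= lexx ltW.
have Dt : `[0, T]%classic t by rewrite /= in_itv /= t0.
have [A1 A2 _ A4] := HD 0 t D0 Dt t0.
have := incr_norm C1 (le_trans dc cC) (holder_rough_le cC HX) (lexx 0) t0 tT (lexx 0) A1 A4.
rewrite (sol_map_start T0 sY) (sol_map_start T0 sZ) subrr subr0 mulr0 mul0r addr0 mul0r.
rewrite !normr_le0 in A2 *; move=> A5.
by split; apply/eqP; rewrite -subr_eq0.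
Qed.

End Wellposedness.

Lemma stability_uniform {R : realType} (d e k : nat) (c0 : R) : 1 <= c0 -> d%:R <= c0 -> (e + k)%:R <= c0 ->
  exists2 M : R, 0 <= M & forall (p T E : R) (X : R -> 'rV[R]_d) XX
    (f f1 : 'rV[R]_(e + k) -> linmx R d 1 k)
    y y' y1 y1' alpha alpha' alpha1 alpha1' Y Y' Y1 Y1',
  2 < p -> p < 3 -> sew_const (3 / p) <= c0 -> 0 < T -> 0 < E ->
  rough_path T p X XX -> (rough_norm T p X XX <= c0%:E)%E ->
  controlled T p X y y' -> controlled T p X y1 y1' ->
  controlled T p X alpha alpha' -> controlled T p X alpha1 alpha1' ->
  (ctrl_norm T p X alpha alpha' <= c0%:E)%E -> (ctrl_norm T p X alpha1 alpha1' <= c0%:E)%E ->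
  Cb 3 f -> Cb 3 f1 -> (Cbnorm 3 f <= c0%:E)%E ->
  rde_solution T p X XX f y y' alpha alpha' Y Y' ->
  rde_solution T p X XX f1 y1 y1' alpha1 alpha1' Y1 Y1' ->
  (ctrl_norm T p X Y Y' <= c0%:E)%E -> (ctrl_norm T p X Y1 Y1' <= c0%:E)%E ->
  (`|y 0 - y1 0|%:E <= E%:E)%E -> (ctrl_dist T p X y y' y1 y1' <= E%:E)%E ->
  (Cbnorm 2 (fun z => (f z - f1 z)%R) <= E%:E)%E ->
  (`|alpha 0 - alpha1 0|%:E <= E%:E)%E -> (ctrl_dist T p X alpha alpha' alpha1 alpha1' <= E%:E)%E ->
  (`|Y 0 - Y1 0|%:E + ctrl_dist T p X Y Y' Y1 Y1' <= (M * E)%:E)%E.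
Proof.
(* Seven controls of mass at most 2. The last two measure the differences of the data and are
   normalised by [E], whence [0 < E]. *)
move=> c01 dc nc; pose C := 14 * c0.
have C1 : 1 <= C by rewrite /C; lra.
have cC : c0 <= C by rewrite /C; lra.
have c3C : 3 * c0 <= C by rewrite /C; lra.
have [M M0 H] := @stability_uniform_control R d e k C C1 (le_trans dc cC) (le_trans nc cC).
(* The first 1 is for the initial values, which are those of [y] and [y1]; the rest converts the
   bounds [M * E] with respect to a control of mass at most [C] into variation norms. *)
exists (1 + M * (1 + 2 * C)); first by rewrite addr_ge0// mulr_ge0//; lra.
move=> p T E X XX f f1 y y' y1 y1' al al' al1 al1' Y Y' Y1 Y1' p2 p3 sc T0 E0 rX nX cy cy1 ca ca1.
move=> na na1 Cf Cf1 nf /rde_solution_sol_map[cY sY] /rde_solution_sol_map[cY1 sY1] nY nY1.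
rewrite !lee_fin => dy0 ny nff da0 nda.
have cp : 0 < c0 by lra.
have [_ [W [cW WT [[[HX Ha] [Ha1 HY]] [HY1 [Hda Hdy]]]]]] := control_propertyI
  (control_propertyI
    (control_propertyI (rough_path_property p2 p3 T0 cp rX nX) (controlled_property p2 T0 cp ca na))
    (control_propertyI (controlled_property p2 T0 cp ca1 na1) (controlled_property p2 T0 cp cY nY)))
  (control_propertyI (controlled_property p2 T0 cp cY1 nY1)
    (control_propertyI (controlled_diff_property p2 T0 E0 ca ca1 nda)
       (controlled_diff_property p2 T0 E0 cy cy1 ny))).
have WC : W T <= C by rewrite /C; lra.
have fC : C3bd C f (frechet f) (frechet (frechet f)) (frechet (frechet (frechet f))).
  by apply: C3bd_Cb => //; apply: (le_trans nf); rewrite lee_fin.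
have gE := C2bd_CbB (CbW Cf) (CbW Cf1) nff.
have HD := H p T E W X XX f f1 _ _ _ _ _ y y' y1 y1' al al' al1 al1' Y Y' Y1 Y1'
  (le_trans sc cC) (holder_rough_le cC HX) WC (ltW E0) fC gE
  (ctl_bd_le c3C cC cC Ha) (ctl_bd_le c3C cC cC Ha1) Hda da0 Hdy dy0
  (ctl_bd_le c3C cC cC HY) (ctl_bd_le c3C cC cC HY1) sY sY1.
have ME : 0 <= M * E by rewrite mulr_ge0// ltW.
rewrite ctrl_dist_norm (sol_map_start T0 sY) (sol_map_start T0 sY1).
have -> : (1 + M * (1 + 2 * C)) * E = E + (M * E + M * E * C + M * E * C) by ring.
rewrite EFinD; apply: leeD; first by rewrite lee_fin.
exact: (ctl_bd_ctrl_norm p2 T0 ME ME cW WC C1 HD).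
Qed.

Lemma nat_sum_mono {R : realType} (M : nat -> R) m n : (forall i, 0 <= M i) -> (m <= n)%N ->
  \sum_(i < m) M i <= \sum_(i < n) M i.
Proof.
move=> M0 mn; rewrite -!(big_mkord xpredT M) (big_cat_nat (leq0n m) mn) /= lerDl.
by apply: sumr_ge0.
Qed.

Lemma nat_sum_ge {R : realType} (M : nat -> R) n : (forall i, 0 <= M i) -> M n <= \sum_(i < n.+1) M i.
Proof. by move=> M0; rewrite big_ord_recr /= lerDr sumr_ge0. Qed.

Lemma sum5_bounds {R : realType} (x1 x2 x3 x4 x5 n c : R) :
  0 <= x1 -> 0 <= x2 -> 0 <= x3 -> 0 <= x4 -> 0 <= x5 ->
  x1 + x2 + x3 + x4 + x5 < n -> n <= c -> [/\ x1 <= c, x2 <= c, x4 <= c & x5 <= c].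
Proof. by move=> *; split; lra. Qed.

Lemma sum6_bounds {R : realType} (x1 x2 x3 x4 x5 x6 n c : R) :
  0 <= x1 -> 0 <= x2 -> 0 <= x3 -> 0 <= x4 -> 0 <= x5 -> 0 <= x6 ->
  x1 + x2 + x3 + x4 + x5 + x6 < n -> n <= c ->
  [/\ x1 <= c, x2 <= c, x3 <= c, x4 <= c & x5 <= c /\ x6 <= c].
Proof. by move=> *; split; [..|split]; lra. Qed.

Lemma apriori_function {R : realType} (d k e : nat) (p : R) : 2 < p < 3 ->
    exists Kp : R -> R -> R -> R -> R -> R,
      [/\ (forall x1 x2 x3 x4 x5,
             0 <= x1 -> 0 <= x2 -> 0 <= x3 -> 0 <= x4 -> 0 <= x5 ->
             0 <= Kp x1 x2 x3 x4 x5),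
          (forall x1 x2 x3 x4 x5 z1 z2 z3 z4 z5,
             0 <= x1 <= z1 -> 0 <= x2 <= z2 -> 0 <= x3 <= z3 ->
             0 <= x4 <= z4 -> 0 <= x5 <= z5 ->
             Kp x1 x2 x3 x4 x5 <= Kp z1 z2 z3 z4 z5) &
          forall (T : R) (X : R -> 'rV[R]_d) (XX : R -> R -> 'M[R]_d)
            (y : R -> 'rV[R]_k) (y' : R -> linmx R d 1 k)
            (alpha : R -> 'rV[R]_e) (alpha' : R -> linmx R d 1 e)
            (f : 'rV[R]_(e + k) -> linmx R d 1 k)
            (Y : R -> 'rV[R]_k) (Y' : R -> linmx R d 1 k),
          0 < T -> rough_path T p X XX ->
          controlled T p X y y' -> controlled T p X alpha alpha' -> Cb 3 f ->
          rde_solution T p X XX f y y' alpha alpha' Y Y' ->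
          (ctrl_norm T p X Y Y' <=
             (Kp (fine (Cbnorm 2 f)) (fine (ctrl_norm T p X y y'))
                 (fine (var1 T p alpha)) (fine (ctrl_norm T p X alpha alpha'))
                 (fine (rough_norm T p X XX)))%:E)%E].
Proof.
move=> /andP[p2 p3].
pose c (n : nat) : R := n.+1%:R + (d%:R + (e + k)%:R + sew_const (3 / p)).
have s0 : 0 <= sew_const (3 / p).
  by apply: sew_const_ge0; rewrite ltr_pdivlMr ?mul1r ?p3//; apply: lt_trans p2.
have cn n : [/\ 1 <= c n, d%:R <= c n, (e + k)%:R <= c n, sew_const (3 / p) <= c n & n.+1%:R <= c n].
  have h1 : 1 <= n.+1%:R :> R by rewrite ler1n.
  have h2 := ler0n R d; have h3 := ler0n R (e + k).
  by rewrite /c; split; lra.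
have HM n : exists M : R, 0 <= M /\ forall (T : R) (X : R -> 'rV[R]_d) XX
    (f : 'rV[R]_(e + k) -> linmx R d 1 k) y y' alpha alpha' Y Y', 0 < T -> rough_path T p X XX ->
    (rough_norm T p X XX <= (c n)%:E)%E ->
    controlled T p X y y' -> (ctrl_norm T p X y y' <= (c n)%:E)%E ->
    controlled T p X alpha alpha' -> (ctrl_norm T p X alpha alpha' <= (c n)%:E)%E ->
    Cb 2 f -> (Cbnorm 2 f <= (c n)%:E)%E ->
    rde_solution T p X XX f y y' alpha alpha' Y Y' -> (ctrl_norm T p X Y Y' <= M%:E)%E.
  have [h1 h2 h3 h4 _] := cn n; have [M M0 H] := @apriori_uniform R d e k (c n) h1 h2 h3.
  by exists M; split => // T X XX f y y' al al' Y Y'; exact: H.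
have [M {}HM] := choice HM.
have M0 n : 0 <= M n by case: (HM n).
(* The constants [M n] are given for integer sizes [n] and need not be monotone; their partial sums
   are, and the last term is the one for an integer size exceeding all arguments. *)
exists (fun x1 x2 x3 x4 x5 => \sum_(i < (Num.truncn (x1 + x2 + x3 + x4 + x5)).+1) M i); split.
- by move=> *; apply: sumr_ge0.
- move=> x1 x2 x3 x4 x5 z1 z2 z3 z4 z5 /andP[_ h1] /andP[_ h2] /andP[_ h3] /andP[_ h4] /andP[_ h5].
  by apply: nat_sum_mono => //; rewrite ltnS; apply: le_truncn; rewrite !lerD.
move=> T X XX y y' al al' f Y Y' T0 rX cy ca Cf sY.
have k1 := fine_ge0 (Cbnorm_ge0 2 f); have k2 := fine_ge0 (ctrl_norm_ge0 T p X y y').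
have k3 := fine_ge0 (var2_ge0 T p (incr al)); have k4 := fine_ge0 (ctrl_norm_ge0 T p X al al').
have k5 := fine_ge0 (rough_norm_ge0 p T X XX).
set n := Num.truncn _.
have [_ _ _ _ h0] := cn n.
have [b1 b2 b4 b5] := sum5_bounds k1 k2 k3 k4 k5 (truncnS_gt _) h0.
have [_ H] := HM n.
have := H T X XX f y y' al al' Y Y' T0 rX (le_fine_bound (rough_norm_fin rX) b5)
  cy (le_fine_bound (ctrl_norm_fin cy) b2) ca (le_fine_bound (ctrl_norm_fin ca) b4)
  (CbW Cf) (le_fine_bound (Cbnorm_fin (CbW Cf)) b1) sY.
by move/le_trans; apply; rewrite lee_fin; exact: nat_sum_ge.
Qed.

Lemma near_lt {R : realType} (U : topologicalType) (g : U -> R) (z : U) (b : R) :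
  continuous g -> g z < b -> \forall w \near z, g w < b.
Proof. by move=> cg; apply: cvgr_lt; exact: cg. Qed.

Lemma stability_function {R : realType} (d k e : nat) :
  exists C : (R * R * R * R * R * R)%type -> R,
    locally_bounded_on
      [set z : (R * R * R * R * R * R)%type | let: (p, F, A, B, K, x) := z in
         [/\ 2 < p < 3, 0 <= F, 0 <= A, 0 <= B & 0 < K /\ 0 <= x]] C /\
    forall (p T K : R) (X : R -> 'rV[R]_d) (XX : R -> R -> 'M[R]_d)
      (y y1 : R -> 'rV[R]_k) (y' y1' : R -> linmx R d 1 k)
      (alpha alpha1 : R -> 'rV[R]_e) (alpha' alpha1' : R -> linmx R d 1 e)
      (f f1 : 'rV[R]_(e + k) -> linmx R d 1 k)
      (Y Y1 : R -> 'rV[R]_k) (Y' Y1' : R -> linmx R d 1 k),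
    2 < p < 3 -> 0 < T -> 0 < K -> rough_path T p X XX ->
    controlled T p X y y' -> controlled T p X y1 y1' ->
    controlled T p X alpha alpha' -> controlled T p X alpha1 alpha1' ->
    Cb 3 f -> Cb 3 f1 ->
    rde_solution T p X XX f y y' alpha alpha' Y Y' ->
    rde_solution T p X XX f1 y1 y1' alpha1 alpha1' Y1 Y1' ->
    (ctrl_norm T p X Y Y' <= K%:E)%E -> (ctrl_norm T p X Y1 Y1' <= K%:E)%E ->
    (`|Y 0 - Y1 0|%:E + ctrl_dist T p X Y Y' Y1 Y1' <=
       (C (p, Num.max (fine (Cbnorm 3 f)) (fine (Cbnorm 3 f1)),
           fine (ctrl_norm T p X alpha alpha'),
           fine (ctrl_norm T p X alpha1 alpha1'),
           K, fine (rough_norm T p X XX)))%:E *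
       (`|y 0 - y1 0|%:E + ctrl_dist T p X y y' y1 y1'
        + Cbnorm 2 (fun z => (f z - f1 z)%R)
        + `|alpha 0 - alpha1 0|%:E
        + ctrl_dist T p X alpha alpha' alpha1 alpha1'))%E.
Proof.
pose c (n : nat) : R := n.+1%:R + (d%:R + (e + k)%:R).
have cn n : [/\ 1 <= c n, d%:R <= c n, (e + k)%:R <= c n & n.+1%:R <= c n].
  have h1 : 1 <= n.+1%:R :> R by rewrite ler1n.
  have h2 := ler0n R d; have h3 := ler0n R (e + k).
  by rewrite /c; split; lra.
have HM n : exists M : R, 0 <= M /\ forall (p T E : R) (X : R -> 'rV[R]_d) XX
    (f f1 : 'rV[R]_(e + k) -> linmx R d 1 k)
    y y' y1 y1' alpha alpha' alpha1 alpha1' Y Y' Y1 Y1',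
  2 < p -> p < 3 -> sew_const (3 / p) <= c n -> 0 < T -> 0 < E ->
  rough_path T p X XX -> (rough_norm T p X XX <= (c n)%:E)%E ->
  controlled T p X y y' -> controlled T p X y1 y1' ->
  controlled T p X alpha alpha' -> controlled T p X alpha1 alpha1' ->
  (ctrl_norm T p X alpha alpha' <= (c n)%:E)%E -> (ctrl_norm T p X alpha1 alpha1' <= (c n)%:E)%E ->
  Cb 3 f -> Cb 3 f1 -> (Cbnorm 3 f <= (c n)%:E)%E ->
  rde_solution T p X XX f y y' alpha alpha' Y Y' ->
  rde_solution T p X XX f1 y1 y1' alpha1 alpha1' Y1 Y1' ->
  (ctrl_norm T p X Y Y' <= (c n)%:E)%E -> (ctrl_norm T p X Y1 Y1' <= (c n)%:E)%E ->
  (`|y 0 - y1 0|%:E <= E%:E)%E -> (ctrl_dist T p X y y' y1 y1' <= E%:E)%E ->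
  (Cbnorm 2 (fun z => (f z - f1 z)%R) <= E%:E)%E ->
  (`|alpha 0 - alpha1 0|%:E <= E%:E)%E -> (ctrl_dist T p X alpha alpha' alpha1 alpha1' <= E%:E)%E ->
  (`|Y 0 - Y1 0|%:E + ctrl_dist T p X Y Y' Y1 Y1' <= (M * E)%:E)%E.
  have [h1 h2 h3 _] := cn n; have [M M0 H] := @stability_uniform R d e k (c n) h1 h2 h3.
  by exists M.
have [M {}HM] := choice HM.
have M0 n : 0 <= M n by case: (HM n).
pose sz (q F A B K x : R) := sew_const (3 / q) + F + A + B + K + x.
(* The sewing constant counts as part of the size, since [p] is now an argument. The leading 1 makes
   [C] positive, so that it can be divided by and an infinite right-hand side stays infinite. *)
pose C (z : R * R * R * R * R * R) : R := let: (q, F, A, B, K, x) := z in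
  1 + \sum_(i < (Num.truncn (sz q F A B K x)).+1) M i.
exists C; split.
  move=> [[[[[q F] A] B] K] x] [/andP[q2 q3] F0 A0 B0 [K0 x0]].
  (* The exponent [(q + 3) / 2] lies strictly between [q] and 3, so its sewing constant dominates
     those of the exponents near [q]. *)
  pose S := sz ((q + 3) / 2) (F + 1) (A + 1) (B + 1) (K + 1) (x + 1).
  exists (1 + \sum_(i < (Num.truncn S).+1) M i).
  have cfst (U V : topologicalType) : continuous (@fst U V) by move=> w; exact: cvg_fst.
  have csnd (U V : topologicalType) : continuous (@snd U V) by move=> w; exact: cvg_snd.
  have comp (U V Z : topologicalType) (g : U -> V) (h : V -> Z) :
      continuous g -> continuous h -> continuous (h \o g).
    by move=> cg ch w; apply: continuous_comp; [exact: cg|exact: ch].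
  have n1 : \forall w \near (q, F, A, B, K, x), w.1.1.1.1.1 < (q + 3) / 2.
    apply: (near_lt (g := fun w : R * R * R * R * R * R => w.1.1.1.1.1)) => /=; last lra.
    exact: (comp _ _ _ _ _ (comp _ _ _ _ _ (comp _ _ _ _ _ (comp _ _ _ _ _ (cfst _ _) (cfst _ _)) (cfst _ _)) (cfst _ _)) (cfst _ _)).
  have n2 : \forall w \near (q, F, A, B, K, x), w.1.1.1.1.2 < F + 1.
    apply: (near_lt (g := fun w : R * R * R * R * R * R => w.1.1.1.1.2)) => /=; last lra.
    exact: (comp _ _ _ _ _ (comp _ _ _ _ _ (comp _ _ _ _ _ (comp _ _ _ _ _ (cfst _ _) (cfst _ _)) (cfst _ _)) (cfst _ _)) (csnd _ _)).
  have n3 : \forall w \near (q, F, A, B, K, x), w.1.1.1.2 < A + 1.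
    apply: (near_lt (g := fun w : R * R * R * R * R * R => w.1.1.1.2)) => /=; last lra.
    exact: (comp _ _ _ _ _ (comp _ _ _ _ _ (comp _ _ _ _ _ (cfst _ _) (cfst _ _)) (cfst _ _)) (csnd _ _)).
  have n4 : \forall w \near (q, F, A, B, K, x), w.1.1.2 < B + 1.
    apply: (near_lt (g := fun w : R * R * R * R * R * R => w.1.1.2)) => /=; last lra.
    exact: (comp _ _ _ _ _ (comp _ _ _ _ _ (cfst _ _) (cfst _ _)) (csnd _ _)).
  have n5 : \forall w \near (q, F, A, B, K, x), w.1.2 < K + 1.
    apply: (near_lt (g := fun w : R * R * R * R * R * R => w.1.2)) => /=; last lra.
    exact: (comp _ _ _ _ _ (cfst _ _) (csnd _ _)).
  have n6 : \forall w \near (q, F, A, B, K, x), w.2 < x + 1.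
    apply: (near_lt (g := fun w : R * R * R * R * R * R => w.2)) => /=; last lra.
    exact: csnd.
  have key w : w.1.1.1.1.1 < (q + 3) / 2 -> w.1.1.1.1.2 < F + 1 -> w.1.1.1.2 < A + 1 ->
      w.1.1.2 < B + 1 -> w.1.2 < K + 1 -> w.2 < x + 1 -> 2 < w.1.1.1.1.1 ->
      `|C w| <= 1 + \sum_(i < (Num.truncn S).+1) M i.
    case: w => [[[[[q' F'] A'] B'] K'] x'] /= k1 k2 k3 k4 k5 k6 q2'.
    rewrite ger0_norm ?addr_ge0 ?sumr_ge0// lerD2l; apply: nat_sum_mono => //.
    rewrite ltnS; apply: le_truncn.
    have h := sew_const_le q2' (ltW k1) ltac:(lra).
    rewrite /S /sz; lra.
  near=> w => Dw; apply: key; [near: w; exact: n1|near: w; exact: n2|near: w; exact: n3|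
    near: w; exact: n4|near: w; exact: n5|near: w; exact: n6|].
  by move: Dw; case: (w) => [[[[[q' F'] A'] B'] K'] x'] [/andP[]].
move=> p T K X XX y y1 y' y1' al al1 al' al1' f f1 Y Y1 Y' Y1' /andP[p2 p3] T0 K0 rX cy cy1 ca ca1.
move=> Cf Cf1 sY sY1 nY nY1.
set rr := (X in (_ <= _ * X)%E).
have e1 : (0 <= `|y 0 - y1 0|%:E)%E by rewrite lee_fin.
have e2 : (0 <= ctrl_dist T p X y y' y1 y1')%E by rewrite ctrl_dist_norm ctrl_norm_ge0.
have e3 : (0 <= Cbnorm 2 (fun z => (f z - f1 z)%R))%E by exact: Cbnorm_ge0.
have e4 : (0 <= `|al 0 - al1 0|%:E)%E by rewrite lee_fin.
have e5 : (0 <= ctrl_dist T p X al al' al1 al1')%E by rewrite ctrl_dist_norm ctrl_norm_ge0.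
have rr0 : (0 <= rr)%E by exact: (adde_ge0 (adde_ge0 (adde_ge0 (adde_ge0 e1 e2) e3) e4) e5).
have h1 : 0 <= sew_const (3 / p).
  by apply: sew_const_ge0; rewrite ltr_pdivlMr ?mul1r ?p3//; apply: lt_trans p2.
have h2 := fine_ge0 (Cbnorm_ge0 3 f).
have h3 := fine_ge0 (ctrl_norm_ge0 T p X al al'); have h4 := fine_ge0 (ctrl_norm_ge0 T p X al1 al1').
have h5 := fine_ge0 (rough_norm_ge0 p T X XX).
rewrite /C; set n := Num.truncn _; set Cn : R := 1 + _.
have Cn0 : 0 < Cn by rewrite ltr_pwDl// sumr_ge0.
have [->|rrfin] := eqVneq rr +oo%E; first by rewrite gt0_muley ?lte_fin// leey.
have rrE : rr = (fine rr)%:E by rewrite fineK// ge0_fin_numE// lt_neqAle rrfin leey.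
have [_ _ _ h0] := cn n.
have le_maxl (a b : R) : a <= Num.max a b by rewrite le_max lexx.
have F0 := le_trans h2 (le_maxl _ (fine (Cbnorm 3 f1))).
have [b1 b2 b3 b4 [b5 b6]] : [/\ sew_const (3 / p) <= c n,
    Num.max (fine (Cbnorm 3 f)) (fine (Cbnorm 3 f1)) <= c n, fine (ctrl_norm T p X al al') <= c n,
    fine (ctrl_norm T p X al1 al1') <= c n & K <= c n /\ fine (rough_norm T p X XX) <= c n].
  exact: (sum6_bounds h1 F0 h3 h4 (ltW K0) h5 (truncnS_gt _) h0).
have b2' := le_trans (le_maxl _ _) b2.
have KE : (K%:E <= (c n)%:E)%E by rewrite lee_fin.
have Mn : M n <= Cn by apply: (le_trans (nat_sum_ge n M0)); rewrite /Cn lerDr.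
(* The uniform estimate requires a positive [E], whereas the distance [rr] of the data may be 0: it
   is applied with a slightly larger [E], and [eps] is arbitrary. *)
rewrite rrE -EFinM; apply/lee_addgt0Pr => eps eps0.
pose eta := eps / Cn; have eta0 : 0 < eta by rewrite divr_gt0.
have E0 : 0 < fine rr + eta by rewrite ltr_wpDl// fine_ge0.
have rrle : (rr <= (fine rr + eta)%:E)%E by rewrite rrE lee_fin /= lerDl ltW.
have [f1234 r5] := lee_sum_parts (adde_ge0 (adde_ge0 (adde_ge0 e1 e2) e3) e4) e5 rrle.
have [f123 r4] := lee_sum_parts (adde_ge0 (adde_ge0 e1 e2) e3) e4 f1234.
have [f12 r3] := lee_sum_parts (adde_ge0 e1 e2) e3 f123.
have [r1 r2] := lee_sum_parts e1 e2 f12.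
have [_ H] := HM n.
have := H p T (fine rr + eta) X XX f f1 y y' y1 y1' al al' al1 al1' Y Y' Y1 Y1' p2 p3 b1 T0 E0 rX
  (le_fine_bound (rough_norm_fin rX) b6) cy cy1 ca ca1 (le_fine_bound (ctrl_norm_fin ca) b3)
  (le_fine_bound (ctrl_norm_fin ca1) b4) Cf Cf1 (le_fine_bound (Cbnorm_fin Cf) b2') sY sY1
  (le_trans nY KE) (le_trans nY1 KE) r1 r2 r3 r4 r5.
move/le_trans; apply; rewrite -EFinD lee_fin.
apply: (le_trans (ler_wpM2r (ltW E0) Mn)).
by rewrite mulrDr lerD2l /eta mulrCA mulfV ?mulr1// gt_eqF.
Unshelve. all: by end_near. Qed.

Theorem corollary3p3 (R : realType) (d k e : nat) :
  (* existence and uniqueness *)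
  (forall (p T : R) (X : R -> 'rV[R]_d) (XX : R -> R -> 'M[R]_d)
      (y : R -> 'rV[R]_k) (y' : R -> linmx R d 1 k)
      (alpha : R -> 'rV[R]_e) (alpha' : R -> linmx R d 1 e)
      (f : 'rV[R]_(e + k) -> linmx R d 1 k),
    2 < p < 3 -> 0 < T -> rough_path T p X XX ->
    controlled T p X y y' -> controlled T p X alpha alpha' -> Cb 3 f ->
    (exists (Y : R -> 'rV[R]_k) (Y' : R -> linmx R d 1 k),
        rde_solution T p X XX f y y' alpha alpha' Y Y') /\
    (forall (Y Z : R -> 'rV[R]_k) (Y' Z' : R -> linmx R d 1 k),
        rde_solution T p X XX f y y' alpha alpha' Y Y' ->
        rde_solution T p X XX f y y' alpha alpha' Z Z' ->
        forall t, 0 <= t <= T -> Y t = Z t /\ Y' t = Z' t)) /\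
  (* a priori bound *)
  (forall p : R, 2 < p < 3 ->
    exists Kp : R -> R -> R -> R -> R -> R,
      [/\ (forall x1 x2 x3 x4 x5,
             0 <= x1 -> 0 <= x2 -> 0 <= x3 -> 0 <= x4 -> 0 <= x5 ->
             0 <= Kp x1 x2 x3 x4 x5),
          (forall x1 x2 x3 x4 x5 z1 z2 z3 z4 z5,
             0 <= x1 <= z1 -> 0 <= x2 <= z2 -> 0 <= x3 <= z3 ->
             0 <= x4 <= z4 -> 0 <= x5 <= z5 ->
             Kp x1 x2 x3 x4 x5 <= Kp z1 z2 z3 z4 z5) &
          forall (T : R) (X : R -> 'rV[R]_d) (XX : R -> R -> 'M[R]_d)
            (y : R -> 'rV[R]_k) (y' : R -> linmx R d 1 k)
            (alpha : R -> 'rV[R]_e) (alpha' : R -> linmx R d 1 e)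
            (f : 'rV[R]_(e + k) -> linmx R d 1 k)
            (Y : R -> 'rV[R]_k) (Y' : R -> linmx R d 1 k),
          0 < T -> rough_path T p X XX ->
          controlled T p X y y' -> controlled T p X alpha alpha' -> Cb 3 f ->
          rde_solution T p X XX f y y' alpha alpha' Y Y' ->
          (ctrl_norm T p X Y Y' <=
             (Kp (fine (Cbnorm 2 f)) (fine (ctrl_norm T p X y y'))
                 (fine (var1 T p alpha)) (fine (ctrl_norm T p X alpha alpha'))
                 (fine (rough_norm T p X XX)))%:E)%E]) /\
  (* stability *)
  (exists C : (R * R * R * R * R * R)%type -> R,
    locally_bounded_on
      [set z : (R * R * R * R * R * R)%type | let: (p, F, A, B, K, x) := z in
         [/\ 2 < p < 3, 0 <= F, 0 <= A, 0 <= B & 0 < K /\ 0 <= x]] C /\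
    forall (p T K : R) (X : R -> 'rV[R]_d) (XX : R -> R -> 'M[R]_d)
      (y y1 : R -> 'rV[R]_k) (y' y1' : R -> linmx R d 1 k)
      (alpha alpha1 : R -> 'rV[R]_e) (alpha' alpha1' : R -> linmx R d 1 e)
      (f f1 : 'rV[R]_(e + k) -> linmx R d 1 k)
      (Y Y1 : R -> 'rV[R]_k) (Y' Y1' : R -> linmx R d 1 k),
    2 < p < 3 -> 0 < T -> 0 < K -> rough_path T p X XX ->
    controlled T p X y y' -> controlled T p X y1 y1' ->
    controlled T p X alpha alpha' -> controlled T p X alpha1 alpha1' ->
    Cb 3 f -> Cb 3 f1 ->
    rde_solution T p X XX f y y' alpha alpha' Y Y' ->
    rde_solution T p X XX f1 y1 y1' alpha1 alpha1' Y1 Y1' ->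
    (ctrl_norm T p X Y Y' <= K%:E)%E -> (ctrl_norm T p X Y1 Y1' <= K%:E)%E ->
    (`|Y 0 - Y1 0|%:E + ctrl_dist T p X Y Y' Y1 Y1' <=
       (C (p, Num.max (fine (Cbnorm 3 f)) (fine (Cbnorm 3 f1)),
           fine (ctrl_norm T p X alpha alpha'),
           fine (ctrl_norm T p X alpha1 alpha1'),
           K, fine (rough_norm T p X XX)))%:E *
       (`|y 0 - y1 0|%:E + ctrl_dist T p X y y' y1 y1'
        + Cbnorm 2 (fun z => (f z - f1 z)%R)
        + `|alpha 0 - alpha1 0|%:E
        + ctrl_dist T p X alpha alpha' alpha1 alpha1'))%E).
Proof.
split; last by split; [exact: apriori_function|exact: stability_function].
move=> p T X XX y y' alpha alpha' f /andP[p2 p3] T0 rX cy ca Cf.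
by split; [exact: rde_existence|move=> Y Z Y' Z'; exact: rde_uniqueness].
Qed.
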